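(* There is an absolute constant $\lambda_0>0$ such that the following holds for every $\lambda>\lambda_0$. Let $\pm m_\star$ be the Bayes-optimal local minimizers of $\mathcal{F}_{\mathrm{TAP}}$ (defined in the context, for a fixed sufficiently small $\iota=\iota(\lambda)>0$, and existing with probability approaching $1$). Then with probability approaching $1$ as $n\to\infty$, $\pm m_\star$ are the global minimizers of $\mathcal{F}_{\mathrm{TAP}}$. Furthermore, they are the only critical points of $\mathcal{F}_{\mathrm{TAP}}$ in the domain $$\mathcal{S}=\Big\{m\in(-1,1)^n:\ \mathcal{F}_{\mathrm{TAP}}(m)<-\lambda^2/3\Big\}.$$
   Context: $\mathbb{Z}_2$-synchronization model: $x\in\{-1,+1\}^n$ has i.i.d. coordinates uniform on $\{-1,+1\}$, and one observes $Y=\frac{\lambda}{n}xx^\top+W$, where $W\sim\mathrm{GOE}(n)$ is independent of $x$: $W$ is symmetric, with independent entries $W_{ii}\sim\mathcal{N}(0,2/n)$ and $W_{ij}\sim\mathcal{N}(0,1/n)$ for $i<j$. For $m\in(-1,1)^n$, let $Q(m)=\|m\|_2^2/n$. The TAP free energy is $$\mathcal{F}_{\mathrm{TAP}}(m)=-\frac{\lambda}{2n}\langle m,Ym\rangle-\frac1n\sum_{i=1}^n\mathsf{h}(m_i)-\frac{\lambda^2}{4}[1-Q(m)]^2,$$ where $\mathsf{h}(u)=-\frac{1+u}{2}\log\frac{1+u}{2}-\frac{1-u}{2}\log\frac{1-u}{2}$. It satisfies $\mathcal{F}_{\mathrm{TAP}}(m)=\mathcal{F}_{\mathrm{TAP}}(-m)$.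 Let $\widehat{X}_{\mathrm{Bayes}}=\mathbb{E}[xx^\top\mid Y]$. It is known that for every $\lambda>1$ and every sufficiently small fixed $\iota>0$ (depending on $\lambda$, not on $n$), with probability approaching $1$ as $n\to\infty$ there is a critical point and local minimizer $m_\star$ of $\mathcal{F}_{\mathrm{TAP}}$ with $\frac1{n^2}\|m_\star m_\star^\top-\widehat{X}_{\mathrm{Bayes}}\|_F^2<\iota$, and it is the unique critical point satisfying this inequality, up to $\pm$ sign. The points $\pm m_\star$ are called the Bayes-optimal local minimizers. *)

(* Defs.v *)
From mathcomp Require Import all_boot all_order all_algebra.
From mathcomp Require Import all_classical all_reals all_analysis.

Set Implicit Arguments.
Unset Strict Implicit.
Unset Printing Implicit Defensive.
Import Order.TTheory GRing.Theory Num.Theory.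
Import numFieldNormedType.Exports.

Local Open Scope classical_set_scope.
Local Open Scope ring_scope.

Section Probability.
Context {R : realType} {d : measure_display} {T : measurableType d}
  (P : probability T R).

Definition sigma_of (I : Type) (X : I -> T -> R) : set (set T) :=
  <<s \bigcup_i preimage_set_system setT (X i) measurable >>.

(* Mutual independence of the subfamily of the X i with i in D. *)
Definition mutually_independent (I : finType) (D : {set I})
    (X : I -> {RV P >-> R}) : Prop :=
  forall (J : {set I}) (B : I -> set R), J \subset D ->
    (forall i, measurable (B i)) ->
    P (\big[setI/setT]_(i in J) (X i @^-1` B i)) =
    (\prod_(i in J) P (X i @^-1` B i))%E.

Definition independent_systems (G H : set (set T)) : Prop :=
  forall A B, G A -> H B -> P (A `&` B) = (P A * P B)%E.

(* g is a version of the conditional expectation E[f | G]; G is meant to be a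
   sub-sigma-algebra of the measurable sets and f to be integrable. *)
Definition is_cond_expectation (G : set (set T)) (f g : T -> R) : Prop :=
  [/\ forall B : set R, measurable B -> G (g @^-1` B),
      P.-integrable setT (EFin \o g) &
      forall A, G A ->
        (\int[P]_(w in A) (g w)%:E = \int[P]_(w in A) (f w)%:E)%E].

End Probability.

(* The event need not be measurable: its inner probability tends to 1. *)
Definition with_probability_approaching_1 (R : realType)
    (d : nat -> measure_display) (T : forall n, measurableType (d n))
    (P : forall n, probability (T n) R) (G : forall n, set (T n)) : Prop :=
  exists E : forall n, set (T n),
    [/\ forall n, measurable (E n),
        forall n, E n `<=` G n &
        P n (E n) @[n --> \oo] --> 1%E].

Section Model.
Context {R : realType} {d : measure_display} {T : measurableType d}
  (P : probability T R) (n : nat).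
Implicit Types (x : 'I_n -> {RV P >-> R}) (W : 'I_n -> 'I_n -> {RV P >-> R}).

Definition iid_Rademacher x : Prop :=
  mutually_independent [set: 'I_n]%SET x /\
  forall i, P [set w | x i w = 1] = (2^-1)%:E /\
            P [set w | x i w = -1] = (2^-1)%:E.

(* The second parameter of normal_prob is the standard deviation. *)
Definition GOE W : Prop :=
  [/\ forall i j w, W i j w = W j i w,
      mutually_independent [set p : 'I_n * 'I_n | (p.1 <= p.2)%N]%SET
        (fun p => W p.1 p.2),
      forall i (A : set R), measurable A ->
        distribution P (W i i) A = normal_prob 0 (Num.sqrt (2 / n%:R)) A &
      forall i j : 'I_n, (i < j)%N -> forall A : set R, measurable A ->
        distribution P (W i j) A = normal_prob 0 (Num.sqrt (1 / n%:R)) A].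

Definition Z2_sync x W : Prop :=
  [/\ iid_Rademacher x, GOE W &
      independent_systems P (sigma_of x)
        (sigma_of (fun p : 'I_n * 'I_n => W p.1 p.2))].

Definition observation (lambda : R) x W (w : T) : 'M[R]_n :=
  \matrix_(i, j) (lambda / n%:R * (x i w * x j w) + W i j w).

(* Xhat is a version of E[x x^T | Y], entry by entry. *)
Definition is_Bayes_estimator x (Y Xhat : T -> 'M[R]_n) : Prop :=
  forall i j, is_cond_expectation P
    (sigma_of (fun (p : 'I_n * 'I_n) w => Y w p.1 p.2))
    (fun w => x i w * x j w) (fun w => Xhat w i j).

End Model.

Section TAP.
Context {R : realType} {n : nat}.
Implicit Types (m : 'cV[R]_n) (A Y : 'M[R]_n).

Definition cube : set 'cV[R]_n := [set m | forall i, -1 < m i 0 < 1].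

Definition frobenius_sq A : R := \sum_i \sum_j A i j ^+ 2.

Definition Qnorm m : R := (\sum_i m i 0 ^+ 2) / n%:R.

Definition bin_entropy (u : R) : R :=
  - ((1 + u) / 2) * ln ((1 + u) / 2) - (1 - u) / 2 * ln ((1 - u) / 2).

Definition TAP (lambda : R) Y m : R :=
  - (lambda / (2 * n%:R)) * (m^T *m (Y *m m)) 0 0
  - n%:R^-1 * (\sum_i bin_entropy (m i 0))
  - lambda ^+ 2 / 4 * (1 - Qnorm m) ^+ 2.

(* TAP is a total function with junk values off the cube, so domain membership
   is part of each notion below. *)
Definition critical_point (lambda : R) Y m : Prop :=
  cube m /\ is_diff m (TAP lambda Y) (cst 0).

Definition local_minimizer (lambda : R) Y m : Prop :=
  cube m /\
  \forall m' \near m, cube m' -> TAP lambda Y m <= TAP lambda Y m'.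

Definition global_minimizer (lambda : R) Y m : Prop :=
  cube m /\ forall m', cube m' -> TAP lambda Y m <= TAP lambda Y m'.

Definition Bayes_close (iota : R) (Xhat : 'M[R]_n) m : Prop :=
  (n%:R ^+ 2)^-1 * frobenius_sq (m *m m^T - Xhat) < iota.

Definition Bayes_optimal_minimizer (lambda iota : R) Y (Xhat : 'M[R]_n) m :
    Prop :=
  [/\ critical_point lambda Y m, local_minimizer lambda Y m,
      Bayes_close iota Xhat m &
      forall m', critical_point lambda Y m' -> Bayes_close iota Xhat m' ->
        m' = m \/ m' = - m].

Definition low_energy (lambda : R) Y : set 'cV[R]_n :=
  [set m | cube m /\ TAP lambda Y m < - (lambda ^+ 2 / 3)].

End TAP.

(* Main.v *)
From HB Require Import structures.
Require Import Defs.
From mathcomp Require Import all_boot all_order all_algebra.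
From mathcomp Require Import all_classical all_reals all_analysis.
From mathcomp Require Import finmap measurable_realfun ring lra.
Import Order.TTheory GRing.Theory Num.Theory.
Import numFieldNormedType.Exports.
Set Implicit Arguments.
Unset Strict Implicit.
Unset Printing Implicit Defensive.
Local Open Scope classical_set_scope.
Local Open Scope ring_scope.
(** For large [lambda] the landscape can be controlled without computing
    expected numbers of critical points. Write [a = <x, m> / n] and
    [Q = |m|^2 / n]. The gradient vanishes at [m] exactly when, for all [i],
    [atanh (m_i) = lambda^2 a x_i + lambda (W m)_i - lambda^2 (1 - Q) m_i].

    Energy. On the event that [W] has operator norm [O(1)], the free energy is
    [- lambda^2 (a^2 / 2 + (1 - Q)^2 / 4) + O(lambda)], and [a^2 <= Q]. Since
    the bracket is below [1/3] when [a^2 < 9/16], an energy below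
    [- lambda^2 / 3] forces [|a| >= 3/4] ([low_energy_overlap]).

    Alignment. By symmetry let [a >= 3/4]. The drift [lambda^2 (a - (1 - Q))]
    then pushes [x_i m_i] within [2 exp (- 2 lambda^2 / 5)] of 1, unless
    [x_i (W m)_i] is below [- lambda / 10]. Split [W m = W x + W (m - x)]. As
    [W] is independent of [x], few rows of [W x] are that large; the number of
    such rows of [W (m - x)] is at most a small multiple of [|m - x|^2], itself
    controlled by the number of misaligned coordinates. This bootstrap leaves
    at most [lambda^-6 n / 2] misaligned coordinates
    ([stationary_concentrates]).

    Uniqueness. Subtract the equations of two such points and pair with the
    difference [v]. As [atanh] has slope at least [1/4] everywhere and a huge
    slope on the aligned coordinates, the only danger is
    [lambda <v_S, W v_S>] on the set [S] of misaligned coordinates; but [W] has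
    norm at most [1 / (8 lambda)] on every block of [lambda^-6 n] coordinates.
    So [v = 0] ([stationary_unique]).

    Existence. The entropy has infinite slope at the boundary of the cube, so a
    global minimizer exists inside ([tap_minimizer_exists]); comparison with
    [9/10 x] shows that its energy is below the threshold. It is therefore the
    only critical point of large overlap, up to sign, and the theorem reduces
    to showing that [mstar] has a large overlap with [x] ([landscape]).

    The Bayes estimator. A sign vector [mu] maximizing [mu^T Y mu] has squared
    overlap [1 - O(1 / lambda)] with [x] as soon as [W] has norm [O(1)]. It is
    a function of [Y], so integrating [mu^T Xhat mu] over the event on which a
    given [mu] is the first maximizer replaces [Xhat] by [x x^T] there. Hence
    [mu^T Xhat mu] is close to [n^2] with probability tending to 1, and not
    only on average ([Bayes_estimator_aligned]); closeness of [m m^T] to [Xhat]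
    then gives [<mu, m>^2] close to [n^2].

    The events about [W] follow from one estimate, the moment generating
    function of [u^T W v] ([GOE_mgf]), by union bounds over integer grids and
    over subsets of coordinates. *)

(** * Expectations of products of independent variables *)

Section Independence.
Import HBNNSimple.
Context {R : realType} {d : measure_display} {T : measurableType d}
  {d' : measure_display} {T' : measurableType d'}.

(** Both sides are linear and monotonically continuous in [f], and the
    hypothesis is the case of indicators. *)
Lemma integral_comp_density (mu : {measure set T -> \bar R})
    (nu : {measure set T' -> \bar R}) (X : T -> T') (G : T -> R) (c : R)
    (f : T' -> R) :
  measurable_fun setT X -> measurable_fun setT G -> (forall w, 0 <= G w) ->
  0 <= c ->
  (forall B, measurable B ->
    (\int[mu]_w (\1_B (X w) * G w)%:E = c%:E * nu B)%E) ->
  measurable_fun setT f -> (forall y, 0 <= f y) ->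
  (\int[mu]_w (f (X w) * G w)%:E = c%:E * \int[nu]_y (f y)%:E)%E.
Proof.
move=> mX mG G0 c0 H mf f0; have /measurable_EFinP mEf := mf.
pose a := nnsfun_approx measurableT mEf.
have aD m n y : (m <= n)%N -> a m y <= a n y.
  by move=> mn; have /lefP := nd_nnsfun_approx measurableT mEf mn; apply.
have acvg y : (a n y)%:E @[n --> \oo] --> (f y)%:E.
  by apply: (cvg_nnsfun_approx measurableT mEf) => // z _; rewrite lee_fin.
have aX n : measurable_fun setT (fun w => a n (X w)).
  by apply: measurableT_comp.
(* [f] is approximated from below by simple functions. *)
have step n : (\int[mu]_w (a n (X w) * G w)%:E = c%:E * \int[nu]_y (a n y)%:E)%E.
  pose s := fset_set (range (a n)).
  have s0 (i : 'I_(size s)) : 0 <= s`_i.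
    have : s`_i \in s by exact: mem_nth.
    by rewrite in_fset_set//; move=> /set_mem[y _ <-].
  have mi i : measurable (a n @^-1` [set s`_i]) by exact: measurable_sfunP.
  have mIX i : measurable_fun setT
      (fun w => \1_(a n @^-1` [set s`_i]) (X w) * G w).
    by apply: measurable_funM => //; apply: measurableT_comp => //; exact: measurable_indic.
  under eq_integral => w _.
    rewrite fimfunEord mulr_suml -sumEFin.
    under eq_bigr do rewrite -mulrA EFinM.
    over.
  rewrite ge0_integral_sum//; last 2 first.
  - by move=> i; apply: measurable_funeM; exact/measurable_EFinP.
  - by move=> i w _; rewrite mule_ge0 ?lee_fin// mulr_ge0.
  under eq_bigr => i _.
    rewrite ge0_integralZl_EFin//; [|by move=> w _; rewrite lee_fin mulr_ge0|
      exact/measurable_EFinP].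
    rewrite H// muleCA.
    over.
  rewrite -ge0_sume_distrr; last by move=> i _; rewrite mule_ge0// lee_fin.
  congr (c%:E * _)%E.
  under [RHS]eq_integral => w _.
    rewrite fimfunEord -sumEFin.
    under eq_bigr do rewrite EFinM.
    over.
  rewrite ge0_integral_sum//; last 2 first.
  - by move=> i; apply: measurable_funeM; exact/measurable_EFinP/measurable_indic.
  - by move=> i w _; rewrite mule_ge0 ?lee_fin.
  apply: eq_bigr => i _; rewrite ge0_integralZl_EFin//.
    by rewrite integral_indic// setIT.
  exact/measurable_EFinP/measurable_indic.
have L : (\int[mu]_w (a n (X w) * G w)%:E @[n --> \oo] -->
          \int[mu]_w (f (X w) * G w)%:E)%E.
  have := @cvg_monotone_convergence _ _ _ mu _ measurableT
    (fun n w => (a n (X w) * G w)%:E).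
  have E : (fun x => limn (fun n => (a n (X x) * G x)%:E)) =
           (fun w => (f (X w) * G w)%:E).
    apply/funext => w; apply/cvg_lim => //.
    rewrite [X in _ --> X]EFinM.
    under eq_fun do rewrite EFinM.
    under eq_fun do rewrite muleC.
    rewrite muleC; exact: cvgeZl.
  rewrite /= E; apply.
  - by move=> n; apply/measurable_EFinP/measurable_funM.
  - by move=> n w _; rewrite lee_fin mulr_ge0.
  - by move=> w _ m n mn; rewrite lee_fin ler_wpM2r// aD.
have L2 : (\int[nu]_w (a n w)%:E @[n --> \oo] --> \int[nu]_w (f w)%:E)%E.
  have := @cvg_monotone_convergence _ _ _ nu _ measurableT
    (fun n w => (a n w)%:E).
  have E : (fun x => limn (fun n => (a n x)%:E)) = (fun w => (f w)%:E).
    by apply/funext => w; apply/cvg_lim.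
  rewrite /= E; apply.
  - by move=> n; apply/measurable_EFinP.
  - by move=> n w _; rewrite lee_fin.
  - by move=> w _ m n mn; rewrite lee_fin aD.
rewrite (funext step) in L.
apply: (cvg_unique _ L) => //.
exact: cvgeZl.
Qed.
End Independence.
Section IndependentFamilies.
Context {R : realType} {d : measure_display} {T : measurableType d}
  (P : probability T R) (I : finType).

(** The product rule for sets passes to functions one index at a time: with
    all other factors fixed, both sides are integrals of [h a], so that
    [integral_comp_density] reduces [h a] to an indicator. *)
Lemma expectation_prod_independent (D : {set I}) (X : I -> {RV P >-> R})
    (h : I -> R -> R) (e : I -> R) :
  mutually_independent D X ->
  (forall i, measurable_fun setT (h i)) -> (forall i y, 0 <= h i y) ->
  (forall i, \int[P]_w (h i (X i w))%:E = (e i)%:E)%E ->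
  (\int[P]_w (\prod_(i in D) h i (X i w))%:E = (\prod_(i in D) e i)%:E)%E.
Proof.
move=> indep.
(* Outside [s] the functions are indicators; [s] grows by one index per step. *)
suff main (s : seq I) : forall (h : I -> R -> R) (e : I -> R),
    (forall i, measurable_fun setT (h i)) -> (forall i y, 0 <= h i y) ->
    (forall i, \int[P]_w (h i (X i w))%:E = (e i)%:E)%E ->
    (forall i, i \notin s -> exists2 B, measurable B & h i = \1_B) ->
    (\int[P]_w (\prod_(i in D) h i (X i w))%:E = (\prod_(i in D) e i)%:E)%E.
  move=> mh h0 he; apply: (main (enum I)) => // i.
  by rewrite mem_enum inE.
elim: s => [{}h {}e mh h0 he hB|a s IH {}h {}e mh h0 he hB].
  have /choice[B HB] : forall i, exists B, measurable B /\ h i = \1_B.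
    by move=> i; have [B mB hiB] := hB i isT; exists B.
  have mXB i : measurable (X i @^-1` B i).
    by rewrite -[X in measurable X]setTI; apply: measurable_funP => //; case: (HB i).
  have hE i w : h i (X i w) = \1_(X i @^-1` B i) w.
    by rewrite (HB i).2 !indicE; congr (_%:R).
  have eE i : P (X i @^-1` B i) = (e i)%:E.
    rewrite -he; under eq_integral do rewrite hE.
    by rewrite integral_indic// setIT.
  transitivity (P (\big[setI/setT]_(i in D) (X i @^-1` B i))).
    rewrite -[in RHS](setIT (\big[_/_]_(_ in _) _)) -integral_indic//.
      apply: eq_integral => w _; congr (_%:E).
      under eq_bigr do rewrite hE.
      rewrite -big_filter -[in RHS]big_filter.
      elim: [seq _ <- _ | _] => [|i r IH]; first by rewrite !big_nil indicT.
      by rewrite !big_cons IH indicI.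
    rewrite -big_filter; elim: [seq _ <- _ | _] => [|i r IH].
      by rewrite big_nil.
    by rewrite big_cons; exact: measurableI.
  rewrite indep//; last by move=> i; case: (HB i).
  by rewrite -prodEFin; apply: eq_bigr => i _; exact: eE.
have upd (B : set R) : measurable B -> 
  (\int[P]_w (\prod_(i in D) (if i == a then \1_B else h i) (X i w))%:E =
   (\prod_(i in D) (if i == a then fine (P (X a @^-1` B)) else e i))%:E)%E.
  move=> mB.
  apply: (IH (fun i => if i == a then \1_B else h i)).
  - by move=> i; case: eqP => // _; exact: measurable_indic.
  - by move=> i y; case: eqP.
  - move=> i; case: eqP => [->|_]; last exact: he.
    have mXB : measurable (X a @^-1` B).
      by rewrite -[X in measurable X]setTI; exact: measurable_funP.
    rewrite fineK ?fin_num_measure// -[in RHS](setIT (_ @^-1` _)).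
    by rewrite -integral_indic.
  - move=> i ins; case: eqP => [_|/eqP ia]; first by exists B.
    by apply: hB; rewrite inE negb_or ia.
case: (boolP (a \in D)) => aD; last first.
  have iD i : i \in D -> (i == a) = false.
    by move=> iD; apply: contraNF aD => /eqP <-.
  have := upd setT measurableT.
  under eq_integral => w _ do under eq_bigr => i /iD -> do over.
  by under [in RHS]eq_bigr => i /iD -> do over.
rewrite (bigD1 a)//= mulrC.
under eq_integral do rewrite (bigD1 a)//=.
have step := @integral_comp_density R d T _ _ P (distribution P (X a)) (X a)
   (fun w => \prod_(i in D | i != a) h i (X i w))
   (\prod_(i in D | i != a) e i) (h a).
rewrite [LHS]step//.
- rewrite EFinM; congr (_ * _)%E.
  rewrite ge0_integral_distribution//= ?he//.
    exact/measurable_EFinP.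
  by move=> y; rewrite lee_fin.
- under eq_fun do rewrite -big_filter.
  by apply: measurable_prod => i _; exact: measurableT_comp.
- by move=> w; apply: prodr_ge0.
- apply: prodr_ge0 => i _; rewrite -lee_fin -he; apply: integral_ge0 => w _.
  by rewrite lee_fin.
move=> B mB; have := upd _ mB.
rewrite (bigD1 a)//= eqxx.
under eq_integral do rewrite (bigD1 a)//= eqxx.
under eq_integral => w _ do under eq_bigr => i /andP[_ /negbTE ->] do over.
under eq_bigr => i /andP[_ /negbTE ->] do over.
move=> ->; rewrite mulrC EFinM fineK// fin_num_measure//.
by rewrite -[X in measurable X]setTI; exact: measurable_funP.
Qed.
End IndependentFamilies.

(** * Gaussian bilinear forms *)

Section MeasurableComparisons.
Context {R : realType} {d : measure_display} {T : measurableType d}.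

Lemma measurable_set_ler (f g : T -> R) : measurable_fun setT f ->
  measurable_fun setT g -> measurable [set w | f w <= g w].
Proof.
by move=> mf mg; rewrite -[X in measurable X]setTI; exact: measurable_fun_le.
Qed.

Lemma measurable_set_ltr (f g : T -> R) : measurable_fun setT f ->
  measurable_fun setT g -> measurable [set w | f w < g w].
Proof.
move=> mf mg; rewrite (_ : [set _ | _] = ~` [set w | g w <= f w]).
  by apply: measurableC; exact: measurable_set_ler.
by apply/seteqP; split => w /=; [rewrite leNgt => ->|move/negP; rewrite -ltNge].
Qed.

End MeasurableComparisons.

Section GaussianForms.
Context {R : realType}.

(** Completing the square turns the integrand into a multiple of the normal
    density of mean [t * s ^+ 2]. *)
Lemma normal_mgf (s t : R) : s != 0 ->
  (\int[normal_prob 0 s]_y (expR (t * y))%:E = (expR (t ^+ 2 * s ^+ 2 / 2))%:E)%E.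
Proof.
move=> s0.
have mpdf m : measurable_fun setT (normal_pdf m s).
  exact: measurable_normal_pdf.
have step := @integral_comp_density R _ (measurableTypeR R) _ (measurableTypeR R)
   (@lebesgue_measure R) (normal_prob 0 s) id (normal_pdf 0 s) 1 (fun y => expR (t * y)).
rewrite mul1e in step; rewrite -step//; last 3 first.
- exact: normal_pdf_ge0.
- move=> B mB; rewrite mul1e /normal_prob/= [RHS]integral_mkcond.
  apply: eq_integral => y _; rewrite /patch indicE.
  by case: ifP; rewrite ?mul1r ?mul0r.
- by apply: measurableT_comp => //; exact: measurable_funM.
have E y : (expR (t * y) * normal_pdf 0 s y)%:E =
    ((expR (t ^+ 2 * s ^+ 2 / 2))%:E * (normal_pdf (t * s ^+ 2) s y)%:E)%E.
  rewrite -EFinM !normal_pdfE// /normal_fun !(mulrCA _ (normal_peak s)).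
  rewrite -!expRD; congr ((_ * expR _)%:E).
  by field.
under eq_integral do rewrite E.
rewrite ge0_integralZl_EFin ?expR_ge0 ?integral_normal_pdf ?mule1//.
  by move=> y _; rewrite lee_fin normal_pdf_ge0.
  by apply/measurable_EFinP; exact: mpdf.
exact: mpdf.
Qed.

Definition bil n (W : 'I_n -> 'I_n -> R) (u v : 'I_n -> R) : R :=
  \sum_i \sum_j u i * W i j * v j.

Definition nsq n (u : 'I_n -> R) : R := \sum_i u i ^+ 2.

(** Only the entries on and above the diagonal of a GOE matrix are independent:
    forms are folded onto that triangle before their expectation factors. *)
Lemma sum_upper_triangle n (a : 'I_n -> 'I_n -> R) :
  \sum_i \sum_j a i j = \sum_(p in [set p : 'I_n * 'I_n | (p.1 <= p.2)%N]%SET)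
    (if p.1 == p.2 then a p.1 p.2 else a p.1 p.2 + a p.2 p.1).
Proof.
rewrite pair_big/= (bigID (fun p : 'I_n * 'I_n => (p.1 <= p.2)%N))/=.
rewrite [X in _ + X](reindex (fun p : 'I_n * 'I_n => (p.2, p.1)))/=; last first.
  by exists (fun p => (p.2, p.1)) => -[].
rewrite [X in _ + X](_ : _ = \sum_(p : 'I_n * 'I_n | (p.1 <= p.2)%N)
   (if p.1 == p.2 then 0 else a p.2 p.1)); last first.
  rewrite big_mkcond [RHS]big_mkcond; apply: eq_bigr => -[i j] _ /=.
  by rewrite -ltnNge ltn_neqAle -val_eqE; case: eqP; case: ifP.
rewrite -big_split/=; apply: eq_big => p; first by rewrite inE.
by case: eqP; rewrite ?addr0.
Qed.

Context {d : measure_display} {T : measurableType d} (P : probability T R).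

Lemma mgf_of_normal_law (X : {RV P >-> R}) (s t : R) : s != 0 ->
  (forall A, measurable A -> distribution P X A = normal_prob 0 s A) ->
  (\int[P]_w (expR (t * X w))%:E = (expR (t ^+ 2 * s ^+ 2 / 2))%:E)%E.
Proof.
move=> s0 XA; rewrite -normal_mgf//.
have mX : measurable_fun setT X by exact: measurable_funP.
have step := @integral_comp_density R _ T _ (measurableTypeR R)
   P (normal_prob 0 s) X (cst 1) 1 (fun y => expR (t * y)).
rewrite mul1e in step; rewrite -step//.
- by under [RHS]eq_integral do rewrite /= mulr1.
- move=> B mB; rewrite mul1e; transitivity (distribution P X B).
    2: exact: XA.
  rewrite /distribution /pushforward/=.
  have mXB : measurable (X @^-1` B).
    by rewrite -[X in measurable X]setTI; exact: mX.
  rewrite -(setIT (X @^-1` B)) -integral_indic//.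
  by apply: eq_integral => w _; rewrite mulr1 !indicE.
- by apply: measurableT_comp => //; exact: measurable_funM.
Qed.

Lemma bil_upper_triangle n (W : 'I_n -> 'I_n -> R) u v :
  (forall i j, W i j = W j i) ->
  bil W u v = \sum_(p in [set p : 'I_n * 'I_n | (p.1 <= p.2)%N]%SET)
    (if p.1 == p.2 then u p.1 * v p.2 else u p.1 * v p.2 + u p.2 * v p.1)
    * W p.1 p.2.
Proof.
move=> Wsym; rewrite /bil sum_upper_triangle; apply: eq_bigr => -[i j] _ /=.
by rewrite (Wsym j i); case: eqP => _; ring.
Qed.

Lemma measurable_bil n (W : 'I_n -> 'I_n -> T -> R) u v :
  (forall i j, measurable_fun setT (W i j)) ->
  measurable_fun setT (fun w => bil (fun i j => W i j w) u v).
Proof.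
move=> mW; apply: measurable_sum => i; apply: measurable_sum => j.
by apply: measurable_funM => //; exact: measurable_funM.
Qed.

(** An off-diagonal entry of variance [1 / n] enters with coefficient
    [u_i v_j + u_j v_i], whose square is at most
    [2 (u_i v_j)^2 + 2 (u_j v_i)^2]; a diagonal entry has twice the variance.
    Both contribute at most their share of [nsq u * nsq v / n]. *)
Lemma GOE_mgf n (W : 'I_n -> 'I_n -> {RV P >-> R}) u v : (0 < n)%N -> GOE W ->
  (\int[P]_w (expR (bil (fun i j => W i j w) u v))%:E <=
   (expR (nsq u * nsq v / n%:R))%:E)%E.
Proof.
move=> n0 [Wsym Windep Wdiag Woff].
have nR : (0 : R) < n%:R by rewrite ltr0n.
pose c (p : 'I_n * 'I_n) := if p.1 == p.2 then u p.1 * v p.2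
  else if (p.1 <= p.2)%N then u p.1 * v p.2 + u p.2 * v p.1 else 0.
pose q (p : 'I_n * 'I_n) := c p ^+ 2 * (if p.1 == p.2 then 1 else 2^-1) / n%:R.
have E w : expR (bil (fun i j => W i j w) u v) =
    \prod_(p in [set p : 'I_n * 'I_n | (p.1 <= p.2)%N]%SET) expR (c p * W p.1 p.2 w).
  rewrite bil_upper_triangle// -expR_sum; congr expR; apply: eq_bigr => -[i j].
  by rewrite inE /c /= => ->.
under eq_integral do rewrite E.
rewrite (expectation_prod_independent (h := fun p y => expR (c p * y))
   (e := fun p => expR (q p)) Windep).
- rewrite lee_fin -expR_sum ler_expR.
  have -> : nsq u * nsq v = \sum_i \sum_j u i ^+ 2 * v j ^+ 2.
    by rewrite /nsq mulr_suml; apply: eq_bigr => i _; rewrite mulr_sumr.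
  rewrite sum_upper_triangle.
  rewrite mulr_suml; apply: ler_sum => -[i j]; rewrite inE /q /c /= => ij.
  rewrite ler_wpM2r// ?invr_ge0 ?ler0n// ij; case: eqP => _.
    by rewrite mulr1 exprMn.
  by have := sqr_ge0 (u i * v j - u j * v i); nra.
- by move=> p; apply: measurableT_comp => //; exact: measurable_funM.
- by move=> p y; exact: expR_ge0.
- case=> i j /=; rewrite /q /c /=; case: eqP => [->|/eqP ij].
    rewrite (@mgf_of_normal_law _ (Num.sqrt (2 / n%:R))).
    + by rewrite sqr_sqrtr ?divr_ge0 ?ler0n//; congr ((expR _)%:E); field; lra.
    + by rewrite gt_eqF// sqrtr_gt0 divr_gt0.
    + exact: Wdiag.
  case: ifP => lij; last first.
    under eq_integral do rewrite mul0r expR0.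
    rewrite integral_cst// mul1e expr0n !mul0r expR0; exact: probability_setT.
  rewrite (@mgf_of_normal_law _ (Num.sqrt (1 / n%:R))).
  + by rewrite sqr_sqrtr ?divr_ge0 ?ler0n//; congr ((expR _)%:E); field; lra.
  + by rewrite gt_eqF// sqrtr_gt0 divr_gt0.
  + by apply: Woff; rewrite ltn_neqAle lij -val_eqE in ij *; rewrite ij.
Qed.

Lemma bilZl n (W : 'I_n -> 'I_n -> R) a u v :
  bil W (fun i => a * u i) v = a * bil W u v.
Proof.
rewrite /bil mulr_sumr; apply: eq_bigr => i _; rewrite mulr_sumr.
by apply: eq_bigr => j _; rewrite !mulrA.
Qed.

Lemma nsqZ n a (u : 'I_n -> R) : nsq (fun i => a * u i) = a ^+ 2 * nsq u.
Proof. by rewrite /nsq mulr_sumr; apply: eq_bigr => i _; rewrite exprMn. Qed.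

(** Chernoff's bound; the optimal [t] depends on the use. *)
Lemma GOE_tail n (W : 'I_n -> 'I_n -> {RV P >-> R}) u v (t a : R) :
  (0 < n)%N -> GOE W -> 0 < t ->
  (P [set w | a < bil (fun i j => W i j w) u v]%R <=
   (expR (t ^+ 2 * nsq u * nsq v / n%:R - t * a))%:E)%E.
Proof.
move=> n0 HW t0.
pose f w := bil (fun i j => W i j w) u v.
have mf : measurable_fun setT f by exact: measurable_bil.
pose X : {RV P >-> R} := HB.pack_for {mfun T >-> R} f
  (isMeasurableFun.Build _ _ _ _ f mf).
apply: (@le_trans _ _ (P [set w | a <= X w]%R)).
  apply: le_measure; last by move=> w /= /ltW.
  - by apply/mem_set/measurable_set_ltr.
  - by apply/mem_set/measurable_set_ler.
apply: (le_trans (chernoff X a t0)).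
rewrite expRD EFinM; apply: lee_pmul => //.
- by apply: expectation_ge0 => w; exact: expR_ge0.
rewrite /mmt_gen_fun expectation_def.
have := GOE_mgf (fun i => t * u i) v n0 HW; rewrite nsqZ.
apply: le_trans; apply: ge0_le_integral => //.
- by move=> w _; rewrite lee_fin expR_ge0.
- by apply/measurable_EFinP; apply: measurable_funPT.
- apply/measurable_EFinP; apply: measurableT_comp => //.
  exact: measurable_bil.
- by move=> w _; rewrite lee_fin /= bilZl mulrC.
Qed.

End GaussianForms.

(** * Operator norms from integer grids *)

Section Nets.
Context {R : realType}.
Implicit Types (n L : nat).

Lemma bilDl n (W : 'I_n -> 'I_n -> R) u1 u2 v :
  bil W (fun i => u1 i + u2 i) v = bil W u1 v + bil W u2 v.
Proof.
rewrite /bil -big_split; apply: eq_bigr => i _ /=; rewrite -big_split.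
by apply: eq_bigr => j _ /=; ring.
Qed.

Lemma bilDr n (W : 'I_n -> 'I_n -> R) u v1 v2 :
  bil W u (fun i => v1 i + v2 i) = bil W u v1 + bil W u v2.
Proof.
rewrite /bil -big_split; apply: eq_bigr => i _ /=; rewrite -big_split.
by apply: eq_bigr => j _ /=; ring.
Qed.

Lemma bilZr n (W : 'I_n -> 'I_n -> R) a u v :
  bil W u (fun i => a * v i) = a * bil W u v.
Proof.
rewrite /bil mulr_sumr; apply: eq_bigr => i _; rewrite mulr_sumr.
by apply: eq_bigr => j _; ring.
Qed.

Lemma nsq_ge0 n (u : 'I_n -> R) : 0 <= nsq u.
Proof. by apply: sumr_ge0 => i _; exact: sqr_ge0. Qed.

Lemma sqr_le_nsq n (u : 'I_n -> R) i : u i ^+ 2 <= nsq u.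
Proof.
rewrite /nsq (bigD1 i)//= lerDl; apply: sumr_ge0 => j _; exact: sqr_ge0.
Qed.

Lemma nsq_eq0 n (u : 'I_n -> R) : nsq u = 0 -> forall i, u i = 0.
Proof.
move=> u0 i; apply/eqP; rewrite -sqrf_eq0 eq_le sqr_ge0 andbT -u0.
exact: sqr_le_nsq.
Qed.

(** Each integer of absolute value at most [L] has exactly one code; a second
    code for 0 would cost a factor exponential in [n] in the union bounds. *)
Definition grid_value L (t : option (bool * 'I_L)) : R :=
  if t is Some (b, j) then (if b then -1 else 1) * j.+1%:R else 0.

(** Rounding toward zero: the grid value is no longer than [y], and zero
    coordinates stay zero, so that supports are kept. *)
Lemma grid_rounding L (y : R) : y ^+ 2 <= L%:R ->
  exists t : option (bool * 'I_L),
    [/\ grid_value t ^+ 2 <= y ^+ 2, (y - grid_value t) ^+ 2 <= 1 &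
        y = 0 -> grid_value t = 0].
Proof.
move=> yL.
have /andP[k1 k2] := truncn_itv (normr_ge0 y).
case ky : (Num.truncn `|y|) k1 k2 => [|k] k1 k2.
  exists None; split => //=; rewrite ?expr0n ?sqr_ge0//= subr0.
  by rewrite -real_normK ?num_real//; have := normr_ge0 y; nra.
have kL : (k < L)%N.
  rewrite -(ler_nat R); apply: le_trans yL; rewrite -real_normK ?num_real//.
  have : (1 : R) <= k.+1%:R by rewrite ler1n.
  by nra.
exists (Some (y < 0, Ordinal kL)) => /=; case: ltrP => y0.
  move: k1 k2; rewrite (ltr0_norm y0) -[in X in _ < X]natr1.
  have := ler0n R k; rewrite -natr1 => k0 k1 k2; split; [nra|nra|lra].
move: k1 k2; rewrite (ger0_norm y0) -[in X in _ < X]natr1.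
by have := ler0n R k; rewrite -natr1 => k0 k1 k2; split; [nra|nra|lra].
Qed.

Definition supported n (S : {set 'I_n}) (u : 'I_n -> R) : Prop :=
  forall i, i \notin S -> u i = 0.

(** Rounding [sqrt L * u] errs by at most 1 on each coordinate of [S]; as
    [16 #|S| <= L], the error after rescaling has norm at most [1/4]. *)
Lemma grid_approximation n L (S : {set 'I_n}) (u : 'I_n -> R) :
  (0 < L)%N -> (16 * #|S| <= L)%N -> supported S u -> nsq u <= 1 ->
  exists (f : {ffun 'I_n -> option (bool * 'I_L)}) (r : 'I_n -> R),
    [/\ nsq (fun i => grid_value (f i)) <= L%:R,
        supported S (fun i => grid_value (f i)),
        supported S r, nsq r <= 1 &
        forall i, u i = (Num.sqrt L%:R)^-1 * grid_value (f i) + 4^-1 * r i].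
Proof.
move=> L0 SL Su u1.
have L0R : (0 : R) < L%:R by rewrite ltr0n.
pose k := Num.sqrt (L%:R : R).
have k0 : 0 < k by rewrite sqrtr_gt0.
have k2 : k ^+ 2 = L%:R by rewrite sqr_sqrtr// ler0n.
have kuL i : (k * u i) ^+ 2 <= L%:R.
  by rewrite exprMn k2 ler_piMr ?ler0n// (le_trans (sqr_le_nsq u i)).
have /choice[f Hf] := fun i => grid_rounding (kuL i).
exists [ffun i => f i], (fun i => 4 * k^-1 * (k * u i - grid_value (f i))).
have f0 i : i \notin S -> grid_value (f i) = 0.
  by move=> iS; have [_ _] := Hf i; apply; rewrite Su// mulr0.
split.
- apply: (@le_trans _ _ (k ^+ 2 * nsq u)).
    rewrite /nsq mulr_sumr; apply: ler_sum => i _; rewrite ffunE -exprMn.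
    by have [] := Hf i.
  by rewrite k2 ler_piMr// ler0n.
- by move=> i iS; rewrite ffunE f0.
- by move=> i iS; rewrite f0// Su// mulr0 subr0 mulr0.
- rewrite nsqZ /nsq (bigID (mem S))/= [X in _ * (_ + X)]big1 ?addr0; last first.
    by move=> i iS; rewrite f0// Su// mulr0 subr0 expr0n.
  apply: (@le_trans _ _ ((4 / k) ^+ 2 * \sum_(i in S) 1)).
    rewrite ler_wpM2l ?sqr_ge0//; apply: ler_sum => i _.
    by have [] := Hf i.
  rewrite sumr_const expr_div_n k2 mulrAC ler_pdivrMr// mul1r.
  by rewrite -natrX -natrM ler_nat.
- by move=> i; rewrite ffunE -/k; field; rewrite gt_eqF.
Qed.

(** Let [N] be the supremum of the form over unit vectors supported on [S].
    Replacing both arguments by grid approximations changes the value by at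
    most [N / 4 + N / 4], so [N <= t + N / 2]. *)
Lemma bil_le_of_grid n L (S : {set 'I_n}) (W : 'I_n -> 'I_n -> R) (t : R) :
  (0 < L)%N -> (16 * #|S| <= L)%N ->
  (forall f g : {ffun 'I_n -> option (bool * 'I_L)},
    nsq (fun i => grid_value (f i)) <= L%:R ->
    nsq (fun i => grid_value (g i)) <= L%:R ->
    bil W (fun i => grid_value (f i)) (fun i => grid_value (g i)) <= t * L%:R) ->
  forall u v, supported S u -> supported S v ->
    bil W u v <= 2 * t * (Num.sqrt (nsq u) * Num.sqrt (nsq v)).
Proof.
move=> L0 SL H.
have L0R : (0 : R) < L%:R by rewrite ltr0n.
pose k := Num.sqrt (L%:R : R).
have k0 : 0 < k by rewrite sqrtr_gt0.
have k2 : k ^+ 2 = L%:R by rewrite sqr_sqrtr// ler0n.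
pose unit u := supported S u /\ nsq u <= 1.
pose A : set R := [set a | exists u v, [/\ unit u, unit v & a = bil W u v]].
have ub_abs u i : unit u -> `|u i| <= 1.
  move=> [_ u1]; rewrite -(@ler_pXn2r _ 2)// ?nnegrE// expr1n real_normK ?num_real//.
  exact: le_trans (sqr_le_nsq u i) u1.
have hsA : has_sup A.
  split.
    exists 0, (fun=> 0), (fun=> 0); have U0 : unit (fun=> 0).
      by split => //; rewrite /nsq big1 ?ler01// => i _; rewrite expr0n.
    split => //; rewrite /bil big1// => i _; rewrite big1// => j _.
    by rewrite mulr0.
  exists (\sum_i \sum_j `|W i j|) => _ [u [v [Uu Uv ->]]].
  apply: ler_sum => i _; apply: ler_sum => j _.
  apply: le_trans (ler_norm _) _; rewrite !normrM.
  by rewrite (mulrC `|u i|) -mulrA ler_piMr// mulr_ile1// ub_abs.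
have Asup u v : unit u -> unit v -> bil W u v <= sup A.
  by move=> Uu Uv; apply: sup_upper_bound => //; exists u, v.
have unit_grid (f : {ffun 'I_n -> option (bool * 'I_L)}) :
    supported S (fun i => grid_value (f i)) ->
    nsq (fun i => grid_value (f i)) <= L%:R ->
    unit (fun i => k^-1 * grid_value (f i)).
  move=> Sf fL; split; first by move=> i iS; rewrite Sf// mulr0.
  by rewrite nsqZ exprVn k2 mulrC ler_pdivrMr// mul1r.
have half u v : unit u -> unit v -> bil W u v <= t + sup A / 2.
  move=> [Su u1] Uv; have [Sv v1] := Uv.
  have [f [r [fL Sf Sr r1 uE]]] := grid_approximation L0 SL Su u1.
  have [g [q [gL Sg Sq q1 vE]]] := grid_approximation L0 SL Sv v1.
  rewrite (_ : u = fun i => k^-1 * grid_value (f i) + 4^-1 * r i); last exact/funext.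
  rewrite bilDl [X in bil W (fun i => _ * grid_value (f i)) X](_ : v =
    fun i => k^-1 * grid_value (g i) + 4^-1 * q i); last exact/funext.
  rewrite bilDr.
  have h1 : bil W (fun i => k^-1 * grid_value (f i))
                  (fun i => k^-1 * grid_value (g i)) <= t.
    rewrite bilZl bilZr mulrA -invfM -expr2 k2 mulrC ler_pdivrMr//.
    exact: H.
  have h2 := Asup _ _ (unit_grid f Sf fL) (conj Sq q1).
  have h3 := Asup _ _ (conj Sr r1) Uv.
  by rewrite [X in _ + X + _]bilZr [X in _ + X]bilZl; lra.
have sup2 : sup A <= 2 * t.
  suff : sup A <= t + sup A / 2 by lra.
  by apply: ge_sup; [case: hsA|move=> _ [u [v [Uu Uv ->]]]; exact: half].
move=> u v Su Sv.
have bil0l (w1 w2 : 'I_n -> R) : nsq w1 = 0 -> bil W w1 w2 = 0.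
  move=> /nsq_eq0 w0; rewrite /bil big1// => i _; rewrite big1// => j _.
  by rewrite w0 !mul0r.
have bil0r (w1 w2 : 'I_n -> R) : nsq w2 = 0 -> bil W w1 w2 = 0.
  move=> /nsq_eq0 w0; rewrite /bil big1// => i _; rewrite big1// => j _.
  by rewrite w0 mulr0.
have [u0|u0] := eqVneq (nsq u) 0; first by rewrite bil0l// u0 sqrtr0 mul0r mulr0.
have [v0|v0] := eqVneq (nsq v) 0; first by rewrite bil0r// v0 sqrtr0 !mulr0.
have up : 0 < Num.sqrt (nsq u) by rewrite sqrtr_gt0 lt_neqAle eq_sym u0 nsq_ge0.
have vp : 0 < Num.sqrt (nsq v) by rewrite sqrtr_gt0 lt_neqAle eq_sym v0 nsq_ge0.
have nrm w : supported S w -> 0 < Num.sqrt (nsq w) ->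
    unit (fun i => (Num.sqrt (nsq w))^-1 * w i).
  move=> Sw wp; split; first by move=> i iS; rewrite Sw// mulr0.
  rewrite nsqZ exprVn sqr_sqrtr ?nsq_ge0// mulVf//.
  by apply/eqP => w0; move: wp; rewrite w0 sqrtr0 ltxx.
have := Asup _ _ (nrm _ Su up) (nrm _ Sv vp).
rewrite bilZl bilZr mulrA -invfM mulrC ler_pdivrMr ?mulr_gt0// => /le_trans; apply.
by rewrite ler_wpM2r// mulr_ge0// sqrtr_ge0.
Qed.

End Nets.

(** * Stationary points align with the spike *)

Section StationaryPoints.
Context {R : realType}.

Definition dot n (u v : 'I_n -> R) : R := \sum_i u i * v i.

(** Lagrange's identity. *)
Lemma cauchy_schwarz n (u v : 'I_n -> R) : dot u v ^+ 2 <= nsq u * nsq v.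
Proof.
have H : 0 <= \sum_i \sum_j (u i * v j - u j * v i) ^+ 2.
  by apply: sumr_ge0 => i _; apply: sumr_ge0 => j _; exact: sqr_ge0.
have E : \sum_i \sum_j (u i * v j - u j * v i) ^+ 2 =
    nsq u * nsq v + nsq v * nsq u - 2 * dot u v ^+ 2.
  rewrite expr2 /nsq /dot !mulr_suml mulr_sumr -big_split/= -sumrB.
  apply: eq_bigr => i _; rewrite !mulr_sumr -big_split/= -sumrB.
  by apply: eq_bigr => j _; ring.
by rewrite E in H; lra.
Qed.

Definition restrict n (S : {set 'I_n}) (u : 'I_n -> R) : 'I_n -> R :=
  fun i => if i \in S then u i else 0.

Lemma nsq_restrict n (S : {set 'I_n}) u :
  nsq (restrict S u) = \sum_(i in S) u i ^+ 2.
Proof.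
rewrite /nsq [RHS]big_mkcond; apply: eq_bigr => i _; rewrite /restrict.
by case: ifP; rewrite ?expr0n.
Qed.

Lemma sum_abs_sq_le n (S : {set 'I_n}) (u : 'I_n -> R) :
  (\sum_(i in S) `|u i|) ^+ 2 <= #|S|%:R * nsq (restrict S u).
Proof.
have := cauchy_schwarz (restrict S (fun=> 1)) (fun i => `|restrict S u i|).
rewrite [nsq (fun i => `| _ |)](_ : _ = nsq (restrict S u)); last first.
  by apply: eq_bigr => i _; rewrite real_normK ?num_real.
rewrite [nsq (restrict S (fun=> 1))](_ : _ = #|S|%:R); last first.
  by rewrite nsq_restrict; under eq_bigr do rewrite expr1n; rewrite sumr_const.
rewrite [dot _ _](_ : _ = \sum_(i in S) `|u i|)// /dot [RHS]big_mkcond.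
apply: eq_bigr => i _; rewrite /restrict; case: ifP => _; first by rewrite mul1r.
by rewrite mul0r.
Qed.

Definition atanh (u : R) : R := (ln (1 + u) - ln (1 - u)) / 2.

(** The rescaled gradient of the TAP free energy at [m] vanishes. *)
Definition stationary n (lambda : R) (x : 'I_n -> R) (W : 'I_n -> 'I_n -> R)
    (m : 'I_n -> R) : Prop :=
  forall i, atanh (m i) = lambda ^+ 2 * (dot x m / n%:R) * x i
    + lambda * (\sum_j W i j * m j)
    - lambda ^+ 2 * (1 - nsq m / n%:R) * m i.

Definition in_cube n (m : 'I_n -> R) : Prop := forall i, -1 < m i < 1.

Definition is_sign n (x : 'I_n -> R) : Prop := forall i, x i = 1 \/ x i = -1.

Lemma ln_ratio_ge (a b : R) : 0 < a -> a <= b -> (b - a) / b <= ln b - ln a.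
Proof.
move=> a0 ab; have b0 : 0 < b by exact: lt_le_trans ab.
rewrite -ln_div ?posrE// -[X in _ <= X]opprK -lnV ?posrE ?divr_gt0// invf_div.
have : ln (a / b) <= a / b - 1.
  have := @le_ln1Dx R (a / b - 1); rewrite addrCA subrr addr0; apply.
  by have := divr_gt0 a0 b0; lra.
by move=> H; have -> : (b - a) / b = 1 - a / b by [field; rewrite gt_eqF|]; lra.
Qed.

(** [atanh u - atanh v] is half the sum of the increments of [ln (1 + _)] and
    of [- ln (1 - _)], both nonnegative; one with denominator at most [r]
    suffices. *)
Lemma atanh_slope (u v r : R) : -1 < u < 1 -> -1 < v < 1 -> v <= u ->
  (1 + u <= r) || (1 - v <= r) ->
  (u - v) / (2 * r) <= atanh u - atanh v.
Proof.
move=> /andP[u1 u2] /andP[v1 v2] vu hr.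
have r0 : 0 < r by case/orP: hr => ?; lra.
have a1 : 0 < 1 + v by lra.
have a2 : 0 < 1 - u by lra.
have := ln_ratio_ge a1 (_ : 1 + v <= 1 + u); move=> /(_ ltac:(lra)).
have := ln_ratio_ge a2 (_ : 1 - u <= 1 - v); move=> /(_ ltac:(lra)).
have -> : 1 - v - (1 - u) = u - v by ring.
have -> : 1 + u - (1 + v) = u - v by ring.
have p1 : 0 <= (u - v) / (1 - v) by rewrite divr_ge0//; lra.
have p2 : 0 <= (u - v) / (1 + u) by rewrite divr_ge0//; lra.
move=> h1 h2; rewrite /atanh invfM (mulrC 2^-1) mulrA.
suff : (u - v) / r <= (u - v) / (1 - v) + (u - v) / (1 + u) by lra.
case/orP: hr => hr.
  apply: (@le_trans _ _ ((u - v) / (1 + u))); last by lra.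
  by rewrite ler_wpM2l ?subr_ge0// lef_pV2 ?posrE//; lra.
apply: (@le_trans _ _ ((u - v) / (1 - v))); last by lra.
by rewrite ler_wpM2l ?subr_ge0// lef_pV2 ?posrE//; lra.
Qed.

Lemma atanh_monotone (u v r : R) : -1 < u < 1 -> -1 < v < 1 -> 0 < r ->
  (v <= u -> (1 + u <= r) || (1 - v <= r)) ->
  (u <= v -> (1 + v <= r) || (1 - u <= r)) ->
  (u - v) ^+ 2 / (2 * r) <= (atanh u - atanh v) * (u - v).
Proof.
move=> hu hv r0 H1 H2; case: (leP v u) => vu.
  have := atanh_slope hu hv vu (H1 vu) => H.
  rewrite expr2 mulrAC ler_wpM2r// subr_ge0//.
have := atanh_slope hv hu (ltW vu) (H2 (ltW vu)) => H.
have -> : (u - v) ^+ 2 / (2 * r) = ((v - u) / (2 * r)) * (v - u) by ring.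
have -> : (atanh u - atanh v) * (u - v) = (atanh v - atanh u) * (v - u) by ring.
by rewrite ler_wpM2r// subr_ge0 ltW.
Qed.

(** The slope available on misaligned coordinates. *)
Lemma atanh_monotone_half (u v : R) : -1 < u < 1 -> -1 < v < 1 ->
  (u - v) ^+ 2 / 4 <= (atanh u - atanh v) * (u - v).
Proof.
move=> /andP[u1 u2] /andP[v1 v2].
have := @atanh_monotone u v 2; rewrite -natrM; apply; rewrite ?u1 ?v1//.
  by move=> _; apply/orP; left; lra.
by move=> _; apply/orP; left; lra.
Qed.

(** Close to a sign the slope of [atanh] is of order [1 / r], which beats any
    fixed power of [lambda] when [r] is exponentially small. *)
Lemma atanh_monotone_near_sign (x u v r : R) : x = 1 \/ x = -1 ->
  -1 < u < 1 -> -1 < v < 1 -> 0 < r -> 1 - r <= x * u -> 1 - r <= x * v ->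
  (u - v) ^+ 2 / (2 * r) <= (atanh u - atanh v) * (u - v).
Proof.
move=> hx hu hv r0 xu xv; apply: atanh_monotone => // _; apply/orP;
  by case: hx xu xv => ->; rewrite ?mul1r ?mulN1r => xu xv; [right|left]; lra.
Qed.

Lemma bil_restrictl n (W : 'I_n -> 'I_n -> R) (S : {set 'I_n}) u v :
  bil W (restrict S u) v = \sum_(i in S) u i * (\sum_j W i j * v j).
Proof.
rewrite /bil [RHS]big_mkcond; apply: eq_bigr => i _; rewrite /restrict mulr_sumr.
case: ifP => iS; first by apply: eq_bigr => j _; rewrite mulrA.
by rewrite big1// => j _; rewrite !mul0r.
Qed.

Lemma nsq_restrict_sign n (x : 'I_n -> R) (S : {set 'I_n}) : is_sign x ->
  nsq (restrict S (fun i => - x i)) = #|S|%:R.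
Proof.
move=> sx; rewrite nsq_restrict (eq_bigr (fun=> 1)) ?sumr_const//.
by move=> i _; case: (sx i) => ->; ring.
Qed.

Lemma sqr_overlap_le_Q n (x m : 'I_n -> R) : (0 < n)%N -> is_sign x ->
  (dot x m / n%:R) ^+ 2 <= nsq m / n%:R.
Proof.
move=> n0 sx; have n0R : (0 : R) < n%:R by rewrite ltr0n.
have := cauchy_schwarz x m.
rewrite [nsq x](_ : _ = n%:R); last first.
  rewrite /nsq (eq_bigr (fun=> 1)) ?sumr_const ?card_ord//.
  by move=> i _; case: (sx i) => ->; ring.
rewrite expr_div_n ler_pdivrMr ?exprn_gt0//.
by have -> : nsq m / n%:R * n%:R ^+ 2 = n%:R * nsq m by field; rewrite gt_eqF.
Qed.

Lemma nsq_cube_le n (m : 'I_n -> R) : in_cube m -> nsq m <= n%:R.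
Proof.
move=> hm; rewrite -[leRHS](_ : \sum_(i < n) 1 = _); last first.
  by rewrite sumr_const card_ord.
by apply: ler_sum => i _; have /andP[? ?] := hm i; nra.
Qed.

(** With [a >= 3/4] and [Q >= a^2 >= 9/16], the equation at [i] gives
    [atanh (x_i m_i) >= lambda^2 (3/4 - 1/10 - 7/16) >= lambda^2 / 5]. *)
Lemma overlap_forces_alignment n (lambda : R) (x m : 'I_n -> R)
    (W : 'I_n -> 'I_n -> R) i :
  (0 < n)%N -> 0 < lambda -> is_sign x -> in_cube m -> stationary lambda x W m ->
  3 / 4 <= dot x m / n%:R ->
  - (lambda / 10) <= x i * (\sum_j W i j * m j) ->
  1 - 2 * expR (- (2 / 5 * lambda ^+ 2)) <= x i * m i.
Proof.
move=> n0 l0 sx cm st a34 hi.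
have n0R : (0 : R) < n%:R by rewrite ltr0n.
have Q1 := sqr_overlap_le_Q m n0 sx.
have Q2 : nsq m / n%:R <= 1 by rewrite ler_pdivrMr// mul1r nsq_cube_le.
set y := x i * m i.
have y1 : -1 < y < 1.
  by have /andP[? ?] := cm i; rewrite /y; case: (sx i) => ->; apply/andP; split; lra.
have E : x i * atanh (m i) = atanh y.
  rewrite /atanh /y; case: (sx i) => ->; rewrite ?mul1r// !mulN1r opprK.
  by rewrite -mulNr opprB.
have := st i; move/(congr1 (fun z => x i * z)); rewrite E => {}E.
have xx : x i * x i = 1 by case: (sx i) => ->; ring.
have Ey : atanh y = lambda ^+ 2 * (dot x m / n%:R)
    + lambda * (x i * (\sum_j W i j * m j)) - lambda ^+ 2 * (1 - nsq m / n%:R) * y.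
  rewrite E mulrBr mulrDr.
  rewrite (mulrCA (x i) (_ * _) (x i)) xx mulr1 (mulrCA (x i) lambda).
  by rewrite (mulrCA (x i) (_ * _) (m i)).
have lb : lambda ^+ 2 / 5 <= atanh y.
  rewrite Ey; set a := dot x m / n%:R in Q1 a34 *.
  set Q := nsq m / n%:R in Q1 Q2 *; set z := x i * _ in hi *.
  have h1 : lambda * (- (lambda / 10)) <= lambda * z by rewrite ler_wpM2l// ltW.
  have l2 : 0 < lambda ^+ 2 by rewrite exprn_gt0.
  have h2 : (1 - Q) * y <= 7 / 16 by move/andP: y1 => [? ?]; nra.
  by rewrite -mulrA; nra.
move/andP: y1 => [y1 y2].
have a1 : 0 < 1 + y by lra.
have a2 : 0 < 1 - y by lra.
have h : ln (1 - y) <= ln (1 + y) - 2 / 5 * lambda ^+ 2.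
  by move: lb; rewrite /atanh; lra.
have : 1 - y <= (1 + y) * expR (- (2 / 5 * lambda ^+ 2)).
  rewrite -[1 - y]lnK ?posrE// -[1 + y]lnK ?posrE// -expRD ler_expR.
  exact: h.
have := expR_gt0 (- (2 / 5 * lambda ^+ 2)); nra.
Qed.

(** A misaligned coordinate lies in [S1], where [x_i (W x)_i] is very negative,
    or in [S2], where [x_i (W (m - x))_i] is. The first set is small by
    hypothesis. The second has at most [(480 / lambda)^2 |m - x|^2] elements by
    the norm bound, and [|m - x|^2 <= 4 #|S| + r^2 n], so that [#|S|] is bounded
    by [#|S1|] plus small multiples of itself and of [r^2 n]. *)
Lemma stationary_concentrates n (lambda s : R) (x m : 'I_n -> R)
    (W : 'I_n -> 'I_n -> R) (r := 2 * expR (- (2 / 5 * lambda ^+ 2))) :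
  (0 < n)%N -> 10 ^+ 4 <= lambda -> 0 <= s -> is_sign x -> in_cube m ->
  stationary lambda x W m -> 3 / 4 <= dot x m / n%:R ->
  (forall u v, bil W u v <= 24 * (Num.sqrt (nsq u) * Num.sqrt (nsq v))) ->
  (forall S : {set 'I_n}, (0 < #|S|)%N -> s * n%:R <= #|S|%:R ->
    bil W (restrict S (fun i => - x i)) x <= lambda / 20 * #|S|%:R) ->
  #|[set i | x i * m i < 1 - r]%SET|%:R <= (2 * s + r ^+ 2) * n%:R.
Proof.
move=> n0 hl s0 sx cm st a34 HW Hx.
have n0R : (0 : R) < n%:R by rewrite ltr0n.
have l0 : 0 < lambda by apply: lt_le_trans hl; rewrite exprn_gt0.
have [K [K0 K1 KE]] : exists K : R, [/\ 0 <= K, K ^+ 2 <= 1 / 400 &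
    K * lambda = 20 * 24].
  (* 24 bounds the norm of [W] and 20 comes from the threshold [lambda / 20]. *)
  exists (20 * 24 / lambda); have h1 : 0 <= 20 * 24 / lambda.
    by apply: divr_ge0; [lra|exact: ltW].
  split; [exact: h1| |by rewrite divfK// gt_eqF].
  have : 20 * 24 / lambda <= 1 / 20 by rewrite ler_pdivrMr//; lra.
  by move: h1; move: (_ / lambda) => K; nra.
move: hl => _.
have r0 : 0 < r by rewrite mulr_gt0// expR_gt0.
pose S := [set i | x i * m i < 1 - r]%SET.
pose S1 := [set i | x i * (\sum_j W i j * x j) < - (lambda / 20)]%SET.
pose S2 := [set i | x i * (\sum_j W i j * (m j - x j)) < - (lambda / 20)]%SET.
have S12 : S \subset S1 :|: S2.
  apply/fintype.subsetP => i; rewrite !inE ltNge => iS; rewrite -[_ || _]negbK negb_or -!leNgt.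
  apply: contra iS => /andP[h1 h2]; apply: overlap_forces_alignment => //.
  have -> : \sum_j W i j * m j =
     \sum_j W i j * x j + \sum_j W i j * (m j - x j).
    by rewrite -big_split/=; apply: eq_bigr => j _; ring.
  by rewrite mulrDr; lra.
have bigS1 (S' : {set 'I_n}) z :
    (forall i, i \in S' -> x i * (\sum_j W i j * z j) < - (lambda / 20)) ->
    lambda / 20 * #|S'|%:R <= bil W (restrict S' (fun i => - x i)) z.
  move=> hS'; rewrite bil_restrictl.
  have -> : lambda / 20 * #|S'|%:R = \sum_(i in S') lambda / 20.
    by rewrite sumr_const mulr_natr.
  by apply: ler_sum => i /hS'; lra.
have S1s : #|S1|%:R <= s * n%:R.
  rewrite leNgt; apply/negP => hS1.
  have S1p : (0 < #|S1|)%N.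
    by rewrite -(ltr_nat R); apply: le_lt_trans hS1; rewrite mulr_ge0// ltW.
  have := Hx S1 S1p (ltW hS1).
  rewrite bil_restrictl leNgt => /negP; apply.
  have -> : lambda / 20 * #|S1|%:R = \sum_(i in S1) lambda / 20.
    by rewrite sumr_const mulr_natr.
  have [i0 i0S] : exists i, i \in S1 by apply/card_gt0P.
  apply: ltr_sum; last by move=> i; rewrite inE; lra.
  by apply/hasP; exists i0; rewrite ?mem_index_enum.
have S2s : #|S2|%:R <= (K) ^+ 2 * nsq (fun i => m i - x i).
  have := bigS1 S2 (fun i => m i - x i); move=> /(_ (fun i => _)) H.
  have {}H := H (fun i => ltac:(by rewrite inE)).
  have {H} := le_trans H (HW _ _); rewrite nsq_restrict_sign//.
  set p := Num.sqrt _; set q := Num.sqrt _ => H.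
  have p2 : p ^+ 2 = #|S2|%:R by rewrite sqr_sqrtr.
  have q2 : q ^+ 2 = nsq (fun i => m i - x i) by rewrite sqr_sqrtr ?nsq_ge0.
  have p0 : 0 <= p by exact: sqrtr_ge0.
  have q0 : 0 <= q by exact: sqrtr_ge0.
  suff pq : p <= K * q.
    by rewrite -p2 -q2 -[K ^+ 2 * _]exprMn lerXn2r ?nnegrE// mulr_ge0.
  have {}H : lambda / 20 * p ^+ 2 <= 24 * (p * q) by rewrite p2; exact: H.
  have [->|pn] := eqVneq p 0; first by rewrite mulr_ge0.
  have pp : 0 < p by rewrite lt_neqAle eq_sym pn.
  have KE' : K * lambda * (q * p) = 20 * 24 * (q * p) by rewrite KE.
  have {}H : lambda * (p - K * q) * p <= 0 by lra.
  have : lambda * (p - K * q) <= 0 by rewrite -(pmulr_lle0 _ pp).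
  by rewrite pmulr_rle0// subr_le0.
have rn : nsq (fun i => m i - x i) <= 4 * #|S|%:R + r ^+ 2 * n%:R.
  rewrite /nsq (bigID (mem S))/=; apply: lerD.
    have -> : 4 * #|S|%:R = \sum_(i in S) (4 : R) by rewrite sumr_const mulr_natr.
    by apply: ler_sum => i _; have /andP[? ?] := cm i; case: (sx i) => ->; nra.
  apply: (@le_trans _ _ (\sum_(i < n) r ^+ 2)); last first.
    by rewrite sumr_const card_ord mulr_natr.
  rewrite big_mkcond; apply: ler_sum => i _; case: ifP; last by rewrite sqr_ge0.
  rewrite inE -leNgt; have /andP[? ?] := cm i; case: (sx i) => -> h; nra.
have cS : #|S|%:R <= #|S1|%:R + #|S2|%:R :> R.
  rewrite -natrD ler_nat; apply: leq_trans (subset_leq_card S12) _.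
  by rewrite -cardsUI leq_addr.
have S0 : 0 <= #|S|%:R :> R by exact: ler0n.
have r2n : 0 <= r ^+ 2 * n%:R by rewrite mulr_ge0 ?sqr_ge0// ltW.
have h : #|S2|%:R <= 1 / 400 * (4 * #|S|%:R + r ^+ 2 * n%:R).
  apply: le_trans S2s _; apply: ler_pM => //; rewrite ?sqr_ge0 ?nsq_ge0//.
have sn : 0 <= s * n%:R by rewrite mulr_ge0// ltW.
rewrite -/S mulrDl -mulrA; lra.
Qed.

End StationaryPoints.

(** * Aligned stationary points are unique *)

Section Uniqueness.
Context {R : realType}.

Lemma bil_split n (W : 'I_n -> 'I_n -> R) (S : {set 'I_n}) v :
  bil W v v = bil W (restrict S v) (restrict S v)
    + bil W (restrict S v) (restrict (~: S) v)
    + bil W (restrict (~: S) v) (restrict S v)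
    + bil W (restrict (~: S) v) (restrict (~: S) v).
Proof.
have vE : v = fun i => restrict S v i + restrict (~: S)%SET v i.
  apply/funext => i; rewrite /restrict inE.
  by case: (i \in S); rewrite /= ?addr0 ?add0r.
by rewrite [in LHS]vE bilDl !bilDr addrA.
Qed.

Lemma nsq_split n (S : {set 'I_n}) (v : 'I_n -> R) :
  nsq v = nsq (restrict S v) + nsq (restrict (~: S) v).
Proof.
rewrite !nsq_restrict /nsq (bigID (mem S))/=; congr (_ + _).
by apply: eq_bigl => i; rewrite inE.
Qed.

Lemma abs_dot_le n (u v : 'I_n -> R) (c : R) : (forall i, `|u i| <= c) ->
  `|dot u v| <= c * \sum_i `|v i|.
Proof.
move=> hu; apply: le_trans (ler_norm_sum _ _ _) _; rewrite mulr_sumr.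
by apply: ler_sum => i _; rewrite normrM ler_wpM2r.
Qed.

(** In the last term, [Q - Q'] is rewritten as [<m + m', v> / n], so that every
    term is quadratic in [v]. *)
Lemma pairing_of_stationary n (lambda : R) x W (m m' : 'I_n -> R)
    (v := fun i => m i - m' i) : (0 < n)%N ->
  stationary lambda x W m -> stationary lambda x W m' ->
  \sum_i (atanh (m i) - atanh (m' i)) * v i =
    lambda ^+ 2 / n%:R * dot x v ^+ 2 + lambda * bil W v v
    - lambda ^+ 2 * (1 - nsq m / n%:R) * nsq v
    + lambda ^+ 2 / n%:R * dot (fun i => m i + m' i) v * dot m' v.
Proof.
move=> n0 st st'; have n0R : (n%:R : R) != 0 by rewrite pnatr_eq0 -lt0n.
have dE : dot x v = dot x m - dot x m'.
  by rewrite /dot -sumrB; apply: eq_bigr => i _; rewrite /v; ring.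
have QE : dot (fun i => m i + m' i) v = nsq m - nsq m'.
  by rewrite /dot /nsq -sumrB; apply: eq_bigr => i _; rewrite /v; ring.
have E i : (atanh (m i) - atanh (m' i)) * v i =
    lambda ^+ 2 / n%:R * dot x v * (x i * v i)
    + lambda * (\sum_j v i * W i j * v j)
    - lambda ^+ 2 * (1 - nsq m / n%:R) * v i ^+ 2
    + lambda ^+ 2 / n%:R * dot (fun i => m i + m' i) v * (m' i * v i).
  have -> : \sum_j v i * W i j * v j =
      v i * (\sum_j W i j * m j) - v i * (\sum_j W i j * m' j).
    by rewrite !mulr_sumr -sumrB; apply: eq_bigr => j _; rewrite {2}/v; ring.
  by rewrite st st' dE QE /v; field.
under eq_bigr do rewrite E.
rewrite !big_split/= sumrN -!mulr_sumr -/(dot x v) -/(dot m' v) -/(nsq v).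
by rewrite -/(bil W v v) -mulrA -expr2.
Qed.

(** With [A = |v_S|^2] and [B = |v_T|^2] for the complement [T] of [S], the
    monotonicity of [atanh] bounds the pairing below by [A / 4 + B / (2 r)]. The
    rank-one terms are at most [6 lambda^2 (s A + B)], and the noise costs
    [A / 8] on [S], [A / 16 + (96 lambda)^2 B] across, [24 lambda B] on [T]. *)
Lemma stationary_unique n (lambda s r : R) (x m m' : 'I_n -> R)
    (W : 'I_n -> 'I_n -> R) (S : {set 'I_n}) :
  (0 < n)%N -> 1 <= lambda -> 0 <= s -> s * lambda ^+ 2 <= 1 / 100 ->
  0 < r -> 10 ^+ 4 * 2 * lambda ^+ 2 * r < 1 ->
  is_sign x -> in_cube m -> in_cube m' ->
  stationary lambda x W m -> stationary lambda x W m' ->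
  #|S|%:R <= s * n%:R ->
  (forall i, i \notin S -> 1 - r <= x i * m i) ->
  (forall i, i \notin S -> 1 - r <= x i * m' i) ->
  (forall u v, bil W u v <= 24 * (Num.sqrt (nsq u) * Num.sqrt (nsq v))) ->
  (forall u, bil W (restrict S u) (restrict S u)
     <= nsq (restrict S u) / (8 * lambda)) ->
  forall i, m i = m' i.
Proof.
move=> n0 l1 s0 sl r0 rl sx cm cm' st st' Ss hm hm' HW HS.
have n0R : (0 : R) < n%:R by rewrite ltr0n.
pose v i := m i - m' i.
have l0 : 0 < lambda by lra.
set A := nsq (restrict S v); set B := nsq (restrict (~: S)%SET v).
have A0 : 0 <= A by exact: nsq_ge0.
have B0 : 0 <= B by exact: nsq_ge0.
have lower : A / 4 + B / (2 * r) <= \sum_i (atanh (m i) - atanh (m' i)) * v i.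
  rewrite [leRHS](bigID (mem S))/= /A /B !nsq_restrict !mulr_suml; apply: lerD.
    by apply: ler_sum => i _; exact: atanh_monotone_half.
  rewrite (eq_bigl (fun i => i \notin S)); last by move=> i; rewrite inE.
  apply: ler_sum => i iS; apply: (@atanh_monotone_near_sign _ (x i)) => //.
  - exact: hm.
  - exact: hm'.
pose l := \sum_i `|v i|.
have l_ge0 : 0 <= l by apply: sumr_ge0.
have l2 : l ^+ 2 <= 2 * (s * n%:R * A + n%:R * B).
  pose lS := \sum_(i in S) `|v i|; pose lT := \sum_(i in ~: S) `|v i|.
  have lE : l = lS + lT.
    rewrite /l (bigID (mem S))/=; congr (_ + _).
    by apply: eq_bigl => i; rewrite inE.
  have h1 : lS ^+ 2 <= s * n%:R * A.
    by apply: le_trans (sum_abs_sq_le S v) _; rewrite ler_wpM2r.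
  have h2 : lT ^+ 2 <= n%:R * B.
    apply: le_trans (sum_abs_sq_le (~: S) v) _; rewrite ler_wpM2r//.
    by rewrite ler_nat -[leqRHS]card_ord max_card.
  by rewrite lE; have := sqr_ge0 (lS - lT); nra.
have dx : `|dot x v| <= l.
  rewrite -[l]mul1r; apply: abs_dot_le => i.
  by case: (sx i) => ->; rewrite ?normrN normr1.
have dm : `|dot m' v| <= l.
  rewrite -[l]mul1r; apply: abs_dot_le => i; have /andP[? ?] := cm' i.
  by rewrite ler_norml; apply/andP; split; lra.
have dmm : `|dot (fun i => m i + m' i) v| <= 2 * l.
  apply: abs_dot_le => i; have /andP[? ?] := cm' i; have /andP[? ?] := cm i.
  by rewrite ler_norml; apply/andP; split; lra.
have prod : dot (fun i => m i + m' i) v * dot m' v <= 2 * l ^+ 2.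
  apply: le_trans (ler_norm _) _; rewrite normrM expr2 mulrA.
  by apply: ler_pM.
have sq : dot x v ^+ 2 <= l ^+ 2.
  by rewrite -real_normK ?num_real// lerXn2r ?nnegrE.
have bilW : bil W v v <= A / (8 * lambda) + 48 * (Num.sqrt A * Num.sqrt B) + 24 * B.
  rewrite (bil_split W S).
  have h1 := HS v.
  have h2 := HW (restrict S v) (restrict (~: S) v).
  have h3 := HW (restrict (~: S) v) (restrict S v).
  have h4 := HW (restrict (~: S) v) (restrict (~: S) v).
  rewrite -/A in h1 h2 h3; rewrite -/B -expr2 sqr_sqrtr// in h2 h3 h4.
  by rewrite -/B in h2 h3; lra.
have upper : \sum_i (atanh (m i) - atanh (m' i)) * v i <=
    3 * (lambda ^+ 2 / n%:R) * l ^+ 2 + lambda * bil W v v.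
  rewrite (pairing_of_stationary n0 st st') -/v.
  have ln0 : 0 <= lambda ^+ 2 / n%:R by rewrite divr_ge0 ?sqr_ge0// ltW.
  have h1 := ler_wpM2l ln0 sq.
  have h2 := ler_wpM2l ln0 prod.
  have h3 : 0 <= lambda ^+ 2 * (1 - nsq m / n%:R) * nsq v.
    apply: mulr_ge0; last exact: nsq_ge0.
    apply: mulr_ge0; first exact: sqr_ge0.
    by rewrite subr_ge0 ler_pdivrMr// mul1r nsq_cube_le.
  by lra.
have l2n : lambda ^+ 2 / n%:R * l ^+ 2 <= 2 * (lambda ^+ 2 * s * A + lambda ^+ 2 * B).
  have -> : 2 * (lambda ^+ 2 * s * A + lambda ^+ 2 * B) =
    lambda ^+ 2 / n%:R * (2 * (s * n%:R * A + n%:R * B)) by field; rewrite gt_eqF.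
  by rewrite ler_wpM2l// divr_ge0 ?sqr_ge0// ltW.
have lbil : lambda * bil W v v <=
    A / 8 + (A / 16 + (96 * lambda) ^+ 2 * B) + 24 * lambda ^+ 2 * B.
  apply: le_trans (ler_wpM2l (ltW l0) bilW) _.
  have -> : lambda * (A / (8 * lambda) + 48 * (Num.sqrt A * Num.sqrt B) + 24 * B)
    = A / 8 + lambda * (48 * (Num.sqrt A * Num.sqrt B)) + 24 * (lambda * B).
    by field; rewrite gt_eqF.
  have h1 : lambda * (48 * (Num.sqrt A * Num.sqrt B)) <=
      A / 16 + (96 * lambda) ^+ 2 * B.
    rewrite -[in X in _ <= X](sqr_sqrtr A0) -[in X in _ <= X](sqr_sqrtr B0).
    have := sqr_ge0 (Num.sqrt A / 4 - 96 * lambda * Num.sqrt B).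
    by move: (Num.sqrt A) (Num.sqrt B) => p q; lra.
  have h2 : lambda * B <= lambda ^+ 2 * B.
    by rewrite ler_wpM2r// expr2 ler_peMl// ltW.
  by lra.
have key : A / 16 - 6 * (s * lambda ^+ 2) * A + (B / (2 * r) - 10 ^+ 4 * (lambda ^+ 2 * B)) <= 0.
  have : 0 <= lambda ^+ 2 * B by rewrite mulr_ge0// sqr_ge0.
  move: lower upper l2n lbil; move: (\sum_i (_ * _)) (lambda * bil _ _ _) => X Z.
  by lra.
have [A00 B00] : A = 0 /\ B = 0.
  have h1 : 6 * (s * lambda ^+ 2) * A <= 6 / 100 * A by rewrite ler_wpM2r//; lra.
  have h2 : 0 <= B / (2 * r) - 10 ^+ 4 * (lambda ^+ 2 * B).
    have -> : B / (2 * r) - 10 ^+ 4 * (lambda ^+ 2 * B) =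
      B / (2 * r) * (1 - 10 ^+ 4 * 2 * lambda ^+ 2 * r) by field; rewrite gt_eqF.
    by rewrite mulr_ge0 ?divr_ge0 ?subr_ge0 ?(ltW rl)// mulr_ge0// ltW.
  have A00 : A = 0 by lra.
  split => //.
  have h3 : B / (2 * r) * (1 - 10 ^+ 4 * 2 * lambda ^+ 2 * r) = 0.
    have -> : B / (2 * r) * (1 - 10 ^+ 4 * 2 * lambda ^+ 2 * r) =
      B / (2 * r) - 10 ^+ 4 * (lambda ^+ 2 * B) by field; rewrite gt_eqF.
    by move: key h2; rewrite A00; lra.
  move/eqP: h3; rewrite !mulf_eq0 invr_eq0 mulf_eq0 (gt_eqF r0) pnatr_eq0/=.
  by rewrite subr_eq0 (gt_eqF rl) !orbF => /eqP.
have : nsq v = 0 by rewrite (nsq_split S) -/A -/B A00 B00 addr0.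
by move=> /nsq_eq0 v0 i; have := v0 i; rewrite /v => /eqP; rewrite subr_eq0 => /eqP.
Qed.

End Uniqueness.

(** * Derivatives of the free energy *)

Section FreeEnergy.
Context {R : realType}.

(** The TAP free energy as a function of the coordinates of [m], with the
    spike [x] and the noise [W] of the observation made explicit. *)
Definition tap n (lambda : R) (x : 'I_n -> R) (W : 'I_n -> 'I_n -> R)
    (m : 'I_n -> R) : R :=
  - (lambda / (2 * n%:R)) * (lambda / n%:R * dot x m ^+ 2 + bil W m m)
  - n%:R^-1 * (\sum_i bin_entropy (m i))
  - lambda ^+ 2 / 4 * (1 - nsq m / n%:R) ^+ 2.

Definition observe n (lambda : R) (x : 'I_n -> R) (W : 'I_n -> 'I_n -> R) :
  'M[R]_n := \matrix_(i, j) (lambda / n%:R * (x i * x j) + W i j).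

Lemma quadratic_form_observe n (lambda : R) x W (u v : 'I_n -> R) :
  \sum_i \sum_j u i * observe lambda x W i j * v j =
  lambda / n%:R * (dot x u * dot x v) + bil W u v.
Proof.
rewrite /dot mulr_suml mulr_sumr /bil -big_split; apply: eq_bigr => i _ /=.
rewrite !mulr_sumr -big_split; apply: eq_bigr => j _ /=.
by rewrite mxE; ring.
Qed.

Lemma TAP_observe n (lambda : R) x W (m : 'cV[R]_n) :
  TAP lambda (observe lambda x W) m = tap lambda x W (fun i => m i 0).
Proof.
rewrite /TAP /tap; congr (_ * _ - _ - _).
rewrite expr2 -quadratic_form_observe mxE; apply: eq_bigr => i _.
by rewrite !mxE mulr_sumr; apply: eq_bigr => j _; rewrite mulrA.
Qed.

Lemma is_derive_bin_entropy (u : R) : -1 < u < 1 ->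
  is_derive u 1 (@bin_entropy R) (- atanh u).
Proof.
move=> /andP[u1 u2].
have p1 : 0 < (1 + u) / 2 by lra.
have p2 : 0 < (1 - u) / 2 by lra.
have d1 : is_derive u (1 : R) (fun z : R => (1 + z) / 2) (2^-1 : R).
  rewrite (_ : (fun _ => _) = (2^-1 : R) \*: (cst (1 : R) + id : R -> R)).
    by apply: is_derive_eq; rewrite add0r scaler1.
  by apply/funext => z /=; rewrite mulrC.
have d2 : is_derive u (1 : R) (fun z : R => (1 - z) / 2) (- 2^-1 : R).
  rewrite (_ : (fun _ => _) = (2^-1 : R) \*: (cst (1 : R) - id : R -> R)).
    by apply: is_derive_eq; rewrite sub0r scalerN scaler1.
  by apply/funext => z /=; rewrite mulrC.
have l1 := @is_derive1_comp R _ _ u _ _ (is_derive1_ln p1) d1.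
have l2 := @is_derive1_comp R _ _ u _ _ (is_derive1_ln p2) d2.
have e1 := is_deriveM d1 l1; have e2 := is_deriveM d2 l2.
have := is_deriveB (is_deriveN e1) e2.
rewrite (_ : _ - _ = @bin_entropy R); last first.
  by apply/funext => z; rewrite /bin_entropy /= mulNr.
move=> H; apply: (is_derive_eq H).
rewrite /= /atanh !ln_div ?posrE//; try lra.
rewrite /= /GRing.scale/=.
by field; rewrite !gt_eqF//; lra.
Qed.

(** Coordinates with values in an arbitrary normed space cover at once columns
    (critical points), rows (compactness) and lines (Fermat's rule). *)
Lemma differentiable_tap n (lambda : R) (x : 'I_n -> R) W
    (V : normedModType R) (c : 'I_n -> V -> R) (v : V) :
  (forall i, differentiable (c i) v) -> in_cube (fun i => c i v) ->
  differentiable (fun z => tap lambda x W (fun i => c i z)) v.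
Proof.
move=> dc hc.
have hsum (f : 'I_n -> V -> R) : (forall i, differentiable (f i) v) ->
    differentiable (fun z => \sum_i f i z) v.
  move=> df; rewrite (_ : (fun _ => _) = \sum_i f i); last first.
    by apply/funext => z; rewrite fct_sumE.
  exact: differentiable_sum.
have hmul (f g : V -> R) : differentiable f v -> differentiable g v ->
    differentiable (fun z => f z * g z) v by exact: differentiableM.
have dcst (a : R) : differentiable ((fun=> a) : V -> R) v by exact: differentiable_cst.
have hadd (f g : V -> R) : differentiable f v -> differentiable g v ->
    differentiable (fun z => f z + g z) v by exact: differentiableD.
have hopp (f : V -> R) : differentiable f v ->
    differentiable (fun z => - f z) v by exact: differentiableN.
have dsq (f : V -> R) : differentiable f v ->
    differentiable (fun z => f z ^+ 2) v.
  by move=> df; under eq_fun do rewrite expr2; exact: (hmul).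
have dent i : differentiable (fun z => bin_entropy (c i z)) v.
  apply: (@differentiable_comp _ _ _ _ (c i) (@bin_entropy R)) => //.
  apply/derivable1_diffP; exact: (@ex_derive _ _ _ _ _ _ _ (is_derive_bin_entropy (hc i))).
rewrite /tap /dot /bil /nsq; apply: (hadd); [apply: (hadd); last apply: (hopp)|apply: (hopp)].
- apply: (hmul) => //; apply: (hadd).
    by apply: (hmul) => //; apply: (dsq); apply: (hsum) => i; apply: (hmul).
  apply: (hsum) => i; apply: (hsum) => j; apply: (hmul) => //.
  by apply: (hmul) => //; apply: (hmul).
- by apply: (hmul) => //; exact: (hsum).
- apply: (hmul) => //; apply: (dsq); apply: (hadd) => //; apply: (hopp).
  by apply: (hmul) => //; apply: (hsum) => i; apply: (dsq).
Qed.

(** The derivative of [tap] at [m] in the direction [v]. *)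
Definition tap_slope n (lambda : R) (x : 'I_n -> R) W (m v : 'I_n -> R) : R :=
  n%:R^-1 * \sum_i v i * (atanh (m i) + lambda ^+ 2 * (1 - nsq m / n%:R) * m i
    - lambda ^+ 2 * (dot x m / n%:R) * x i - lambda * (\sum_j W i j * m j)).

Lemma is_derive_tap_line n (lambda : R) (x : 'I_n -> R) W (m v : 'I_n -> R) :
  (0 < n)%N -> (forall i j, W i j = W j i) -> in_cube m ->
  is_derive (0 : R) (1 : R) (fun t : R => tap lambda x W (fun i => t * v i + m i))
    (tap_slope lambda x W m v).
Proof.
move=> n0 Wsym hm.
have dc i : is_derive (0 : R) (1 : R) (fun t : R => t * v i + m i) (v i).
  rewrite (_ : (fun _ => _) = (v i) \*: (id : R -> R) + cst (m i)).
    by apply: is_derive_eq; rewrite addr0 scaler1.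
  by apply/funext => t /=; rewrite /GRing.scale/= mulrC.
have c0 i : 0 * v i + m i = m i by rewrite mul0r add0r.
have hsum (f : 'I_n -> R -> R) df : (forall i, is_derive (0 : R) (1 : R) (f i) (df i)) ->
    is_derive (0 : R) (1 : R) (fun z => \sum_i f i z) (\sum_i df i).
  move=> Hf; rewrite (_ : (fun _ => _) = \sum_i f i); last first.
    by apply/funext => z; rewrite fct_sumE.
  exact: is_derive_sum.
have hmul (f g : R -> R) df dg : is_derive (0 : R) (1 : R) f df ->
    is_derive (0 : R) (1 : R) g dg ->
    is_derive (0 : R) (1 : R) (fun z => f z * g z) (f 0 * dg + g 0 * df).
  by move=> Hf Hg; exact: is_deriveM.
have hscale a (f : R -> R) df : is_derive (0 : R) (1 : R) f df ->
    is_derive (0 : R) (1 : R) (fun z => a * f z) (a * df).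
  by move=> Hf; exact: is_deriveZ.
have hadd (f g : R -> R) df dg : is_derive (0 : R) (1 : R) f df ->
    is_derive (0 : R) (1 : R) g dg ->
    is_derive (0 : R) (1 : R) (fun z => f z + g z) (df + dg).
  by move=> Hf Hg; exact: is_deriveD.
have hopp (f : R -> R) df : is_derive (0 : R) (1 : R) f df ->
    is_derive (0 : R) (1 : R) (fun z => - f z) (- df).
  by move=> Hf; exact: is_deriveN.
have dent i : is_derive (0 : R) (1 : R) (fun t : R => bin_entropy (t * v i + m i))
    (- atanh (m i) * v i).
  have H : is_derive ((fun t : R => t * v i + m i) 0) 1 (@bin_entropy R)
      (- atanh (m i)) by rewrite c0; exact: is_derive_bin_entropy.
  exact: (@is_derive1_comp R _ (fun t => t * v i + m i) 0 _ _ H (dc i)).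
have ddot : is_derive (0 : R) (1 : R) (fun t : R => dot x (fun i => t * v i + m i))
    (dot x v).
  exact: hsum _ _ (fun i => hscale (x i) _ _ (dc i)).
have dnsq : is_derive (0 : R) (1 : R) (fun t : R => nsq (fun i => t * v i + m i))
    (2 * dot m v).
  rewrite /nsq; under eq_fun do under eq_bigr do rewrite expr2.
  apply: (is_derive_eq (hsum _ _ (fun i => hmul _ _ _ _ (dc i) (dc i)))).
  by rewrite /dot mulr_sumr; apply: eq_bigr => i _; rewrite c0; ring.
have dbil : is_derive (0 : R) (1 : R)
    (fun t : R => bil W (fun i => t * v i + m i) (fun i => t * v i + m i))
    (2 * bil W v m).
  apply: (is_derive_eq (hsum _ _ (fun i => hsum _ _ (fun j => hmul _ _ _ _
     (hmul _ _ _ _ (dc i) (is_derive_cst (W i j) _ _)) (dc j))))).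
  transitivity (bil W v m + bil W m v).
    rewrite /bil -big_split; apply: eq_bigr => i _ /=; rewrite -big_split.
    by apply: eq_bigr => j _ /=; rewrite !c0; ring.
  have -> : bil W m v = bil W v m; last by ring.
  rewrite /bil exchange_big; apply: eq_bigr => i _; apply: eq_bigr => j _ /=.
  by rewrite (Wsym j i); ring.
have dQ : is_derive (0 : R) (1 : R)
    (fun t : R => 1 - nsq (fun i => t * v i + m i) / n%:R) (- (2 * dot m v / n%:R)).
  apply: (is_derive_eq (hadd _ _ _ _ (is_derive_cst (1 : R) _ _)
    (hopp _ _ (hmul _ _ _ _ dnsq (is_derive_cst (n%:R^-1 : R) _ _))))).
  by rewrite /=; ring.
have := hadd _ _ _ _ (hadd _ _ _ _
  (hscale (- (lambda / (2 * n%:R))) _ _ (hadd _ _ _ _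
     (hscale (lambda / n%:R) _ _ (hmul _ _ _ _ ddot ddot)) dbil))
  (hopp _ _ (hscale n%:R^-1 _ _ (hsum _ _ dent))))
  (hopp _ _ (hscale (lambda ^+ 2 / 4) _ _ (hmul _ _ _ _ dQ dQ))).
rewrite (_ : (fun _ => _) = fun t => tap lambda x W (fun i => t * v i + m i)).
  move=> H; apply: (is_derive_eq H).
  have -> : (fun i => 0 * v i + m i) = m by apply/funext => i; exact: c0.
  rewrite /tap_slope.
  have -> : \sum_i v i * (atanh (m i) + lambda ^+ 2 * (1 - nsq m / n%:R) * m i -
       lambda ^+ 2 * (dot x m / n%:R) * x i - lambda * \sum_j W i j * m j) =
    \sum_i v i * atanh (m i) + lambda ^+ 2 * (1 - nsq m / n%:R) * dot m v
    - lambda ^+ 2 * (dot x m / n%:R) * dot x v - lambda * bil W v m.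
    rewrite /dot /bil !mulr_sumr -big_split/= -!sumrB; apply: eq_bigr => i _.
    have -> : \sum_j v i * W i j * m j = v i * \sum_j W i j * m j.
      by rewrite mulr_sumr; apply: eq_bigr => j _; rewrite mulrA.
    by ring.
  have -> : \sum_i - atanh (m i) * v i = - \sum_i v i * atanh (m i).
    by rewrite -sumrN; apply: eq_bigr => i _; ring.
  by field; rewrite pnatr_eq0 -lt0n.
by apply/funext => t; rewrite /tap !expr2.
Qed.

End FreeEnergy.

(** * Critical points and minimizers *)

Section Minimizers.
Context {R : realType}.

Lemma tap_slopeE n (lambda : R) x W (m v : 'I_n -> R) :
  stationary lambda x W m -> tap_slope lambda x W m v = 0.
Proof.
move=> st; rewrite /tap_slope big1 ?mulr0// => i _.
by rewrite st; ring.
Qed.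

Lemma stationary_of_tap_slope n (lambda : R) x W (m : 'I_n -> R) : (0 < n)%N ->
  (forall k, tap_slope lambda x W m (fun i => (i == k)%:R) = 0) ->
  stationary lambda x W m.
Proof.
move=> n0 H i; have := H i; rewrite /tap_slope.
rewrite (bigD1 i)//= [X in _ + X]big1 ?addr0; last first.
  by move=> j /negbTE ->; rewrite mul0r.
move=> /eqP; rewrite mulf_eq0 invr_eq0 pnatr_eq0 eqn0Ngt n0/= eqxx mul1r.
move=> /eqP H'; apply/eqP; rewrite -subr_eq0; apply/eqP; rewrite -[RHS]H'.
by ring.
Qed.

Lemma derive_along_line (V : normedModType R) (f : V -> R) (a v : V) :
  'D_v f a = 'D_1 (fun h : R => f (h *: v + a)) 0.
Proof.
rewrite /derive; set F := fun h => _; set G := fun h => _.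
suff -> : F = G by [].
apply/funext => h; rewrite /F /G /=.
by rewrite addr0 scale0r add0r [h *: 1]mulr1.
Qed.

Lemma TAP_derive n (lambda : R) x W (m v : 'cV[R]_n) : (0 < n)%N ->
  (forall i j, W i j = W j i) -> cube m ->
  'D_v (TAP lambda (observe lambda x W)) m =
  tap_slope lambda x W (fun i => m i 0) (fun i => v i 0).
Proof.
move=> n0 Wsym cm; rewrite derive_along_line.
rewrite (_ : (fun h => _) = fun t => tap lambda x W (fun i => t * v i 0 + m i 0)).
  exact: (@derive_val _ _ _ _ _ _ _ (is_derive_tap_line lambda x _ n0 Wsym cm)).
apply/funext => t; rewrite TAP_observe; congr (tap _ _ _ _).
by apply/funext => i; rewrite !mxE.
Qed.

Lemma critical_pointP n (lambda : R) x W (m : 'cV[R]_n) : (0 < n)%N ->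
  (forall i j, W i j = W j i) ->
  critical_point lambda (observe lambda x W) m <->
  cube m /\ stationary lambda x W (fun i => m i 0).
Proof.
move=> n0 Wsym; split => -[cm]; last first.
  move=> st; split => //.
  have dT : differentiable (TAP lambda (observe lambda x W)) m.
    rewrite (_ : TAP _ _ = fun z : 'cV[R]_n => tap lambda x W (fun i => z i 0)).
      apply: (@differentiable_tap _ _ _ _ _ _ (fun i (z : 'cV[R]_n) => z i 0)) => //.
      by move=> i; exact: differentiable_coord.
    by apply/funext => z; rewrite TAP_observe.
  split => //; apply/funext => v /=.
  by rewrite -deriveE// TAP_derive// tap_slopeE.
move=> dT; split => //; apply: stationary_of_tap_slope => // k.
have := TAP_derive lambda x (\col_i (i == k)%:R) n0 Wsym cm.
rewrite deriveE; last exact: ex_diff.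
rewrite diff_val /= => ->; congr tap_slope.
by apply/funext => i; rewrite mxE.
Qed.

(** Fermat's rule along each coordinate line, which meets the cube in an open
    interval around [g]. *)
Lemma minimizer_stationary n (lambda : R) x W (g : 'I_n -> R) : (0 < n)%N ->
  (forall i j, W i j = W j i) -> in_cube g ->
  (forall m, in_cube m -> tap lambda x W g <= tap lambda x W m) ->
  stationary lambda x W g.
Proof.
move=> n0 Wsym cg gmin; apply: stationary_of_tap_slope => // k.
pose v i : R := (i == k)%:R.
(* Moving coordinate [k] by less than [e] stays in the cube. *)
pose e := 1 - `|g k|.
have e0 : 0 < e.
  by rewrite subr_gt0 ltr_norml; have /andP[-> ->] := cg k.
have cl t : t \in `](-e), e[ -> in_cube (fun i => t * v i + g i).
  rewrite in_itv/= -ltr_norml => te i; rewrite /v; case: eqP => [->|_]; last first.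
    by rewrite mulr0 add0r.
  rewrite mulr1 -ltr_norml; apply: le_lt_trans (ler_normD _ _) _.
  by rewrite -ltrBrDr.
have H := is_derive_tap_line lambda x v n0 Wsym cg.
have := @derive1_at_min R (fun t => tap lambda x W (fun i => t * v i + g i)) (-e) e 0.
have E0 : (fun i => 0 * v i + g i) = g by apply/funext => i; rewrite mul0r add0r.
move=> /(_ ltac:(lra)) K.
have {}K := K _ _ _.
have D : is_derive (0:R) (1:R) (fun t : R => tap lambda x W (fun i => t * v i + g i)) 0.
  apply: K.
  - move=> t te; apply/derivable1_diffP.
    apply: (@differentiable_tap _ _ _ _ _ _ (fun i (t : R) => t * v i + g i)).
      by move=> i; apply/derivable1_diffP.
    exact: cl.
  - by rewrite in_itv/=; lra.
  - by move=> t te; rewrite E0; apply: gmin; exact: cl.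
by rewrite -(@derive_val _ _ _ _ _ _ _ H) (@derive_val _ _ _ _ _ _ _ D).
Qed.

(** Concavity of the entropy, in the form of the nonnegativity of a relative
    entropy. *)
Lemma bin_entropy_tangent (u c : R) : -1 < u < 1 -> -1 < c < 1 ->
  bin_entropy u <= bin_entropy c - atanh c * (u - c).
Proof.
move=> /andP[u1 u2] /andP[c1 c2].
have key (p q : R) : 0 < p -> 0 < q -> p - q <= p * (ln p - ln q).
  move=> p0 q0; have : ln (q / p) <= q / p - 1.
    have := @le_ln1Dx R (q / p - 1); rewrite addrCA subrr addr0; apply.
    by have := divr_gt0 q0 p0; lra.
  rewrite ln_div ?posrE// => H.
  have : p * (ln q - ln p) <= p * (q / p - 1) by rewrite ler_wpM2l// ltW.
  by have -> : p * (q / p - 1) = q - p by [field; rewrite gt_eqF|]; lra.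
have h1 := key ((1 + u) / 2) ((1 + c) / 2) ltac:(lra) ltac:(lra).
have h2 := key ((1 - u) / 2) ((1 - c) / 2) ltac:(lra) ltac:(lra).
rewrite /bin_entropy /atanh.
have l1 : ln ((1 + c) / 2) = ln (1 + c) - ln 2 by rewrite ln_div ?posrE//; lra.
have l2 : ln ((1 - c) / 2) = ln (1 - c) - ln 2 by rewrite ln_div ?posrE//; lra.
by rewrite l1 l2 in h1 h2 *; lra.
Qed.

Definition clip (c u : R) : R := if c < u then c else if u < - c then - c else u.

Lemma bin_entropy_clip (u c : R) : -1 < u < 1 -> 0 < c < 1 ->
  bin_entropy u <= bin_entropy (clip c u) - atanh c * `|u - clip c u|.
Proof.
move=> hu /andP[c0 c1]; rewrite /clip; case: ltrP => cu.
  have H := bin_entropy_tangent hu (_ : -1 < c < 1).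
  by rewrite ger0_norm ?subr_ge0 ?(ltW cu)//; apply: H; lra.
case: ltrP => uc; last by rewrite subrr normr0 mulr0 subr0.
have := @bin_entropy_tangent u (- c) hu; rewrite ltr0_norm ?subr_lt0//.
have -> : atanh (- c) = - atanh c by rewrite /atanh opprK; ring.
by rewrite mulrN mulNr; apply; lra.
Qed.

Lemma exists_large_atanh (K : R) : exists2 c : R, 0 < c < 1 & K <= atanh c.
Proof.
pose k := Num.max K 1; have k0 : 0 < k by rewrite lt_max ltr01 orbT.
pose E := expR (2 * k); have E1 : 1 < E by rewrite -expR0 ltr_expR mulr_gt0.
(* [tanh k] *)
exists ((E - 1) / (E + 1)).
  rewrite divr_gt0 ?subr_gt0//=; last by lra.
  by rewrite ltr_pdivrMr; lra.
have -> : atanh ((E - 1) / (E + 1)) = k; last by rewrite le_max lexx.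
rewrite /atanh -ln_div ?posrE; last 2 first.
- by rewrite addr_gt0// divr_gt0//; lra.
- by rewrite subr_gt0 ltr_pdivrMr; lra.
have -> : (1 + (E - 1) / (E + 1)) / (1 - (E - 1) / (E + 1)) = E.
  by field; rewrite -?mulrA; apply/andP; split; lra.
by rewrite /E expRK; field.
Qed.

End Minimizers.

(** * Existence of a global minimizer *)

Section Existence.
Context {R : realType}.

Lemma smooth_part_lipschitz n (lambda : R) x (W : 'I_n -> 'I_n -> R)
    (smooth := fun m : 'I_n -> R =>
      - (lambda / (2 * n%:R)) * (lambda / n%:R * dot x m ^+ 2 + bil W m m)
      - lambda ^+ 2 / 4 * (1 - nsq m / n%:R) ^+ 2) :
  (0 < n)%N -> 0 < lambda -> is_sign x ->
  exists L : R, forall m m', (forall i, `|m i| <= 1) -> (forall i, `|m' i| <= 1) ->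
    smooth m' - smooth m <= L * \sum_i `|m i - m' i|.
Proof.
move=> n0 l0 sx; have n0R : (0 : R) < n%:R by rewrite ltr0n.
pose w := \sum_i \sum_j `|W i j|.
exists (lambda / (2 * n%:R) * (lambda / n%:R * (2 * n%:R) + 2 * w)
  + lambda ^+ 2 / 4 * (4 / n%:R)) => m m' hm hm'.
pose v i := m i - m' i; pose l := \sum_i `|v i|.
have l_ge0 : 0 <= l by apply: sumr_ge0.
have nE : \sum_(i < n) `|1 : R| = n%:R by rewrite normr1 sumr_const card_ord.
have sum2 i : `|m i + m' i| <= 2.
  by apply: le_trans (ler_normD _ _) _; apply: lerD.
have h1 : dot x m ^+ 2 - dot x m' ^+ 2 <= 2 * n%:R * l.
  have -> : dot x m ^+ 2 - dot x m' ^+ 2 = dot x v * dot x (fun i => m i + m' i).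
    rewrite subr_sqr; congr (_ * _); rewrite /dot -?sumrB -?big_split/=;
      by apply: eq_bigr => i _; rewrite /v; ring.
  apply: le_trans (ler_norm _) _; rewrite normrM mulrC; apply: ler_pM => //.
    have := @abs_dot_le _ _ (fun i => m i + m' i) x 2 sum2.
    rewrite (eq_bigr (fun=> `|1 : R|)) ?nE; last first.
      by move=> i _; case: (sx i) => ->; rewrite ?normrN.
    by rewrite /dot; under eq_bigr do rewrite mulrC.
  rewrite -[l]mul1r; apply: abs_dot_le => i.
  by case: (sx i) => ->; rewrite ?normrN normr1.
have bilb (u z : 'I_n -> R) (hz : forall i, `|z i| <= 1) : bil W u z <= w * (\sum_i `|u i|) /\ 
    bil W z u <= w * (\sum_i `|u i|).
  have le_s i : `|u i| <= \sum_j `|u j|.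
    by rewrite (bigD1 i)//= lerDl sumr_ge0.
  have le2 (a b c : R) s : `|a| <= 1 -> `|c| <= s -> a * b * c <= `|b| * s.
    move=> ha hc; apply: le_trans (ler_norm _) _; rewrite !normrM.
    by apply: ler_pM => //; rewrite ler_piMl.
  split; rewrite /bil /w mulr_suml; apply: ler_sum => i _; rewrite mulr_suml;
      apply: ler_sum => j _; last exact: le2.
  have -> : u i * W i j * z j = z j * W i j * u i by ring.
  exact: le2.
have h2 : bil W m m - bil W m' m' <= 2 * w * l.
  have -> : bil W m m - bil W m' m' = bil W v m + bil W m' v.
    rewrite /bil -sumrB -big_split; apply: eq_bigr => i _ /=.
    rewrite -sumrB -big_split; apply: eq_bigr => j _ /=; rewrite /v; ring.
  by have [+ _] := bilb v m hm; have [_ +] := bilb v m' hm'; rewrite -/l; lra.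
have nsqb (u : 'I_n -> R) : (forall i, `|u i| <= 1) -> 0 <= nsq u / n%:R <= 1.
  move=> hu; apply/andP; split; first by rewrite divr_ge0 ?nsq_ge0 ?(ltW n0R).
  rewrite ler_pdivrMr// mul1r.
  rewrite -nE normr1; apply: ler_sum => i _.
  by rewrite -real_normK ?num_real// expr_le1.
have h3 : (1 - nsq m / n%:R) ^+ 2 - (1 - nsq m' / n%:R) ^+ 2 <= 4 / n%:R * l.
  have hQ : `|nsq m' / n%:R - nsq m / n%:R| <= 2 / n%:R * l.
    rewrite -mulrBl normrM (@ger0_norm R n%:R^-1) ?invr_ge0 ?(ltW n0R)//.
    rewrite mulrAC ler_wpM2r ?invr_ge0 ?(ltW n0R)//.
    have -> : nsq m' - nsq m = - dot (fun i => m i + m' i) v.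
      by rewrite /nsq /dot -!sumrN -big_split; apply: eq_bigr => i _ /=; rewrite /v; ring.
    by rewrite normrN; exact: abs_dot_le.
  have /andP[q1 q2] := nsqb m hm; have /andP[q3 q4] := nsqb m' hm'.
  rewrite subr_sqr.
  move: hQ q1 q2 q3 q4; move: (nsq m / n%:R) (nsq m' / n%:R) => q q'.
  have -> : 4 / n%:R * l = 2 * (2 / n%:R * l) by ring.
  move: (2 / n%:R * l) => z; rewrite ler_norml => /andP[? ?] *.
  have -> : 1 - q - (1 - q') = q' - q by ring.
  by nra.
have a0 : 0 <= lambda / (2 * n%:R) by rewrite divr_ge0 ?mulr_ge0// ltW.
have b0 : 0 <= lambda ^+ 2 / 4 by rewrite divr_ge0 ?sqr_ge0.
have c0 : 0 <= lambda / n%:R by rewrite divr_ge0 ?(ltW n0R) ?(ltW l0).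
have k1 := ler_wpM2l c0 h1.
have k2 := ler_wpM2l b0 h3.
have k3 : lambda / (2 * n%:R) * ((lambda / n%:R * dot x m ^+ 2 + bil W m m) -
   (lambda / n%:R * dot x m' ^+ 2 + bil W m' m')) <=
   lambda / (2 * n%:R) * (lambda / n%:R * (2 * n%:R * l) + 2 * w * l).
  by rewrite ler_wpM2l//; lra.
rewrite -/l /smooth.
move: k2 k3; move: (lambda / n%:R) (lambda / (2 * n%:R)) (lambda ^+ 2 / 4)
  ((1 - nsq m / n%:R) ^+ 2) ((1 - nsq m' / n%:R) ^+ 2) => p q r y y'.
by move: (4 / n%:R) => z k2 k3; lra.
Qed.

(** Moving all coordinates into [[-c, c]] gains entropy at rate [atanh c] per
    unit of l1 distance, which exceeds the Lipschitz constant of the polynomial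
    part when [c] is close to 1. *)
Lemma tap_clip n (lambda : R) x (W : 'I_n -> 'I_n -> R) :
  (0 < n)%N -> 0 < lambda -> is_sign x ->
  exists2 c : R, 0 < c < 1 & forall m, in_cube m ->
    tap lambda x W (fun i => clip c (m i)) <= tap lambda x W m.
Proof.
move=> n0 l0 sx; have n0R : (0 : R) < n%:R by rewrite ltr0n.
have [L HL] := smooth_part_lipschitz W n0 l0 sx.
have [c c01 cL] := exists_large_atanh (n%:R * L).
exists c => // m cm; have /andP[c0 c1] := c01.
have h1 i : `|m i| <= 1 by rewrite ler_norml; have /andP[/ltW -> /ltW ->] := cm i.
have h2 i : `|clip c (m i)| <= 1.
  by have := h1 i; rewrite /clip !ler_norml; case: ltrP; case: ltrP; lra.
have := HL _ _ h1 h2.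
have E : \sum_i bin_entropy (m i) <= \sum_i bin_entropy (clip c (m i))
    - atanh c * \sum_i `|m i - clip c (m i)|.
  rewrite mulr_sumr -sumrB; apply: ler_sum => i _; exact: bin_entropy_clip.
have S0 : 0 <= \sum_i `|m i - clip c (m i)| by apply: sumr_ge0.
have hL : L * \sum_i `|m i - clip c (m i)| <=
    n%:R^-1 * (atanh c * \sum_i `|m i - clip c (m i)|).
  by rewrite mulrA ler_wpM2r// mulrC ler_pdivlMr// mulrC.
have hE := ler_wpM2l (_ : 0 <= n%:R^-1) E.
rewrite mulrBr in hE; rewrite /tap.
have := hE ltac:(by rewrite invr_ge0 ltW).
move: hL; move: (_ * (atanh c * _)) (n%:R^-1 * \sum_i bin_entropy (m i))
  (n%:R^-1 * \sum_i bin_entropy (clip c (m i))) (L * _) => p q r t.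
by lra.
Qed.

Lemma tap_minimizer_exists n (lambda : R) x (W : 'I_n -> 'I_n -> R) :
  (0 < n)%N -> 0 < lambda -> is_sign x ->
  exists2 g, in_cube g & forall m, in_cube m -> tap lambda x W g <= tap lambda x W m.
Proof.
move=> n0 l0 sx; have [c /andP[c0 c1] hc] := tap_clip W n0 l0 sx.
pose f (r : 'rV[R]_n) := tap lambda x W (fun i => r 0 i).
pose B : set 'rV[R]_n := [set r | forall i, `[-c, c]%classic (r ord0 i)].
have Bcube r : B r -> in_cube (fun i => r 0 i).
  by move=> Br i; have := Br i; rewrite /= in_itv/= => /andP[? ?]; apply/andP; split; lra.
have cB : compact B by apply: (rV_compact (A := fun=> `[-c, c]%classic)) => i; exact: segment_compact.
have B0 : B !=set0.
  exists 0 => i; rewrite /= in_itv/= mxE; lra.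
have fc : {within B, continuous f}.
  apply: continuous_in_subspaceT => r /set_mem Br.
  apply: differentiable_continuous.
  apply: (@differentiable_tap _ _ _ _ _ _ (fun i (z : 'rV[R]_n) => z 0 i)).
    by move=> i; exact: differentiable_coord.
  exact: Bcube.
have [g /set_mem Bg gmin] := compact_EVT_min B0 cB fc.
exists (fun i => g 0 i); first exact: Bcube.
move=> m cm; apply: le_trans (hc m cm).
have := gmin (\row_i clip c (m i)).
have -> : f (\row_i clip c (m i)) = tap lambda x W (fun i => clip c (m i)).
  by congr tap; apply/funext => i; rewrite mxE.
apply; apply/mem_set => i; rewrite /= in_itv/= mxE /clip.
by case: ltrP => ?; [lra|case: ltrP => ?; lra].
Qed.

End Existence.

(** * The landscape for a typical noise matrix *)

Section Landscape.
Context {R : realType}.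

Lemma dotN n (x m : 'I_n -> R) : dot x (fun i => - m i) = - dot x m.
Proof. by rewrite /dot -sumrN; apply: eq_bigr => i _; rewrite mulrN. Qed.

Lemma nsqN n (m : 'I_n -> R) : nsq (fun i => - m i) = nsq m.
Proof. by apply: eq_bigr => i _; rewrite sqrrN. Qed.

Lemma bilNl n (W : 'I_n -> 'I_n -> R) u v :
  bil W (fun i => - u i) v = - bil W u v.
Proof. by have := bilZl W (-1) u v; rewrite mulN1r => <-; congr bil; apply/funext => i; rewrite mulN1r. Qed.

Lemma bilNr n (W : 'I_n -> 'I_n -> R) u v :
  bil W u (fun i => - v i) = - bil W u v.
Proof. by have := bilZr W (-1) u v; rewrite mulN1r => <-; congr bil; apply/funext => i; rewrite mulN1r. Qed.

Lemma bin_entropyN (u : R) : bin_entropy (- u) = bin_entropy u.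
Proof. by rewrite /bin_entropy opprK; ring. Qed.

Lemma tapN n (lambda : R) x W (m : 'I_n -> R) :
  tap lambda x W (fun i => - m i) = tap lambda x W m.
Proof.
rewrite /tap dotN nsqN bilNl bilNr opprK sqrrN; congr (_ - _ * _ - _).
by apply: eq_bigr => i _; exact: bin_entropyN.
Qed.

Lemma stationaryN n (lambda : R) x W (m : 'I_n -> R) :
  stationary lambda x W m -> stationary lambda x W (fun i => - m i).
Proof.
move=> st i; rewrite dotN nsqN.
have -> : atanh (- m i) = - atanh (m i) by rewrite /atanh opprK; ring.
have -> : \sum_j W i j * - m j = - \sum_j W i j * m j.
  by rewrite -sumrN; apply: eq_bigr => j _; rewrite mulrN.
by rewrite st; ring.
Qed.

Lemma in_cubeN n (m : 'I_n -> R) : in_cube m -> in_cube (fun i => - m i).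
Proof. by move=> cm i; have /andP[? ?] := cm i; apply/andP; split; lra. Qed.

(** The bounds [0 <= - p ln p <= 1 - p] suffice: the entropy is of order 1,
    against energies of order [lambda^2]. *)
Lemma bin_entropy_bounds (u : R) : -1 < u < 1 -> 0 <= bin_entropy u <= 1.
Proof.
move=> /andP[u1 u2].
have key (p : R) : 0 < p -> p < 1 -> 0 <= - p * ln p <= 1 - p.
  move=> p0 p1; have l0 : ln p <= 0 by rewrite ln_le0// ltW.
  have : ln p^-1 <= p^-1 - 1.
    have := @le_ln1Dx R (p^-1 - 1); rewrite addrCA subrr addr0; apply.
    by have : 0 < p^-1 by [rewrite invr_gt0|]; lra.
  rewrite lnV ?posrE// => h.
  have := ler_wpM2l (ltW p0) h; rewrite mulrBr divff ?gt_eqF//.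
  by move=> h2; apply/andP; split; nra.
have /andP[a1 a2] := key ((1 + u) / 2) ltac:(lra) ltac:(lra).
have /andP[b1 b2] := key ((1 - u) / 2) ltac:(lra) ltac:(lra).
by rewrite /bin_entropy; apply/andP; split; lra.
Qed.

Lemma average_entropy_bounds n (m : 'I_n -> R) : (0 < n)%N -> in_cube m ->
  0 <= n%:R^-1 * (\sum_i bin_entropy (m i)) <= 1.
Proof.
move=> n0 cm; have n0R : (0 : R) < n%:R by rewrite ltr0n.
have h i := bin_entropy_bounds (cm i).
apply/andP; split.
  rewrite mulr_ge0 ?invr_ge0 ?ler0n//; apply: sumr_ge0 => i _.
  by have /andP[] := h i.
rewrite mulrC ler_pdivrMr// mul1r.
rewrite -[leRHS](_ : \sum_(i < n) 1 = _); last by rewrite sumr_const card_ord.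
by apply: ler_sum => i _; have /andP[] := h i.
Qed.

Lemma nsq_sign n (x : 'I_n -> R) : is_sign x -> nsq x = n%:R.
Proof.
move=> sx; rewrite /nsq (eq_bigr (fun=> 1)) ?sumr_const ?card_ord//.
by move=> i _; case: (sx i) => ->; ring.
Qed.

Lemma sign_form_sq_le n (mu : 'I_n -> R) (D : 'M[R]_n) : is_sign mu ->
  (\sum_i \sum_j mu i * D i j * mu j) ^+ 2 <= n%:R ^+ 2 * frobenius_sq D.
Proof.
move=> smu; pose e i := \sum_j D i j * mu j.
have -> : \sum_i \sum_j mu i * D i j * mu j = dot mu e.
  by apply: eq_bigr => i _; rewrite mulr_sumr; apply: eq_bigr => j _; rewrite mulrA.
apply: le_trans (cauchy_schwarz _ _) _; rewrite nsq_sign// expr2 -mulrA.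
rewrite ler_wpM2l ?ler0n// /nsq /frobenius_sq mulr_sumr; apply: ler_sum => i _.
by rewrite -(nsq_sign smu) mulrC; exact: cauchy_schwarz (fun j => D i j) mu.
Qed.

(** Two vectors that both almost saturate their overlap with a common sign
    vector [mu] have a large overlap with each other; the factorization
    [mu^T (m m^T) mu = <mu, m>^2] turns closeness of [m m^T] to [Xhat] into
    such an overlap. *)
Lemma overlap_via_sign n (x mu : 'I_n -> R) (m : 'cV[R]_n) (Xhat : 'M[R]_n)
    (iota : R) : (0 < n)%N -> is_sign x -> is_sign mu -> cube m ->
  199 / 200 <= (dot mu x / n%:R) ^+ 2 ->
  99 / 100 * n%:R ^+ 2 <= \sum_i \sum_j mu i * Xhat i j * mu j ->
  iota <= 10 ^- 4 -> Bayes_close iota Xhat m ->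
  9 / 16 <= (dot x (fun i => m i 0) / n%:R) ^+ 2.
Proof.
move=> n0 sx smu cm hx hX hi hB; have n0R : (0 : R) < n%:R by rewrite ltr0n.
have n2 : (0 : R) < n%:R ^+ 2 by rewrite exprn_gt0.
pose y i := m i 0.
have hF : frobenius_sq (m *m m^T - Xhat) <= 10 ^- 4 * n%:R ^+ 2.
  move: hB; rewrite /Bayes_close mulrC ltr_pdivrMr// => /ltW/le_trans; apply.
  by rewrite ler_wpM2r// ltW.
have hD : (dot mu y ^+ 2 - \sum_i \sum_j mu i * Xhat i j * mu j) ^+ 2 <=
    (10 ^- 2 * n%:R ^+ 2) ^+ 2.
  have -> : dot mu y ^+ 2 - \sum_i \sum_j mu i * Xhat i j * mu j =
      \sum_i \sum_j mu i * (m *m m^T - Xhat) i j * mu j.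
    rewrite expr2 {1}/dot mulr_suml -sumrB; apply: eq_bigr => i _.
    rewrite mulr_sumr -sumrB; apply: eq_bigr => j _.
    by rewrite !mxE big_ord1 !mxE /y; ring.
  apply: le_trans (sign_form_sq_le _ smu) _.
  apply: le_trans (ler_wpM2l (ltW n2) hF) _.
  by rewrite le_eqVlt; apply/orP; left; apply/eqP; field.
have hq : 98 / 100 <= (dot mu y / n%:R) ^+ 2.
  rewrite expr_div_n ler_pdivlMr//.
  have h0 : 0 <= 10 ^- 2 * n%:R ^+ 2 :> R by rewrite mulr_ge0 ?(ltW n2).
  have : `|dot mu y ^+ 2 - \sum_i \sum_j mu i * Xhat i j * mu j| <= 10 ^- 2 * n%:R ^+ 2.
    by rewrite -ler_sqr ?nnegrE// real_normK ?num_real.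
  by rewrite ler_norml => /andP[h1 h2]; lra.
have bound (z : 'I_n -> R) : (forall i, `|z i| <= 1) -> `|dot mu z / n%:R| <= 1.
  move=> hz; rewrite normrM normfV (ger0_norm (ltW n0R)) ler_pdivrMr// mul1r.
  rewrite (_ : dot mu z = dot z mu); last by apply: eq_bigr => i _; rewrite mulrC.
  apply: le_trans (abs_dot_le mu hz) _; rewrite mul1r (eq_bigr (fun=> 1)).
    by rewrite sumr_const card_ord.
  by move=> i _; case: (smu i) => ->; rewrite ?normrN normr1.
have hz i : `|y i| <= 1 by rewrite ler_norml; have /andP[/ltW -> /ltW ->] := cm i.
have b1 : `|dot mu x / n%:R| <= 1.
  by apply: bound => i; case: (sx i) => ->; rewrite ?normrN normr1.
have b2 : `|dot mu y / n%:R| <= 1 by exact: bound.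
have key (mu' : 'I_n -> R) : is_sign mu' ->
    199 / 200 <= dot mu' x / n%:R -> forall z, (forall i, `|z i| <= 1) ->
    98 / 100 <= dot mu' z / n%:R -> 3 / 4 <= dot x z / n%:R.
  move=> smu' h1 z hz' h2.
  have : dot mu' z - dot x z <= n%:R - dot mu' x.
    rewrite -[X in X - dot mu' x](_ : \sum_(i < n) 1 = _); last first.
      by rewrite sumr_const card_ord.
    rewrite /dot -!sumrB; apply: ler_sum => i _.
    have := hz' i; rewrite ler_norml => /andP[z1 z2].
    by case: (sx i) => ->; case: (smu' i) => ->; lra.
  rewrite ler_pdivlMr//; move: h1 h2; rewrite !ler_pdivlMr//; lra.
have final (a : R) : 3 / 4 <= a \/ 3 / 4 <= - a -> 9 / 16 <= a ^+ 2.
  by case=> ?; nra.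
have dmu (z : 'I_n -> R) : dot (fun i => - mu i) z = - dot mu z.
  by rewrite /dot -sumrN; apply: eq_bigr => i _; rewrite mulNr.
apply: final; rewrite -/y.
have sq_big (a c : R) : `|a| <= 1 -> c <= a ^+ 2 -> c <= a \/ c <= - a.
  rewrite ler_norml => /andP[a1 a2]; case: (lerP 0 a) => ? ?; [left|right]; nra.
have sN : is_sign (fun i => - mu i).
  by move=> i; case: (smu i) => ->; [right|left]; rewrite ?opprK.
have hyN i : `|- y i| <= 1 by rewrite normrN.
case: (sq_big _ _ b1 hx) => h1; case: (sq_big _ _ b2 hq) => h2.
- by left; exact: (key mu).
- right; have := key mu smu h1 _ hyN; rewrite !dotN !mulNr; exact.
- right; have := key _ sN; rewrite dmu mulNr => /(_ h1 _ hyN).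
  by rewrite !dotN dmu opprK mulNr; exact.
- by left; apply: (key _ sN) => //; rewrite dmu mulNr.
Qed.

Section Conditioned.
Context (n : nat) (lambda : R) (x : 'I_n -> R) (W : 'I_n -> 'I_n -> R).
Hypothesis n0 : (0 < n)%N.
Hypothesis hl : 10 ^+ 4 <= lambda.
Hypothesis sx : is_sign x.
Hypothesis Wsym : forall i j, W i j = W j i.
Hypothesis Wnorm :
  forall u v, bil W u v <= 24 * (Num.sqrt (nsq u) * Num.sqrt (nsq v)).
Hypothesis Wsmall : forall S : {set 'I_n}, #|S|%:R <= lambda ^- 6 * n%:R ->
  forall u, bil W (restrict S u) (restrict S u) <= nsq (restrict S u) / (8 * lambda).
Hypothesis Wx : forall S : {set 'I_n}, (0 < #|S|)%N ->
  lambda ^- 6 / 8 * n%:R <= #|S|%:R ->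
  bil W (restrict S (fun i => - x i)) x <= lambda / 20 * #|S|%:R.

Let n0R : (0 : R) < n%:R. Proof. by rewrite ltr0n. Qed.
Let l0 : 0 < lambda.
Proof. by apply: lt_le_trans hl; rewrite exprn_gt0. Qed.

Let Wquad u : bil W u u <= 24 * nsq u.
Proof. by have := Wnorm u u; rewrite -expr2 sqr_sqrtr ?nsq_ge0. Qed.

Let Wquad_ge u : - (24 * nsq u) <= bil W u u.
Proof.
have := Wnorm (fun i => - u i) u; rewrite bilNl nsqN -expr2 sqr_sqrtr ?nsq_ge0//.
by lra.
Qed.

(** For [b = a^2 < 9/16], the energy per [lambda^2] is at least
    [- (1 + b^2) / 4 >= - 337/1024] up to [O(1 / lambda)], and
    [337/1024 < 1/3]. *)
Lemma low_energy_overlap m : in_cube m -> tap lambda x W m < - (lambda ^+ 2 / 3) ->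
  9 / 16 <= (dot x m / n%:R) ^+ 2.
Proof.
move=> cm; set b := (dot x m / n%:R) ^+ 2 => low; rewrite leNgt; apply/negP => bs.
have bQ : b <= nsq m / n%:R by exact: sqr_overlap_le_Q.
have Q1 : nsq m / n%:R <= 1 by rewrite ler_pdivrMr// mul1r nsq_cube_le.
have b0 : 0 <= b by exact: sqr_ge0.
have /andP[_ h1] := average_entropy_bounds n0 cm.
have h2 : lambda / (2 * n%:R) * bil W m m <= 12 * lambda.
  have -> : 12 * lambda = lambda / (2 * n%:R) * (24 * n%:R) by field; rewrite gt_eqF.
  rewrite ler_wpM2l ?divr_ge0 ?mulr_ge0 ?(ltW l0) ?(ltW n0R)//.
  apply: le_trans (Wquad m) _; rewrite ler_wpM2l//; exact: nsq_cube_le.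
have h3 : lambda / (2 * n%:R) * (lambda / n%:R * dot x m ^+ 2) = lambda ^+ 2 / 2 * b.
  by rewrite /b; field; rewrite gt_eqF.
have h4 : (1 - nsq m / n%:R) ^+ 2 <= (1 - b) ^+ 2.
  by rewrite ler_sqr ?nnegrE ?subr_ge0//; [lra|exact: le_trans bQ Q1].
have h5 : lambda ^+ 2 / 4 * (1 - nsq m / n%:R) ^+ 2 <= lambda ^+ 2 / 4 * (1 - b) ^+ 2.
  by rewrite ler_wpM2l// divr_ge0// sqr_ge0.
have low2 : lambda ^+ 2 / 3 < lambda ^+ 2 / 4 * (1 + b ^+ 2) + 12 * lambda + 1.
  move: low; rewrite /tap mulNr mulrDr h3.
  move: h1 h2 h5; move: (n%:R^-1 * _) (lambda / (2 * n%:R) * _)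
    ((1 - nsq m / n%:R) ^+ 2) => p q r; lra.
have h6 : lambda ^+ 2 / 4 * (1 + b ^+ 2) <= lambda ^+ 2 / 4 * (1 + (9 / 16) ^+ 2).
  rewrite ler_wpM2l ?divr_ge0 ?sqr_ge0//; nra.
have h7 : 10 ^+ 4 * lambda <= lambda ^+ 2 by rewrite expr2 ler_wpM2r// ltW.
by have := hl; lra.
Qed.

(** The point [9/10 x] has energy at most
    [- 81/200 lambda^2 + O(lambda)]. *)
Lemma tap_below_threshold m : in_cube m ->
  (forall m', in_cube m' -> tap lambda x W m <= tap lambda x W m') ->
  tap lambda x W m < - (lambda ^+ 2 / 3).
Proof.
move=> cm mmin.
pose y i := 9 / 10 * x i.
have cy : in_cube y.
  by move=> i; rewrite /y; case: (sx i) => ->; apply/andP; split; lra.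
apply: le_lt_trans (mmin y cy) _.
have nx : nsq x = n%:R.
  rewrite /nsq (eq_bigr (fun=> 1)) ?sumr_const ?card_ord//.
  by move=> i _; case: (sx i) => ->; ring.
have dy : dot x y = 9 / 10 * n%:R.
  by rewrite -nx /dot /nsq mulr_sumr; apply: eq_bigr => i _; rewrite /y; ring.
have /andP[h1 _] := average_entropy_bounds n0 cy.
have h2 : - (lambda / (2 * n%:R) * bil W y y) <= 12 * lambda.
  rewrite -mulrN; have -> : 12 * lambda = lambda / (2 * n%:R) * (24 * n%:R).
    by field; rewrite gt_eqF.
  rewrite ler_wpM2l ?divr_ge0 ?mulr_ge0 ?(ltW l0) ?(ltW n0R)//.
  by have := Wquad_ge y; have := nsq_cube_le cy; lra.
have h3 : lambda / (2 * n%:R) * (lambda / n%:R * dot x y ^+ 2) = lambda ^+ 2 * (81 / 200).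
  by rewrite dy; field; rewrite gt_eqF.
have h4 : 0 <= lambda ^+ 2 / 4 * (1 - nsq y / n%:R) ^+ 2.
  by rewrite mulr_ge0 ?sqr_ge0// divr_ge0 ?sqr_ge0.
have h7 : 10 ^+ 4 * lambda <= lambda ^+ 2 by rewrite expr2 ler_wpM2r// ltW.
rewrite /tap mulNr mulrDr h3.
move: h1 h2 h4; move: (n%:R^-1 * _) (lambda / (2 * n%:R) * _)
    ((1 - nsq y / n%:R) ^+ 2) => p q r; have := hl; lra.
Qed.

Let rad := 2 * expR (- (2 / 5 * lambda ^+ 2)).

Let rad_small : rad * lambda ^+ 6 <= 2 / 10 ^+ 4.
Proof.
rewrite /rad expRN; set E := expR _.
have El : 10 ^- 4 * lambda ^+ 8 <= E.
  have -> : E = expR (lambda ^+ 2 / 10) ^+ 4.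
    by rewrite -expRM_natl; congr expR; lra.
  have -> : 10 ^- 4 * lambda ^+ 8 = (lambda ^+ 2 / 10) ^+ 4 by lra.
  rewrite lerXn2r ?nnegrE ?expR_ge0 ?divr_ge0 ?sqr_ge0//.
  by have := expR_ge1Dx (lambda ^+ 2 / 10); lra.
have E0 : 0 < E by exact: expR_gt0.
rewrite mulrAC ler_pdivrMr//.
have h : 10 ^+ 8 * lambda ^+ 6 <= lambda ^+ 8.
  have -> : lambda ^+ 8 = lambda ^+ 2 * lambda ^+ 6 by rewrite -exprD.
  rewrite ler_wpM2r ?exprn_ge0 ?(ltW l0)//.
  have -> : (10 : R) ^+ 8 = (10 ^+ 4) ^+ 2 by rewrite -exprM.
  by rewrite ler_sqr ?nnegrE ?(ltW l0) ?exprn_ge0.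
by lra.
Qed.

(** Each point has at most [lambda^-6 n / 2] misaligned coordinates, so that the
    union of the two misaligned sets is still a small block. *)
Lemma aligned_stationary_unique m m' : in_cube m -> in_cube m' ->
  stationary lambda x W m -> stationary lambda x W m' ->
  3 / 4 <= dot x m / n%:R -> 3 / 4 <= dot x m' / n%:R ->
  forall i, m i = m' i.
Proof.
move=> cm cm' st st' a a'.
have l6 : 0 < lambda ^+ 6 by rewrite exprn_gt0.
have l4 : 10 ^+ 4 <= lambda ^+ 4.
  by apply: le_trans hl _; rewrite ler_eXnr//; have := hl; lra.
have r0 : 0 < rad by rewrite mulr_gt0// expR_gt0.
have s0 : 0 <= lambda ^- 6 / 8 by rewrite divr_ge0// invr_ge0 ltW.
have c1 := stationary_concentrates n0 hl s0 sx cm st a Wnorm Wx.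
have c2 := stationary_concentrates n0 hl s0 sx cm' st' a' Wnorm Wx.
pose S := ([set i | x i * m i < 1 - rad] :|: [set i | x i * m' i < 1 - rad])%SET.
have r1 : rad * 2 <= 1 / 10 ^+ 3.
  have : 1 <= lambda ^+ 6 by rewrite exprn_ege1//; have := hl; lra.
  by move: rad_small => h1 h2; nra.
have r6 : rad <= 2 / 10 ^+ 4 * lambda ^- 6 by rewrite ler_pdivlMr.
have Ss : #|S|%:R <= lambda ^- 6 * n%:R.
  apply: (@le_trans _ _ (2 * ((2 * (lambda ^- 6 / 8) + rad ^+ 2) * n%:R))).
    have : #|S|%:R <= #|[set i | x i * m i < 1 - rad]%SET|%:R +
        #|[set i | x i * m' i < 1 - rad]%SET|%:R :> R.
      by rewrite -natrD ler_nat /S -cardsUI leq_addr.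
    by rewrite -/rad in c1 c2; lra.
  rewrite mulrA ler_wpM2r ?(ltW n0R)//.
  have : rad ^+ 2 <= rad by rewrite expr2 ler_piMl ?(ltW r0)//; lra.
  have : 0 < lambda ^- 6 by rewrite invr_gt0.
  by move: r6; move: (lambda ^- 6) => s; lra.
apply: (@stationary_unique R n lambda (lambda ^- 6) rad x m m' W S) => //.
- by have := hl; lra.
- by rewrite invr_ge0 ltW.
- have -> : lambda ^- 6 * lambda ^+ 2 = (lambda ^+ 4)^-1 by field; rewrite gt_eqF.
  rewrite mul1r lef_pV2 ?posrE ?exprn_gt0//; lra.
- have h : 10 ^+ 4 * lambda ^+ 2 <= lambda ^+ 6.
    have -> : lambda ^+ 6 = lambda ^+ 4 * lambda ^+ 2 by rewrite -exprD.
    by rewrite ler_wpM2r ?sqr_ge0.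
  by have := ler_wpM2r (ltW r0) h; move: rad_small => h1 h2; lra.
- move=> i; rewrite inE negb_or => /andP[+ _]; rewrite inE -leNgt; exact.
- move=> i; rewrite inE negb_or => /andP[_ +]; rewrite inE -leNgt; exact.
- exact: Wsmall.
Qed.

Lemma large_overlap_stationary_unique m m' : in_cube m -> in_cube m' ->
  stationary lambda x W m -> stationary lambda x W m' ->
  9 / 16 <= (dot x m / n%:R) ^+ 2 -> 9 / 16 <= (dot x m' / n%:R) ^+ 2 ->
  (forall i, m' i = m i) \/ (forall i, m' i = - m i).
Proof.
move=> cm cm' st st' a a'.
have root (z : R) : 9 / 16 <= z ^+ 2 -> 3 / 4 <= z \/ 3 / 4 <= - z.
  by case: (lerP 0 z) => ? ?; [left|right]; nra.
have dN z : dot x (fun i => - z i) / n%:R = - (dot x z / n%:R) by rewrite dotN mulNr.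
case: (root _ a) => h; case: (root _ a') => h'.
- by left => i; apply: esym; apply: aligned_stationary_unique.
- right => i; rewrite -[m' i]opprK; congr -%R.
  apply: esym; apply: (aligned_stationary_unique (m' := fun i => - m' i)) => //.
  + exact: in_cubeN.
  + exact: stationaryN.
  + by rewrite dN.
- right => i; apply: esym.
  apply: (aligned_stationary_unique (m := fun i => - m i)) => //.
  + exact: in_cubeN.
  + exact: stationaryN.
  + by rewrite dN.
- left => i; apply: oppr_inj.
  apply: esym; apply: (aligned_stationary_unique (m := fun i => - m i) (m' := fun i => - m' i)).
  + exact: in_cubeN.
  + exact: in_cubeN.
  + exact: stationaryN.
  + exact: stationaryN.
  + by rewrite dN.
  + by rewrite dN.
Qed.

(** Global minimizers and low-energy critical points are stationary with large
    overlap, as is [ms]; all of them are therefore [ms] up to sign. *)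
Lemma landscape (iota : R) (mu : 'I_n -> R) (Xhat : 'M[R]_n) (ms : 'cV[R]_n)
    (Y := observe lambda x W) :
  is_sign mu -> 199 / 200 <= (dot mu x / n%:R) ^+ 2 ->
  99 / 100 * n%:R ^+ 2 <= \sum_i \sum_j mu i * Xhat i j * mu j ->
  iota <= 10 ^- 4 -> Bayes_optimal_minimizer lambda iota Y Xhat ms ->
  [set m | global_minimizer lambda Y m] = [set ms; - ms] /\
  [set m | low_energy lambda Y m /\ critical_point lambda Y m] = [set ms; - ms].
Proof.
move=> smu hx hX hi [crit _ close _].
have [cms stms] := (critical_pointP lambda x ms n0 Wsym).1 crit.
have ov := overlap_via_sign n0 sx smu cms hx hX hi close.
have [g cg gmin] := tap_minimizer_exists W n0 l0 sx.
have stg := minimizer_stationary n0 Wsym cg gmin.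
have lowg := tap_below_threshold cg gmin.
have ovg := low_energy_overlap cg lowg.
have tms : tap lambda x W (fun i => ms i 0) = tap lambda x W g.
  case: (large_overlap_stationary_unique cg cms stg stms ovg ov) => h.
    by congr tap; apply/funext => i; exact: h.
  by rewrite -[RHS]tapN; congr tap; apply/funext => i; exact: h.
have tmsN : TAP lambda Y (- ms) = TAP lambda Y ms.
  rewrite !TAP_observe -[RHS]tapN; congr tap; apply/funext => i.
  by rewrite mxE.
have cmsN : cube (- ms).
  by move=> i; rewrite mxE; exact: (in_cubeN cms).
have critN : critical_point lambda Y (- ms).
  apply/(critical_pointP lambda x _ n0 Wsym); split => //.
  rewrite (_ : (fun i => _) = fun i => - ms i 0); first exact: stationaryN.
  by apply/funext => i; rewrite mxE.
have pm (m : 'cV[R]_n) : cube m -> stationary lambda x W (fun i => m i 0) ->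
    tap lambda x W (fun i => m i 0) < - (lambda ^+ 2 / 3) -> m = ms \/ m = - ms.
  move=> cm st low; have ovm := low_energy_overlap cm low.
  case: (large_overlap_stationary_unique cms cm stms st ov ovm) => h; [left|right];
    by apply/matrixP => i j; rewrite ord1 ?mxE; exact: h.
have minE m : cube m -> TAP lambda Y m = TAP lambda Y ms -> global_minimizer lambda Y m.
  move=> cm E; split => // m' cm'.
  by rewrite E !TAP_observe tms; exact: gmin.
have lowE m : cube m -> TAP lambda Y m = TAP lambda Y ms -> low_energy lambda Y m.
  by move=> cm E; split => //; rewrite E TAP_observe tms.
split; apply/seteqP; split => m /=.
- move=> [cm mmin].
  have mmin' m' : in_cube m' -> tap lambda x W (fun i => m i 0) <= tap lambda x W m'.
    move=> cm'; have := mmin (\col_i m' i); rewrite !TAP_observe.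
    rewrite (_ : (fun i => (\col_i0 m' i0) i 0) = m'); last first.
      by apply/funext => i; rewrite mxE.
    by apply=> i; rewrite mxE.
  by apply: pm => //; [exact: minimizer_stationary|exact: tap_below_threshold].
- by case=> ->; exact: minE.
- move=> [[cm low] /(critical_pointP lambda x _ n0 Wsym)[_ st]].
  by apply: pm => //; rewrite -TAP_observe.
- by case=> ->; split => //; exact: lowE.
Qed.

End Conditioned.
End Landscape.

(** * Union bounds *)

Section UnionBounds.
Context {R : realType} {d : measure_display} {T : measurableType d}
  (P : probability T R).

(** An upper bound on the outer probability of a possibly nonmeasurable set. *)
Definition outer_le (A : set T) (e : R) : Prop :=
  exists B, [/\ measurable B, A `<=` B & (P B <= e%:E)%E].

Lemma outer_le_sub (A A' : set T) (e e' : R) :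
  outer_le A e -> A' `<=` A -> e <= e' -> outer_le A' e'.
Proof.
move=> [B [mB AB PB]] AA ee; exists B; split => //.
  exact: subset_trans AB.
by apply: (le_trans PB); rewrite lee_fin.
Qed.

Lemma outer_le_measurable (A : set T) (e : R) :
  measurable A -> (P A <= e%:E)%E -> outer_le A e.
Proof. by move=> mA PA; exists A; split. Qed.

Lemma outer_leU (A B : set T) (a b : R) :
  outer_le A a -> outer_le B b -> outer_le (A `|` B) (a + b).
Proof.
move=> [A' [mA AA PA]] [B' [mB BB PB]]; exists (A' `|` B'); split.
- exact: measurableU.
- exact: setUSS.
- by apply: le_trans (measureU2 P mA mB) _; rewrite EFinD; apply: leeD.
Qed.

Lemma outer_le_exists (I : finType) (Q : pred I) (A : I -> set T) (e : I -> R) :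
  (forall i, Q i -> outer_le (A i) (e i)) ->
  outer_le [set w | exists2 i, Q i & A i w] (\sum_(i | Q i) e i).
Proof.
move=> H.
suff main (s : seq I) : outer_le [set w | exists2 i, (i \in s) && Q i & A i w]
    (\sum_(i <- s | Q i) e i).
  apply: outer_le_sub (main (index_enum I)) _ _ => //.
  by move=> w [i Qi Aw]; exists i; rewrite ?mem_index_enum.
elim: s => [|i s IH].
  exists set0; split => //; first by move=> w [].
  by rewrite measure0 big_nil.
rewrite big_cons; case: ifP => Qi.
  apply: outer_le_sub (outer_leU (H i Qi) IH) _ _ => //.
  move=> w [j]; rewrite inE => /andP[/orP[/eqP ->|js] Qj] Aj; first by left.
  by right; exists j; rewrite ?js.
apply: outer_le_sub IH _ _ => // w [j]; rewrite inE => /andP[/orP[/eqP ->|js] Qj] Aj.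
  by rewrite Qj in Qi.
by exists j; rewrite ?js.
Qed.

End UnionBounds.

Section GridEvents.
Context {R : realType}.

Definition grid_magnitude L (t : option (bool * 'I_L)) : nat :=
  if t is Some (_, j) then j.+1 else 0%N.

Definition grid_vectors n L := {ffun 'I_n -> option (bool * 'I_L)}.

Definition in_grid_ball n L (f : grid_vectors n L) : bool :=
  nsq (fun i => grid_value (f i) : R) <= L%:R.

Lemma sum_grid_weights L (z : R) : 0 < z -> z < 1 ->
  \sum_(t : option (bool * 'I_L)) z ^+ grid_magnitude t <= (1 + z) / (1 - z).
Proof.
move=> z0 z1.
rewrite (bigD1 None)//= (reindex_omap Some id)/=; last by case.
rewrite (eq_bigl xpredT); last by move=> p; rewrite eqxx.
rewrite (_ : \sum_(p : bool * 'I_L) _ = \sum_(b : bool) \sum_(j < L) z ^+ j.+1).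
  2: by rewrite pair_bigA; apply: eq_bigr => -[].
rewrite sumr_const card_bool.
have -> : \sum_(j < L) z ^+ j.+1 = z * \sum_(j < L) z ^+ j.
  by rewrite mulr_sumr; apply: eq_bigr => j _; rewrite exprS.
have := subrX1 z L; move: (\sum_(j < L) z ^+ j) => s hs.
have zL : 0 < z ^+ L by rewrite exprn_gt0.
rewrite ler_pdivlMr ?subr_gt0// -[_ *+ 2]mulr_natr.
by have h : z * ((1 - z) * s) <= z * 1; [rewrite ler_wpM2l// ?ltW//; lra|nra].
Qed.

Lemma grid_value_sqr L (t : option (bool * 'I_L)) :
  grid_value t ^+ 2 = (grid_magnitude t ^ 2)%:R :> R.
Proof.
case: t => [[b j]|] /=; last by rewrite expr0n.
by rewrite exprMn natrX; case: b; rewrite ?sqrrN expr1n mul1r.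
Qed.

(** Weighting each grid vector by [z] to the power of its total magnitude turns
    the count into a product over the coordinates; a small [z] is what makes
    the count subexponential when [L] is a small multiple of [n]. *)
Lemma card_grid_ball n L (z : R) : 0 < z -> z < 1 ->
  #|[set f : grid_vectors n L | in_grid_ball f]%SET|%:R
    <= z^-1 ^+ L * ((1 + z) / (1 - z)) ^+ n.
Proof.
move=> z0 z1; rewrite -sum1_card natr_sum.
apply: (@le_trans _ _ (\sum_(f : grid_vectors n L)
    z^-1 ^+ L * \prod_i z ^+ grid_magnitude (f i))).
  rewrite [leLHS]big_mkcond; apply: ler_sum => f _; case: ifP => [|_]; last first.
    by rewrite mulr_ge0 ?exprn_ge0 ?invr_ge0 ?(ltW z0)// prodr_ge0// => i _;
       rewrite exprn_ge0 ?(ltW z0).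
  rewrite inE /in_grid_ball => hf.
  rewrite prodrXr exprVn mulrC ler_pdivlMr ?exprn_gt0// mul1r.
  rewrite ler_wiXn2l ?(ltW z0) ?(ltW z1)// -(ler_nat R).
  apply: le_trans hf; rewrite natr_sum; apply: ler_sum => i _.
  by rewrite grid_value_sqr ler_nat; case: (grid_magnitude _) => // k; rewrite -mulnn leq_pmulr.
rewrite -mulr_sumr ler_wpM2l ?exprn_ge0 ?invr_ge0 ?(ltW z0)//.
rewrite -(bigA_distr_bigA (fun _ (t : option (bool * 'I_L)) => z ^+ grid_magnitude t)).
rewrite prodr_const card_ord lerXn2r ?nnegrE//; last exact: sum_grid_weights.
- by apply: sumr_ge0 => t _; rewrite exprn_ge0 ?(ltW z0).
- by rewrite divr_ge0 ?subr_ge0 ?addr_ge0 ?(ltW z0) ?(ltW z1).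
Qed.

Context {d : measure_display} {T : measurableType d} (P : probability T R).

Definition grid_bound n L (t : R) (W : 'I_n -> 'I_n -> R) : Prop :=
  forall f g : grid_vectors n L, in_grid_ball f -> in_grid_ball g ->
    bil W (fun i => grid_value (f i)) (fun i => grid_value (g i)) <= t * L%:R.

(** Chernoff at [t' = n t / (2 L)] for each of at most
    [(z^-L ((1 + z) / (1 - z))^n)^2] pairs of grid vectors. *)
Lemma GOE_grid_bound n L (t z : R) (W : 'I_n -> 'I_n -> {RV P >-> R}) :
  (0 < n)%N -> (0 < L)%N -> 0 < t -> 0 < z -> z < 1 -> GOE W ->
  outer_le P [set w | ~ grid_bound L t (fun i j => W i j w)]
    ((z^-1 ^+ L * ((1 + z) / (1 - z)) ^+ n) ^+ 2 * expR (- (t ^+ 2 / 4 * n%:R))).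
Proof.
move=> n0 L0 t0 z0 z1 HW.
have n0R : (0 : R) < n%:R by rewrite ltr0n.
have L0R : (0 : R) < L%:R by rewrite ltr0n.
pose Q (p : grid_vectors n L * grid_vectors n L) := in_grid_ball p.1 && in_grid_ball p.2.
pose B (p : grid_vectors n L * grid_vectors n L) (w : T) :=
  bil (fun i j => W i j w) (fun i => grid_value (p.1 i)) (fun i => grid_value (p.2 i)).
have HB p : Q p -> outer_le P [set w | t * L%:R < B p w] (expR (- (t ^+ 2 / 4 * n%:R))).
  move=> /andP[h1 h2]; apply: outer_le_measurable.
    by apply: measurable_set_ltr => //; exact: measurable_bil.
  (* The optimal parameter for vectors of squared norm [L]. *)
  have th0 : 0 < n%:R * t / (2 * L%:R) by rewrite divr_gt0 ?mulr_gt0.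
  apply: le_trans (GOE_tail _ _ _ n0 HW th0) _.
  rewrite lee_fin ler_expR.
  set u := nsq _; set v := nsq _.
  have uv : u * v <= L%:R ^+ 2.
    by rewrite expr2; apply: ler_pM => //; exact: nsq_ge0.
  have h : (n%:R * t / (2 * L%:R)) ^+ 2 * (u * v) / n%:R <= n%:R * t ^+ 2 / 4.
    have -> : n%:R * t ^+ 2 / 4 =
      (n%:R * t / (2 * L%:R)) ^+ 2 * L%:R ^+ 2 / n%:R by field; rewrite !gt_eqF.
    by rewrite ler_wpM2r ?invr_ge0 ?(ltW n0R)// ler_wpM2l// sqr_ge0.
  have e : n%:R * t / (2 * L%:R) * (t * L%:R) = n%:R * t ^+ 2 / 2.
    by field; rewrite gt_eqF.
  rewrite -mulrA in h; rewrite -[_ * u * v]mulrA -mulrA e; lra.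
apply: outer_le_sub (outer_le_exists HB) _ _.
  move=> w /= /existsNP[f /existsNP[g]] /not_implyP[hf /not_implyP[hg]].
  move=> /negP; rewrite -ltNge => h.
  by exists (f, g); rewrite // /Q hf hg.
rewrite sumr_const -[leLHS]mulr_natl ler_wpM2r ?expR_ge0//.
have -> : #|Q| = (#|[set f : grid_vectors n L | in_grid_ball f]%SET| ^ 2)%N.
  rewrite -mulnn -cardsX; apply: eq_card => -[f g]; rewrite !inE.
  by [].
by rewrite natrX lerXn2r ?nnegrE ?card_grid_ball// mulr_ge0 ?exprn_ge0 ?invr_ge0 ?(ltW z0)//
  divr_ge0 ?subr_ge0 ?addr_ge0 ?(ltW z0) ?(ltW z1).
Qed.

End GridEvents.

(** * Signs independent of the noise *)

Section GeneratedSigmaAlgebras.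
Context {R : realType} {d : measure_display} {T : measurableType d}
  (P : probability T R).

Lemma measurable_exists_fin (I : finType) (Q : pred I) (A : I -> set T) :
  (forall i, Q i -> measurable (A i)) ->
  measurable [set w | exists2 i, Q i & A i w].
Proof.
move=> mA; apply: (@fin_bigcup_measurable _ _ _ [set i | Q i] A) => //.
Qed.

Lemma sum_disjoint_le (I : finType) (A : I -> set T) (B : set T) :
  (forall i, measurable (A i)) -> measurable B ->
  (forall i j w, A i w -> A j w -> i = j) -> (forall i, A i `<=` B) ->
  (\sum_i P (A i) <= P B)%E.
Proof.
move=> mA mB tA AB.
suff main (s : seq I) : uniq s -> forall B, measurable B ->
    (forall i, i \in s -> A i `<=` B) -> (\sum_(i <- s) P (A i) <= P B)%E.
  by apply: main => //; exact: index_enum_uniq.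
elim: s => [_ C mC _|a s IH /= /andP[as_ us] C mC AC].
  by rewrite big_nil.
rewrite big_cons (measureDI P mC (mA a)) addeC; apply: leeD.
  apply: IH => //; first exact: measurableD.
  move=> i si w Aw; split; first by apply: (AC i) => //; rewrite inE si orbT.
  by move=> Aaw; move: as_; rewrite (tA a i w Aaw Aw) si.
apply: le_measure; [exact/mem_set/mA|by apply/mem_set/measurableI|].
by move=> w Aw; split => //; apply: (AC a) => //; rewrite inE eqxx.
Qed.

Lemma measurable_sigma_of (I : Type) (X : I -> T -> R) (i : I) :
  measurable_fun [set: g_sigma_algebraType
    (\bigcup_i preimage_set_system setT (X i) measurable)] (X i).
Proof.
move=> _ B mB; apply: sub_sigma_algebra; exists i => //.
by exists B.
Qed.

Lemma sigma_of_sub (I : Type) (X : I -> T -> R) (A : set T) :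
  (forall i, measurable_fun setT (X i)) -> sigma_of X A -> measurable A.
Proof.
move=> mX; apply: smallest_sub; first exact: sigma_algebra_measurable.
by move=> B [i _ [C mC <-]]; exact: mX.
Qed.

End GeneratedSigmaAlgebras.

Section SignVectors.
Context {R : realType}.

Definition sign_vector n (b : {ffun 'I_n -> bool}) : 'I_n -> R :=
  fun i => if b i then 1 else -1.

Lemma is_sign_vector n (b : {ffun 'I_n -> bool}) : is_sign (sign_vector b).
Proof. by move=> i; rewrite /sign_vector; case: (b i); [left|right]. Qed.

Lemma sign_vector_exists n (x : 'I_n -> R) : is_sign x ->
  exists b : {ffun 'I_n -> bool}, x = sign_vector b.
Proof.
move=> sx; exists [ffun i => x i == 1]; apply/funext => i.
rewrite /sign_vector ffunE; case: (sx i) => ->; first by rewrite eqxx.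
by rewrite lt_eqF// (lt_trans (ltrN10 _)).
Qed.

Lemma sign_vector_inj n : injective (@sign_vector n).
Proof.
move=> b c bc; apply/ffunP => i; have := congr1 (fun f => f i) bc.
rewrite /sign_vector; case: (b i); case: (c i) => // /eqP.
  by rewrite gt_eqF// (lt_trans (ltrN10 _)).
by rewrite lt_eqF// (lt_trans (ltrN10 _)).
Qed.

Context {d : measure_display} {T : measurableType d} (P : probability T R)
  (n : nat).
Implicit Types (x : 'I_n -> {RV P >-> R}) (W : 'I_n -> 'I_n -> {RV P >-> R}).

(** Because the signs are independent of the noise, a union bound over the
    [2 ^ n] sign vectors costs nothing: each of them is weighted by its own
    probability. *)
Lemma outer_le_independent_signs x W (D : {ffun 'I_n -> bool} -> set T) (e : R) :
  0 <= e ->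
  independent_systems P (sigma_of x) (sigma_of (fun p : 'I_n * 'I_n => W p.1 p.2)) ->
  (forall b, sigma_of (fun p : 'I_n * 'I_n => W p.1 p.2) (D b)) ->
  (forall b, (P (D b) <= e%:E)%E) ->
  outer_le P [set w | exists2 b, true & (x ^~ w = sign_vector b) /\ D b w] e.
Proof.
move=> e0 ind mD PD.
pose X b : set T := [set w | x ^~ w = sign_vector b].
have sX b : sigma_of x (X b).
  rewrite /X (_ : [set w | _] = \bigcap_(i in [set: 'I_n]) (x i @^-1` [set sign_vector b i])).
    pose G := \bigcup_i preimage_set_system setT (x i) measurable.
    apply: (@fin_bigcap_measurable _ (g_sigma_algebraType G)) => // i _.
    have := @measurable_sigma_of R d T 'I_n (fun i => x i) i measurableT
      [set sign_vector b i] (measurable_set1 _).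
    by rewrite setTI.
  apply/seteqP; split => w /=; first by move=> xw i _ /=; rewrite -xw.
  by move=> h; apply/funext => i; exact: h.
have mX b : measurable (X b) by apply: (sigma_of_sub _ (sX b)) => i; exact: measurable_funP.
have mDb b : measurable (D b).
  by apply: (sigma_of_sub _ (mD b)) => p; exact: measurable_funP.
have HXD b : true -> outer_le P (X b `&` D b) (fine (P (X b)) * e).
  move=> _; apply: outer_le_measurable; first exact: measurableI.
  rewrite ind// EFinM fineK ?fin_num_measure//.
  by apply: lee_pmul.
apply: outer_le_sub (outer_le_exists HXD) _ _ => //.
rewrite -mulr_suml ler_piMl//.
rewrite sum_fine; last by move=> b _; exact: fin_num_measure.
rewrite -lee_fin fineK; last first.
  by rewrite sum_fin_num; apply/allP => /= z /mapP[b _ ->]; exact: fin_num_measure.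
rewrite -(probability_setT P); apply: sum_disjoint_le => //.
by move=> b c w; rewrite /X /= => -> /sign_vector_inj.
Qed.

(** Summing over sets of rows, and not bounding each row, makes the failure
    probability exponentially small in [n]: if the rows where [x_i (W x)_i] is
    below [- c] were more than [s n], they would violate this bound. *)
Definition row_bound (c s : R) (W : 'I_n -> 'I_n -> R) (x : 'I_n -> R) : Prop :=
  forall S : {set 'I_n}, (0 < #|S|)%N -> s * n%:R <= #|S|%:R ->
    bil W (restrict S (fun i => - x i)) x <= c * #|S|%:R.

Lemma not_row_boundE c s (W : 'I_n -> 'I_n -> R) (x : 'I_n -> R) :
  (~ row_bound c s W x) <->
  exists2 S : {set 'I_n}, (0 < #|S|)%N && (s * n%:R <= #|S|%:R) &
    c * #|S|%:R < bil W (restrict S (fun i => - x i)) x.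
Proof.
split.
  move=> /existsNP[S /not_implyP[S0 /not_implyP[Ss]]] /negP; rewrite -ltNge => h.
  by exists S; rewrite ?S0.
by move=> [S /andP[S0 Ss]]; rewrite ltNge => /negP h H; apply: h; exact: H.
Qed.

Lemma sum_subsets_pow (p : R) : \sum_(S : {set 'I_n}) p ^+ #|S| = (1 + p) ^+ n.
Proof.
have -> : (1 + p) ^+ n = \prod_(i < n) (p + 1) by rewrite prodr_const card_ord addrC.
rewrite bigA_distr; apply: eq_big => [S|S _]; first by rewrite inE.
by rewrite -(prodr_const (mem S)) big_mkcond.
Qed.

(** For a set [S], Chernoff gives [p ^+ (2 #|S|)] with
    [p = expR (- c^2 / 8)]. One factor [p ^+ #|S|] is at most
    [expR (- c^2 / 8 * s n)], and the other sums over all [S] to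
    [(1 + p) ^+ n]. *)
Lemma GOE_row_bound W (c s : R) (b : {ffun 'I_n -> bool}) :
  (0 < n)%N -> 0 < c -> 0 <= s -> GOE W ->
  (P [set w | ~ row_bound c s (fun i j => W i j w) (sign_vector b)] <=
   (expR (n%:R * (expR (- (c ^+ 2 / 8)) - c ^+ 2 / 8 * s)))%:E)%E.
Proof.
move=> n0 c0 s0 HW.
have n0R : (0 : R) < n%:R by rewrite ltr0n.
pose p := expR (- (c ^+ 2 / 8)); have p0 : 0 < p by exact: expR_gt0.
pose Q (S : {set 'I_n}) := (0 < #|S|)%N && (s * n%:R <= #|S|%:R).
pose A (S : {set 'I_n}) (w : T) := c * #|S|%:R < bil (fun i j => W i j w)
  (restrict S (fun i => - sign_vector b i)) (sign_vector b).
have HA S : Q S -> outer_le P (A S) (expR (- (c ^+ 2 / 8 * s * n%:R)) * p ^+ #|S|).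
  move=> /andP[S0 Ss]; apply: outer_le_measurable.
    by apply: measurable_set_ltr => //; exact: measurable_bil.
  have c20 : 0 < c / 2 by rewrite divr_gt0.
  apply: le_trans (GOE_tail _ _ _ n0 HW c20) _.
  rewrite lee_fin -expRM_natl -expRD ler_expR.
  rewrite nsq_restrict_sign; last exact: is_sign_vector.
  rewrite nsq_sign; last exact: is_sign_vector.
  rewrite mulfK ?gt_eqF//.
  have : c ^+ 2 / 8 * (s * n%:R) <= c ^+ 2 / 8 * #|S|%:R.
    by rewrite ler_wpM2l// divr_ge0// sqr_ge0.
  by lra.
have [B [mB HB PB]] := outer_le_exists HA.
apply: (@le_trans _ _ (P B)).
  apply: le_measure; last by move=> w /= /not_row_boundE h; exact: HB.
    2: exact/mem_set.
  apply/mem_set; rewrite (_ : [set w | _] = [set w | exists2 S, Q S & A S w]).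
    apply: measurable_exists_fin => S _.
    by apply: measurable_set_ltr => //; exact: measurable_bil.
  by apply/seteqP; split => w /= /not_row_boundE.
apply: (le_trans PB); rewrite lee_fin -mulr_sumr.
apply: (@le_trans _ _ (expR (- (c ^+ 2 / 8 * s * n%:R)) * (1 + p) ^+ n)).
  rewrite ler_wpM2l ?expR_ge0// -sum_subsets_pow [leLHS]big_mkcond.
  by apply: ler_sum => S _; case: ifP => // _; rewrite exprn_ge0// ltW.
have h : (1 + p) ^+ n <= expR (n%:R * p).
  rewrite expRM_natl lerXn2r ?nnegrE ?expR_ge0 ?addr_ge0 ?(ltW p0)//.
  exact: expR_ge1Dx.
apply: le_trans (ler_wpM2l (expR_ge0 _) h) _.
by rewrite -expRD ler_expR -/p mulrBr addrC lerD2l lerN2 mulrC.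
Qed.

End SignVectors.

(** * The Bayes estimator *)

Section BayesEstimator.
Context {R : realType} {d : measure_display} {T : measurableType d}
  (P : probability T R) (n : nat).
Implicit Types (x : 'I_n -> {RV P >-> R}) (W : 'I_n -> 'I_n -> {RV P >-> R}).

Definition sign_event x : set T := [set w | is_sign (x ^~ w)].

Lemma measurable_eq_cst (f : T -> R) (a : R) : measurable_fun setT f ->
  measurable [set w | f w = a].
Proof.
move=> mf; have := mf measurableT [set a] (measurable_set1 a).
by rewrite setTI.
Qed.

Lemma measurable_sign_event x : measurable (sign_event x).
Proof.
rewrite /sign_event (_ : [set w | _] = \bigcap_(i in [set: 'I_n])
    ([set w | x i w = 1] `|` [set w | x i w = -1])).
  apply: fin_bigcap_measurable => // i _.
  by apply: measurableU; apply: measurable_eq_cst; exact: measurable_funP.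
by apply/seteqP; split => w /=; [move=> h i _; exact: h|move=> h i; exact: h].
Qed.

Lemma sign_event_full x : iid_Rademacher x -> P (~` sign_event x) = 0%E.
Proof.
move=> [_ half].
have mE i a : measurable [set w | x i w = a].
  by apply: measurable_eq_cst; exact: measurable_funP.
pose A (i : 'I_n) : set T := ~` ([set w | x i w = 1] `|` [set w | x i w = -1]).
have HA i : true -> outer_le P (A i) 0.
  move=> _; apply: outer_le_measurable.
    by apply: measurableC; exact: measurableU.
  have d0 : [set w | x i w = 1] `&` [set w | x i w = -1] = set0.
    apply/seteqP; split => // w /= [-> /eqP].
    by rewrite gt_eqF// (lt_trans (ltrN10 _)).
  have mU : measurable ([set w | x i w = 1] `|` [set w | x i w = -1]).
    exact: measurableU.
  have -> : P (A i) = (1 - (P [set w | x i w = 1]%R + P [set w | x i w = -1]%R))%E.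
    by rewrite /A probability_setC// measureU.
  have [-> ->] := half i.
  have -> : (2^-1%:E + 2^-1%:E = 1%:E :> \bar R)%E by rewrite -EFinD; congr EFin; lra.
  by rewrite subee.
have [B [mB HB PB]] := outer_le_exists HA.
rewrite big1 ?mulr0// in PB.
apply/eqP; rewrite eq_le measure_ge0 andbT (le_trans _ PB)//.
apply: le_measure; [|exact/mem_set|].
  by apply/mem_set/measurableC; exact: measurable_sign_event.
move=> w /= /existsNP[i hi]; apply: HB; exists i => //= h; exact: hi.
Qed.

Definition sign_form (M : 'M[R]_n) (b : {ffun 'I_n -> bool}) : R :=
  \sum_i \sum_j sign_vector b i * M i j * sign_vector b j.

Definition maximizes (M : 'M[R]_n) (b : {ffun 'I_n -> bool}) : Prop :=
  forall c, sign_form M c <= sign_form M b.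

(** Ties are broken by the enumeration, so that the events indexed by [b] are
    disjoint. *)
Definition first_maximizer (M : 'M[R]_n) (b : {ffun 'I_n -> bool}) : Prop :=
  maximizes M b /\ forall c, maximizes M c -> (enum_rank b <= enum_rank c)%N.

Lemma first_maximizer_exists (M : 'M[R]_n) : exists b, first_maximizer M b.
Proof.
have [b0 _ hb0] := @Order.TotalTheory.arg_maxP _ _ _ [ffun=> true] xpredT (sign_form M) isT.
have mb0 : `[< maximizes M b0 >] by apply/asboolP => c; exact: hb0.
case: (@arg_minnP _ b0 (fun b => `[< maximizes M b >]) (fun b => enum_rank b) mb0) => b /asboolP hb hm.
by exists b; split => // c /asboolP; exact: hm.
Qed.

Lemma first_maximizer_unique (M : 'M[R]_n) b c :
  first_maximizer M b -> first_maximizer M c -> b = c.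
Proof.
move=> [mb hb] [mc hc]; apply: enum_rank_inj; apply/val_inj/eqP.
by rewrite eqn_leq hb ?hc.
Qed.

Lemma measurable_sign_form (d' : measure_display) (T' : measurableType d')
    (M : T' -> 'M[R]_n) b : (forall i j, measurable_fun setT (fun w => M w i j)) ->
  measurable_fun setT (fun w => sign_form (M w) b).
Proof.
move=> mM; apply: measurable_sum => i; apply: measurable_sum => j.
by apply: measurable_funM => //; exact: measurable_funM.
Qed.

Lemma measurable_first_maximizer (d' : measure_display) (T' : measurableType d')
    (M : T' -> 'M[R]_n) b : (forall i j, measurable_fun setT (fun w => M w i j)) ->
  measurable [set w | first_maximizer (M w) b].
Proof.
move=> mM.
have mmax c : measurable [set w | maximizes (M w) c].
  rewrite (_ : [set w | _] = \bigcap_(a in [set: {ffun 'I_n -> bool}])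
      [set w | sign_form (M w) a <= sign_form (M w) c]).
    apply: fin_bigcap_measurable => // a _.
    by apply: measurable_set_ler; exact: measurable_sign_form.
  by apply/seteqP; split => w /=; [move=> h a _; exact: h|move=> h a; exact: h].
rewrite (_ : [set w | _] = [set w | maximizes (M w) b] `&`
   ~` [set w | exists2 c, ~~ (enum_rank b <= enum_rank c)%N & maximizes (M w) c]).
  apply: measurableI => //; apply: measurableC.
  by apply: measurable_exists_fin => c _; exact: mmax.
apply/seteqP; split => w /=.
  by move=> [h1 h2]; split => // -[c /negP h3 /h2].
move=> [h1 h2]; split => // c hc; apply: contrapT => /negP h3; apply: h2.
by exists c.
Qed.

(** The event [B] is generated by [Y], so that [mu^T Xhat mu] and [<mu, x>^2]
    have the same integral over it. The first is below [99/100 n^2] on [B], the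
    second at least [199/200 n^2] on the part of [B] inside [A]; hence at least
    [1/199] of the mass of [B] is outside [A]. *)
Lemma first_maximizer_mass x (Y Xhat : T -> 'M[R]_n) (A : set T) b :
  (0 < n)%N -> (forall i j, measurable_fun setT (fun w => Y w i j)) ->
  is_Bayes_estimator x Y Xhat -> P (~` sign_event x) = 0%E ->
  measurable A -> A `<=` sign_event x ->
  (forall w b, A w -> maximizes (Y w) b ->
     199 / 200 <= (dot (sign_vector b) (x ^~ w) / n%:R) ^+ 2) ->
  let B := [set w | first_maximizer (Y w) b] `&`
           [set w | sign_form (Xhat w) b < 99 / 100 * n%:R ^+ 2] in
  measurable B /\ fine (P B) <= 199 * fine (P (B `&` ~` A)).
Proof.
move=> n0 mY HX full mA AS HA B.
have n0R : (0 : R) < n%:R by rewrite ltr0n.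
have n2 : (0 : R) < n%:R ^+ 2 by rewrite exprn_gt0.
pose G := \bigcup_(p : 'I_n * 'I_n)
  preimage_set_system setT (fun w => Y w p.1 p.2) (@measurable _ R).
have sB : sigma_of (fun (p : 'I_n * 'I_n) w => Y w p.1 p.2) B.
  apply: (@measurableI _ (g_sigma_algebraType G)).
    apply: (@measurable_first_maximizer _ (g_sigma_algebraType G)) => i j.
    have h := @measurable_sigma_of R d T _ (fun (p : 'I_n * 'I_n) w => Y w p.1 p.2) (i, j).
    exact: h.
  apply: (@measurable_set_ltr _ _ (g_sigma_algebraType G)) => //.
  apply: (@measurable_sign_form _ (g_sigma_algebraType G)) => i j.
  move=> _ C mC; rewrite setTI; have [h _ _] := HX i j; exact: h.
have mB : measurable B.
  by apply: (sigma_of_sub _ sB) => p; exact: mY.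
split => //.
have mS := measurable_sign_event x.
pose s : 'I_n -> R := sign_vector b.
(* The signs may take other values on a null set, where [x_i x_j] need not be
   bounded. *)
pose y i j w : R := x i w * x j w * \1_(sign_event x) w.
have my i j : measurable_fun setT (y i j).
  by apply: measurable_funM; [exact: measurable_funM|exact: measurable_indic].
have iy i j : P.-integrable setT (EFin \o y i j).
  apply: measurable_bounded_integrable => //.
    by rewrite ltey_eq fin_num_measure.
  exists 1; split => // M M1 w _ /=; rewrite /y indicE.
  apply: le_trans (ltW M1); case: (boolP (w \in sign_event x)) => [/set_mem sw|_].
    rewrite mulr1 normrM.
    by case: (sw i) => ->; case: (sw j) => ->; rewrite ?normrN normr1 mulr1.
  by rewrite mulr0 normr0.
have iX i j : P.-integrable setT (EFin \o (fun w => Xhat w i j)).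
  by have [_ h _] := HX i j.
have EX i j : (\int[P]_(w in B) (Xhat w i j)%:E = \int[P]_(w in B) (y i j w)%:E)%E.
  have [_ _ ->] := HX i j; last exact: sB.
  apply: ae_eq_integral => //.
  - by apply/measurable_EFinP/measurable_funTS/measurable_funM.
  - by apply/measurable_EFinP/measurable_funTS.
  exists (~` sign_event x); split => //; first exact: measurableC.
  move=> w /= /not_implyP[_ h] Sw; apply: h.
  by rewrite /y indicE mem_set// mulr1.
have sumE (z : 'I_n -> 'I_n -> T -> R) :
    (forall i j, P.-integrable setT (EFin \o z i j)) ->
    P.-integrable B (fun w => (\sum_i \sum_j s i * z i j w * s j)%:E) /\
    (\int[P]_(w in B) (\sum_i \sum_j s i * z i j w * s j)%:E =
     \sum_i \sum_j (s i * s j)%:E * \int[P]_(w in B) (z i j w)%:E)%E.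
  move=> iz.
  have izB i j : P.-integrable B (fun w => ((s i * s j)%:E * (z i j w)%:E)%E).
    apply: integrableZl => //; apply: integrableS (iz i j) => //.
  have E w : ((\sum_i \sum_j s i * z i j w * s j)%:E =
      \sum_i \sum_j (s i * s j)%:E * (z i j w)%:E)%E.
    rewrite -sumEFin; apply: eq_bigr => i _; rewrite -sumEFin.
    by apply: eq_bigr => j _; rewrite -EFinM; congr EFin; ring.
  have isum i : P.-integrable B (fun w => \sum_j (s i * s j)%:E * (z i j w)%:E)%E.
    exact: integrable_sum.
  split.
    under eq_fun do rewrite E.
    exact: integrable_sum.
  under eq_integral do rewrite E.
  rewrite integral_sum//; apply: eq_bigr => i _.
  rewrite integral_sum//; apply: eq_bigr => j _.
  by rewrite integralZl//; apply: integrableS (iz i j).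
have [iXs EXs] := sumE _ iX; have [iys Eys] := sumE _ iy.
have EE : (\int[P]_(w in B) (sign_form (Xhat w) b)%:E =
    \int[P]_(w in B) (\sum_i \sum_j s i * y i j w * s j)%:E)%E.
  rewrite Eys [LHS]EXs; apply: eq_bigr => i _; apply: eq_bigr => j _.
  by rewrite EX.
have mBA : measurable (B `&` A) by exact: measurableI.
have mBAc : measurable (B `&` ~` A) by apply: measurableI => //; exact: measurableC.
have up : (\int[P]_(w in B) (sign_form (Xhat w) b)%:E <=
    (99 / 100 * n%:R ^+ 2)%:E * P B)%E.
  rewrite -integral_cst//; apply: le_integral => //.
    exact: (finite_measure_integrable_cst P (99 / 100 * n%:R ^+ 2) mB).
  by move=> w /set_mem[_ h]; rewrite lee_fin ltW.
have sq w : sign_event x w -> \sum_i \sum_j s i * y i j w * s j = dot s (x ^~ w) ^+ 2.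
  move=> Sw; rewrite expr2 {1}/dot mulr_suml; apply: eq_bigr => i _.
  rewrite mulr_sumr; apply: eq_bigr => j _.
  by rewrite /y indicE mem_set// mulr1; ring.
have low : ((199 / 200 * n%:R ^+ 2)%:E * P (B `&` A) <=
    \int[P]_(w in B) (\sum_i \sum_j s i * y i j w * s j)%:E)%E.
  have [c [cE c0]] : exists c : R, c = 199 / 200 * n%:R ^+ 2 /\ 0 <= c.
    by eexists; split; [reflexivity|apply: mulr_ge0; [lra|exact: ltW]].
  rewrite -cE.
  rewrite -(setIC A) -integral_indic// -ge0_integralZl_EFin//; last first.
    exact/measurable_EFinP/measurable_indic.
  apply: ge0_le_integral => //.
  - by move=> w _; rewrite mule_ge0 ?lee_fin.
  - by apply: measurable_funeM; exact/measurable_EFinP/measurable_indic.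
  - by case/integrableP : iys.
  move=> w [hb _]; rewrite -EFinM lee_fin indicE.
  have [Aw|nAw] := pselect (A w).
    rewrite mem_set// mulr1 sq; last exact: AS.
    have [hm _] := hb; have := HA w b Aw hm.
    by rewrite expr_div_n ler_pdivlMr// -cE.
  rewrite memNset// mulr0.
  have [Sw|nSw] := pselect (sign_event x w); first by rewrite sq// sqr_ge0.
  apply: sumr_ge0 => i _; apply: sumr_ge0 => j _.
  by rewrite /y indicE memNset// !mulr0 mul0r.
rewrite EE in up; have {low up} := le_trans low up.
have PBE : P B = ((fine (P (B `&` ~` A)) + fine (P (B `&` A)))%:E)%E.
  by rewrite EFinD !fineK ?fin_num_measure// (measureDI P mB mA) setDE.
rewrite PBE -[P (B `&` A)]fineK ?fin_num_measure// -!EFinM lee_fin /=.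
have := fine_ge0 (measure_ge0 P (B `&` ~` A)).
move: (fine _) (fine _) => p q q0 h.
have : (199 / 200 * p - 99 / 100 * (q + p)) * n%:R ^+ 2 <= 0 by lra.
by rewrite pmulr_lle0//; lra.
Qed.

(** Summing [first_maximizer_mass] over the disjoint events. *)
Lemma Bayes_estimator_aligned x (Y Xhat : T -> 'M[R]_n) (A : set T) (e : R) :
  (0 < n)%N -> (forall i j, measurable_fun setT (fun w => Y w i j)) ->
  is_Bayes_estimator x Y Xhat -> P (~` sign_event x) = 0%E ->
  measurable A -> A `<=` sign_event x ->
  (forall w b, A w -> maximizes (Y w) b ->
     199 / 200 <= (dot (sign_vector b) (x ^~ w) / n%:R) ^+ 2) ->
  (P (~` A) <= e%:E)%E ->
  outer_le P [set w | forall b, maximizes (Y w) b ->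
     sign_form (Xhat w) b < 99 / 100 * n%:R ^+ 2] (199 * e).
Proof.
move=> n0 mY HX full mA AS HA PA.
pose B b := [set w | first_maximizer (Y w) b] `&`
           [set w | sign_form (Xhat w) b < 99 / 100 * n%:R ^+ 2].
have HB b := first_maximizer_mass b n0 mY HX full mA AS HA.
have HO b : true -> outer_le P (B b) (199 * fine (P (B b `&` ~` A))).
  have [mB PB] := HB b; move=> _; apply: outer_le_measurable => //.
  by rewrite -[P (B b)]fineK ?fin_num_measure// lee_fin.
have mBA b : measurable (B b `&` ~` A).
  by apply: measurableI; [case: (HB b)|exact: measurableC].
apply: outer_le_sub (outer_le_exists HO) _ _.
  move=> w /= h; have [b hb] := first_maximizer_exists (Y w).
  by exists b => //; split => //; apply: h; case: hb.
rewrite -mulr_sumr ler_wpM2l// sum_fine; last first.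
  by move=> b _; exact: fin_num_measure.
rewrite -lee_fin fineK; last first.
  by rewrite sum_fin_num; apply/allP => /= z /mapP[b _ ->]; exact: fin_num_measure.
apply: le_trans PA; apply: sum_disjoint_le => //; first exact: measurableC.
by move=> b c w [[h1 _] _] [[h2 _] _]; exact: first_maximizer_unique h1 h2.
Qed.

End BayesEstimator.

(** * Exponential rates *)

Section TypicalLandscape.
Context {R : realType}.

Lemma norm_bound_of_grid n (W : 'I_n -> 'I_n -> R) : (0 < n)%N ->
  grid_bound (16 * n) 12 W ->
  forall u v, bil W u v <= 24 * (Num.sqrt (nsq u) * Num.sqrt (nsq v)).
Proof.
move=> n0 HW u v.
have -> : (24 : R) = 2 * 12 by lra.
apply: (@bil_le_of_grid _ _ (16 * n) [set: 'I_n]%SET) => //.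
- by rewrite muln_gt0.
- by rewrite cardsT card_ord.
- by move=> i; rewrite inE.
- by move=> i; rewrite inE.
Qed.

Lemma small_norm_bound_of_grid n (lambda : R) (W : 'I_n -> 'I_n -> R)
    (b := Num.truncn (lambda ^- 6 * n%:R)) : 0 < lambda -> (0 < b)%N ->
  grid_bound (16 * b) ((16 * lambda)^-1) W ->
  forall S : {set 'I_n}, #|S|%:R <= lambda ^- 6 * n%:R ->
  forall u, bil W (restrict S u) (restrict S u) <= nsq (restrict S u) / (8 * lambda).
Proof.
move=> l0 b0 HW S HS u.
have y0 : 0 <= lambda ^- 6 * n%:R by rewrite mulr_ge0 ?ler0n// invr_ge0 exprn_ge0// ltW.
have supp : supported S (restrict S u) by move=> i /negbTE iS; rewrite /restrict iS.
have L0 : (0 < 16 * b)%N by rewrite muln_gt0.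
have Sb : (16 * #|S| <= 16 * b)%N by rewrite leq_mul2l /= truncn_ge_nat.
have := bil_le_of_grid L0 Sb HW supp supp.
rewrite -expr2 sqr_sqrtr ?nsq_ge0//.
have -> : 2 * (16 * lambda)^-1 * nsq (restrict S u) = nsq (restrict S u) / (8 * lambda).
  by field; rewrite gt_eqF.
exact.
Qed.

(** Comparing with [x] itself: both noise terms are at most [24 n], so
    [1 - q <= 48 / lambda] for the squared overlap [q]. *)
Lemma maximizer_overlap n (lambda : R) x (W : 'I_n -> 'I_n -> R) b :
  (0 < n)%N -> 10 ^+ 4 <= lambda -> is_sign x ->
  (forall u v, bil W u v <= 24 * (Num.sqrt (nsq u) * Num.sqrt (nsq v))) ->
  maximizes (observe lambda x W) b ->
  199 / 200 <= (dot (sign_vector b) x / n%:R) ^+ 2.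
Proof.
move=> n0 hl sx HW hb; have n0R : (0 : R) < n%:R by rewrite ltr0n.
have l0 : 0 < lambda by apply: lt_le_trans hl; rewrite exprn_gt0.
have [c xc] := sign_vector_exists sx.
have up u : is_sign u -> bil W u u <= 24 * n%:R.
  by move=> su; have := HW u u; rewrite -expr2 sqr_sqrtr ?nsq_ge0// nsq_sign.
have lo u : is_sign u -> - (24 * n%:R) <= bil W u u.
  move=> su; have := HW (fun i => - u i) u.
  by rewrite bilNl nsqN -expr2 sqr_sqrtr ?nsq_ge0// nsq_sign//; lra.
have := hb c; rewrite /sign_form !quadratic_form_observe -xc.
set s := sign_vector b; have ss : is_sign s by exact: is_sign_vector.
have -> : dot x x = n%:R by rewrite -(nsq_sign sx); apply: eq_bigr => i _; rewrite expr2.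
have -> : dot x s = dot s x by apply: eq_bigr => i _; rewrite mulrC.
have := up s ss; have := lo x sx => h1 h2.
have -> : lambda / n%:R * (n%:R * n%:R) = lambda * n%:R by field; rewrite gt_eqF.
have -> : lambda / n%:R * (dot s x * dot s x) = lambda * n%:R * (dot s x / n%:R) ^+ 2.
  by field; rewrite gt_eqF.
move: ((dot s x / n%:R) ^+ 2) => q h3.
have h4 : lambda * n%:R * (1 - q) <= 48 * n%:R by lra.
have h5 : lambda * (1 - q) <= 48 by rewrite -(ler_pM2r n0R) mulrAC.
rewrite leNgt; apply/negP => h6.
have q1 : 1 / 200 <= 1 - q by lra.
have : 10 ^+ 4 * (1 / 200) <= lambda * (1 - q) by nra.
by lra.
Qed.

Lemma expR_ge_pow (y : R) k : 0 <= y -> y ^+ k <= expR (y *+ k).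
Proof.
move=> y0; rewrite -mulr_natl expRM_natl lerXn2r ?nnegrE ?expR_ge0//.
by have := expR_ge1Dx y; lra.
Qed.

(** At [z = 1/2] and [L = 16 n] there are at most [(2^32 * 9)^n] pairs, against
    [exp (- 36 n)]. *)
Lemma norm_grid_rate n :
  ((2^-1 : R)^-1 ^+ (16 * n) * ((1 + 2^-1) / (1 - 2^-1)) ^+ n) ^+ 2 *
    expR (- (12 ^+ 2 / 4 * n%:R)) <= (9 / 16) ^+ n.
Proof.
have -> : (1 + 2^-1) / (1 - 2^-1) = 3 :> R.
  have -> : 1 - 2^-1 = 2^-1 :> R by lra.
  by rewrite invrK; lra.
rewrite invrK (exprM _ 16 n) -exprMn exprAC.
have -> : expR (- (12 ^+ 2 / 4 * n%:R)) = expR (- 36 : R) ^+ n.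
  by rewrite -expRM_natl; congr expR; lra.
rewrite -exprMn lerXn2r ?nnegrE ?mulr_ge0 ?expR_ge0 ?exprn_ge0//.
rewrite expRN ler_pdivrMr ?expR_gt0//.
have : (2 : R) ^+ 36 <= expR 36.
  rewrite -[in leRHS](mulr1 36) expRM_natl lerXn2r ?nnegrE ?expR_ge0//.
  by have := expR_ge1Dx (1 : R); lra.
by lra.
Qed.

(** For blocks of [lambda^-6 n] coordinates, [z = exp (- lambda)] makes the
    number of pairs [exp (O(lambda^-4) n)], against a Gaussian tail
    [exp (- n / (1024 lambda^2))]. *)
Lemma small_grid_rate n (lambda : R) (b := Num.truncn (lambda ^- 6 * n%:R))
    (z := expR (- lambda)) : 10 ^+ 4 <= lambda ->
  (z^-1 ^+ (16 * b) * ((1 + z) / (1 - z)) ^+ n) ^+ 2 *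
    expR (- ((16 * lambda)^-1 ^+ 2 / 4 * n%:R)) <=
  expR (- (lambda ^- 2 / 2048)) ^+ n.
Proof.
move=> hl; have l0 : 0 < lambda by apply: lt_le_trans hl; rewrite exprn_gt0.
have z0 : 0 < z by exact: expR_gt0.
have y0 : 0 <= lambda ^- 6 * n%:R by rewrite mulr_ge0 ?ler0n// invr_ge0 exprn_ge0// ltW.
have bn : b%:R <= lambda ^- 6 * n%:R by rewrite truncn_le.
have zl : z * lambda ^+ 4 <= 256.
  have := @expR_ge_pow (lambda / 4) 4; rewrite divr_ge0 ?(ltW l0)// => /(_ isT).
  have -> : (lambda / 4) *+ 4 = lambda by rewrite -mulr_natl; field.
  by move=> h; rewrite /z expRN mulrC ler_pdivrMr ?expR_gt0//; lra.
have l4 : 0 < lambda ^+ 4 by rewrite exprn_gt0.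
have l2 : 10 ^+ 8 <= lambda ^+ 2.
  have -> : (10 : R) ^+ 8 = (10 ^+ 4) ^+ 2 by rewrite -exprM.
  by rewrite ler_sqr ?nnegrE ?(ltW l0) ?exprn_ge0.
have l42 : 10 ^+ 8 * lambda ^+ 2 <= lambda ^+ 4.
  have -> : lambda ^+ 4 = lambda ^+ 2 * lambda ^+ 2 by rewrite -exprD.
  by rewrite ler_wpM2r// sqr_ge0.
have z3 : z <= 1 / 3.
  have : z * 10 ^+ 8 <= 256.
    by apply: le_trans zl; rewrite ler_wpM2l ?(ltW z0)//; nra.
  by lra.
have z1 : 0 < 1 - z by lra.
have Sz : (1 + z) / (1 - z) <= expR (3 * z).
  apply: le_trans (expR_ge1Dx _); rewrite ler_pdivrMr//; nra.
have S0 : 0 <= (1 + z) / (1 - z) by rewrite divr_ge0 ?(ltW z1)//; lra.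
have zE : z^-1 ^+ (16 * b) = expR (16 * lambda * b%:R).
  rewrite /z expRN invrK -expRM_natl; congr expR; rewrite natrM; ring.
have h1 : (z^-1 ^+ (16 * b) * ((1 + z) / (1 - z)) ^+ n) ^+ 2 <=
    expR (32 * lambda * b%:R + 6 * z * n%:R).
  rewrite zE; have -> : 32 * lambda * b%:R + 6 * z * n%:R =
    2%:R * (16 * lambda * b%:R + n%:R * (3 * z)) by lra.
  rewrite expRM_natl lerXn2r ?nnegrE ?expR_ge0 ?mulr_ge0 ?exprn_ge0 ?expR_ge0//.
  rewrite expRD ler_wpM2l ?expR_ge0// expRM_natl lerXn2r ?nnegrE ?expR_ge0//.
apply: le_trans (ler_wpM2r (expR_ge0 _) h1) _.
rewrite -expRD -expRM_natl ler_expR.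
have i2 : 0 < lambda ^- 2 by rewrite invr_gt0 exprn_gt0.
have E1 : (16 * lambda)^-1 ^+ 2 / 4 = lambda ^- 2 / 1024 by field; rewrite gt_eqF.
have h2 : 32 * lambda * b%:R <= 32 * lambda * (lambda ^- 6 * n%:R).
  by rewrite ler_wpM2l// mulr_ge0// ltW.
have E2 : 32 * lambda * (lambda ^- 6 * n%:R) = 32 * (lambda ^- 5 * n%:R).
  by field; rewrite gt_eqF.
have i5 : lambda ^- 5 <= lambda ^- 2 * 10 ^- 8.
  rewrite -invfM lef_pV2 ?posrE ?mulr_gt0 ?exprn_gt0//.
  have -> : lambda ^+ 5 = lambda ^+ 2 * (lambda * lambda ^+ 2) by rewrite -exprS -exprD.
  rewrite ler_wpM2l ?sqr_ge0//; apply: le_trans l2 _.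
  by rewrite ler_peMl ?sqr_ge0//; lra.
have i4 : z <= 256 * (lambda ^- 2 * 10 ^- 8).
  rewrite -invfM ler_pdivlMr ?mulr_gt0 ?exprn_gt0//; apply: le_trans zl.
  by rewrite ler_wpM2l ?(ltW z0)// mulrC.
have n0 : 0 <= n%:R :> R by exact: ler0n.
have k1 := ler_wpM2r n0 i5; have k2 := ler_wpM2r n0 i4.
have k3 : 0 <= lambda ^- 2 * n%:R by rewrite mulr_ge0// ltW.
rewrite E1; move: k1 k2 k3 h2; rewrite E2.
move: (lambda ^- 2) (lambda ^- 5) => p q k1 k2 k3 h2.
by lra.
Qed.

Lemma row_rate n (lambda : R) : 10 ^+ 4 <= lambda ->
  expR (n%:R * (expR (- ((lambda / 20) ^+ 2 / 8))
    - (lambda / 20) ^+ 2 / 8 * (lambda ^- 6 / 8))) <=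
  expR (- (lambda ^- 4 / (512 * 100))) ^+ n.
Proof.
move=> hl; have l0 : 0 < lambda by apply: lt_le_trans hl; rewrite exprn_gt0.
rewrite -expRM_natl ler_expR ler_wpM2l ?ler0n//.
have -> : (lambda / 20) ^+ 2 / 8 * (lambda ^- 6 / 8) = lambda ^- 4 / (256 * 100).
  by field; rewrite gt_eqF.
suff : expR (- ((lambda / 20) ^+ 2 / 8)) <= lambda ^- 4 / (512 * 100) by lra.
(* [(lambda / 20)^2 / 8 = 8 v^2], so that [expR] of it is at least [v^16]. *)
pose v := lambda / 160; have v0 : 50 <= v by rewrite /v; lra.
have -> : (lambda / 20) ^+ 2 / 8 = v ^+ 2 *+ 8 by rewrite /v -mulr_natl; field.
have v4 : 0 < v ^+ 4 by rewrite exprn_gt0//; lra.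
have [K [KE K0]] : exists K : R, K = 512 * 100 * 160 ^+ 4 * v ^+ 4 /\ 0 < K.
  by eexists; split; [reflexivity|apply: mulr_gt0 => [|//]; lra].
have -> : lambda ^- 4 / (512 * 100) = K^-1.
  by rewrite KE /v; field; rewrite gt_eqF.
rewrite expRN lef_pV2 ?posrE ?expR_gt0//.
apply: le_trans (expR_ge_pow 8 (sqr_ge0 v)).
have -> : (v ^+ 2) ^+ 8 = v ^+ 12 * v ^+ 4 by rewrite -exprM -exprD.
rewrite KE ler_wpM2r ?(ltW v4)//; apply: (@le_trans _ _ (50 ^+ 12)); first by lra.
by rewrite lerXn2r ?nnegrE//; lra.
Qed.

End TypicalLandscape.

(** * Probability of an atypical landscape *)

Section AtypicalEvents.
Context {R : realType} {d : measure_display} {T : measurableType d}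
  (P : probability T R) (n : nat).
Implicit Types (x : 'I_n -> {RV P >-> R}) (W : 'I_n -> 'I_n -> {RV P >-> R}).

Lemma measurable_not_row_bound (d' : measure_display) (T' : measurableType d')
    (c s : R) (W : 'I_n -> 'I_n -> T' -> R) (x : 'I_n -> R) :
  (forall i j, measurable_fun setT (W i j)) ->
  measurable [set w | ~ row_bound c s (fun i j => W i j w) x].
Proof.
move=> mW; pose Q (S : {set 'I_n}) := (0 < #|S|)%N && (s * n%:R <= #|S|%:R).
rewrite (_ : [set w | _] = [set w | exists2 S, Q S &
    c * #|S|%:R < bil (fun i j => W i j w) (restrict S (fun i => - x i)) x]).
  apply: (measurable_exists_fin (A := fun (S : {set 'I_n}) => [set w |
    c * #|S|%:R < bil (fun i j => W i j w) (restrict S (fun i => - x i)) x])) => S _.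
  by apply: measurable_set_ltr => //; exact: measurable_bil.
by apply/seteqP; split => w /= /not_row_boundE.
Qed.

(** [GOE_row_bound] is about a fixed sign vector; independence carries it over
    to the random one. *)
Lemma outer_le_not_row_bound x W (lambda : R) : (0 < n)%N -> 10 ^+ 4 <= lambda ->
  Z2_sync x W ->
  outer_le P [set w | sign_event x w /\
      ~ row_bound (lambda / 20) (lambda ^- 6 / 8) (fun i j => W i j w) (x ^~ w)]
    (expR (- (lambda ^- 4 / (512 * 100))) ^+ n).
Proof.
move=> n0 hl [_ HW ind].
have l0 : 0 < lambda by apply: lt_le_trans hl; rewrite exprn_gt0.
pose D b := [set w | ~ row_bound (lambda / 20) (lambda ^- 6 / 8)
  (fun i j => W i j w) (sign_vector b)].
have sD b : sigma_of (fun p : 'I_n * 'I_n => W p.1 p.2) (D b).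
  pose G := \bigcup_(p : 'I_n * 'I_n) preimage_set_system setT (W p.1 p.2)
    (@measurable _ R).
  apply: (@measurable_not_row_bound _ (g_sigma_algebraType G)) => i j.
  have h := @measurable_sigma_of R d T _ (fun p : 'I_n * 'I_n => W p.1 p.2) (i, j).
  exact: h.
have PD b : (P (D b) <= (expR (- (lambda ^- 4 / (512 * 100))) ^+ n)%:E)%E.
  apply: le_trans (GOE_row_bound b n0 _ _ HW) _.
  - by rewrite divr_gt0.
  - by rewrite divr_ge0// invr_ge0 exprn_ge0// ltW.
  - by rewrite lee_fin; exact: row_rate.
have e0 : 0 <= expR (- (lambda ^- 4 / (512 * 100))) ^+ n.
  by apply: exprn_ge0; exact: expR_ge0.
apply: outer_le_sub (outer_le_independent_signs e0 ind sD PD) _ (lexx _).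
move=> w [/sign_vector_exists[b xb] hw]; exists b => //; split => //.
by rewrite /D /= -xb.
Qed.

(** Outside the four exceptional events all hypotheses of [landscape] hold. The
    coefficient 200 is 1 for the norm bound and 199 for the Bayes estimator. *)
Lemma atypical_landscape x W (Xhat : T -> 'M[R]_n) (lambda iota : R)
    (Y := observation lambda x W) :
  (0 < n)%N -> 10 ^+ 4 <= lambda -> iota <= 10 ^- 4 ->
  (0 < Num.truncn (lambda ^- 6 * n%:R))%N ->
  Z2_sync x W -> is_Bayes_estimator x Y Xhat ->
  outer_le P [set w | ~ forall ms,
      Bayes_optimal_minimizer lambda iota (Y w) (Xhat w) ms ->
      [set m | global_minimizer lambda (Y w) m] = [set ms; - ms] /\
      [set m | low_energy lambda (Y w) m /\ critical_point lambda (Y w) m]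
        = [set ms; - ms]]
    (200 * (9 / 16) ^+ n + expR (- (lambda ^- 2 / 2048)) ^+ n
      + expR (- (lambda ^- 4 / (512 * 100))) ^+ n).
Proof.
move=> n0 hl hi b0 HZ HX; have [iid HW ind] := HZ.
have l0 : 0 < lambda by apply: lt_le_trans hl; rewrite exprn_gt0.
have [Wsym _ _ _] := HW.
have mS := measurable_sign_event x.
have full := sign_event_full iid.
pose Wm w i j := W i j w.
have O1 : outer_le P [set w | ~ grid_bound (16 * n) 12 (Wm w)] ((9 / 16) ^+ n).
  have L0 : (0 < 16 * n)%N by rewrite muln_gt0.
  apply: outer_le_sub (GOE_grid_bound n0 L0 _ _ _ HW) _ (norm_grid_rate n) => //.
  by lra.
have O2 : outer_le P [set w | ~ grid_bound (16 * Num.truncn (lambda ^- 6 * n%:R))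
    ((16 * lambda)^-1) (Wm w)] (expR (- (lambda ^- 2 / 2048)) ^+ n).
  have L0 : (0 < 16 * Num.truncn (lambda ^- 6 * n%:R))%N by rewrite muln_gt0.
  apply: outer_le_sub (GOE_grid_bound n0 L0 _ (expR_gt0 (- lambda)) _ HW) _
    (small_grid_rate n hl) => //.
  - by rewrite invr_gt0 mulr_gt0.
  - by rewrite expR_lt1 oppr_lt0.
have O3 := outer_le_not_row_bound n0 hl HZ.
have [B1 [mB1 HB1 PB1]] := O1.
pose A := sign_event x `\` B1.
have mA : measurable A by exact: measurableD.
have AN w : A w -> forall u v, bil (Wm w) u v <= 24 * (Num.sqrt (nsq u) * Num.sqrt (nsq v)).
  move=> [_ nB]; apply: norm_bound_of_grid => //.
  by apply: contrapT => h; apply: nB; exact: HB1.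
have PA : (P (~` A) <= ((9 / 16) ^+ n)%:E)%E.
  have -> : ~` A = ~` sign_event x `|` B1 by rewrite /A setDE setCI setCK.
  apply: le_trans (measureU2 P (measurableC mS) mB1) _.
  have full0 : (P (~` sign_event x) <= 0)%E by rewrite full.
  by apply: le_trans (leeD full0 PB1) _; rewrite add0e.
have mY i j : measurable_fun setT (fun w => Y w i j).
  rewrite (_ : (fun w => _) = fun w => lambda / n%:R * (x i w * x j w) + W i j w).
    apply: measurable_funD => //; apply: measurable_funM => //.
    exact: measurable_funM.
  by apply/funext => w; rewrite /Y mxE.
have HA w b : A w -> maximizes (Y w) b ->
    199 / 200 <= (dot (sign_vector b) (x ^~ w) / n%:R) ^+ 2.
  move=> Aw; apply: maximizer_overlap => //; last exact: AN.
  by case: Aw.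
have AS : A `<=` sign_event x by move=> w [].
have O4 := Bayes_estimator_aligned n0 mY HX full mA AS HA PA.
have O0 : outer_le P (~` A) ((9 / 16) ^+ n).
  by apply: outer_le_measurable => //; exact: measurableC.
apply: outer_le_sub (outer_leU (outer_leU (outer_leU O0 O4) O2) O3) _ _; last first.
  by rewrite lerD2r lerD2r; lra.
move=> w /= hw; apply: contrapT => /not_orP[/not_orP[/not_orP[h0 h4] h2] h3].
apply: hw => ms hms.
have Aw : A w by apply: contrapT.
have sx := AS w Aw.
have [b [hb1 hb2]] : exists b, maximizes (Y w) b /\
    99 / 100 * n%:R ^+ 2 <= sign_form (Xhat w) b.
  have /existsNP[b /not_implyP[hb1 hb2]] := h4.
  by exists b; split => //; rewrite leNgt; apply/negP.
apply: (@landscape R n lambda (x ^~ w) (Wm w) n0 hl sx (fun i j => Wsym i j w) (AN w Aw)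
   _ _ iota (sign_vector b) (Xhat w) ms).
- by apply: small_norm_bound_of_grid => //; exact: contrapT.
- by apply: contrapT => h; apply: h3.
- exact: is_sign_vector.
- exact: HA.
- exact: hb2.
- exact: hi.
- exact: hms.
Qed.

End AtypicalEvents.

(** * The limit *)

Section Limits.
Context {R : realType}.

Lemma cvg_sum_geometric (a b c : R) : 0 <= a < 1 -> 0 <= b < 1 -> 0 <= c < 1 ->
  200 * a ^+ n + b ^+ n + c ^+ n @[n --> \oo] --> (0 : R).
Proof.
have e (z : R) : 0 <= z < 1 -> z ^+ n @[n --> \oo] --> (0 : R).
  by move=> /andP[z0 z1]; apply: cvg_expr; rewrite ger0_norm.
move=> ha hb hc.
rewrite -[X in _ --> X]addr0; apply: cvgD; last exact: e.
rewrite -[X in _ --> X]addr0; apply: cvgD; last exact: e.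
by rewrite -[X in _ --> X](mulr0 200); apply: cvgMr; exact: e.
Qed.

Lemma probability_cvg1_of_outer_le (d : nat -> measure_display)
    (T : forall n, measurableType (d n)) (P : forall n, probability (T n) R)
    (G H : forall n, set (T n)) (e : nat -> R) (n0 : nat) :
  with_probability_approaching_1 P G -> e n @[n --> \oo] --> (0 : R) ->
  (forall n, (n0 <= n)%N -> outer_le (P n) (~` H n) (e n)) ->
  with_probability_approaching_1 P (fun n => G n `&` H n).
Proof.
move=> [E [mE EG PE]] e0 He.
have ex n : exists B : set (T n), (n0 <= n)%N ->
    [/\ measurable B, ~` H n `<=` B & (P n B <= (e n)%:E)%E].
  have [/He[B HB]|_] := boolP (n0 <= n)%N; first by exists B.
  by exists set0.
pose B n := projT1 (cid (ex n)).
have HB n : (n0 <= n)%N ->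
    [/\ measurable (B n), ~` H n `<=` B n & (P n (B n) <= (e n)%:E)%E].
  exact: (projT2 (cid (ex n))).
pose F n : set (T n) := if (n0 <= n)%N then E n `\` B n else set0.
exists F; split.
- move=> n; rewrite /F; case: ifP => // /HB[mB _ _]; exact: measurableD.
- move=> n; rewrite /F; case: ifP => // /HB[_ HBn _] w [Ew nBw].
  by split; [exact: EG|apply: contrapT => /HBn].
apply: (@squeeze_cvge _ _ _ _ (fun n => (P n (E n) - (e n)%:E)%E) _ (cst 1%E)).
- exists n0 => // n /= n0n; have [mB _ PB] := HB n n0n.
  rewrite /F n0n; apply/andP; split; last first.
    by apply: probability_le1; exact: measurableD.
  rewrite EFinN leeBlDr// (measureDI (P n) (mE n) mB) leeD2l//.
  apply: le_trans PB; apply: le_measure; [|exact/mem_set|by move=> w []].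
  by apply/mem_set; exact: measurableI.
- rewrite -[X in _ --> X]sube0; apply: cvgeB => //.
  by apply: cvg_EFin; [exact: nearW|exact: e0].
- exact: cvg_cst.
Qed.

End Limits.

Theorem corollary2p2 (R : realType) :
  exists lambda0 : R, 0 < lambda0 /\
  forall lambda : R, lambda0 < lambda ->
  exists iota0 : R, 0 < iota0 /\
  forall iota : R, 0 < iota -> iota < iota0 ->
  forall (d : nat -> measure_display) (T : forall n, measurableType (d n))
    (P : forall n, probability (T n) R)
    (x : forall n, 'I_n -> {RV (P n) >-> R})
    (W : forall n, 'I_n -> 'I_n -> {RV (P n) >-> R})
    (Xhat : forall n, T n -> 'M[R]_n)
    (mstar : forall n, T n -> 'cV[R]_n),
  let Y := fun n => observation lambda (x n) (W n) in
  (forall n, Z2_sync (x n) (W n)) ->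
  (forall n, is_Bayes_estimator (x n) (Y n) (Xhat n)) ->
  with_probability_approaching_1 P (fun n => [set w |
    Bayes_optimal_minimizer lambda iota (Y n w) (Xhat n w) (mstar n w)]) ->
  with_probability_approaching_1 P (fun n => [set w |
    [set m | global_minimizer lambda (Y n w) m]
      = [set mstar n w; - mstar n w] /\
    [set m | low_energy lambda (Y n w) m /\ critical_point lambda (Y n w) m]
      = [set mstar n w; - mstar n w]]).
Proof.
exists (10 ^+ 4); split; first by rewrite exprn_gt0.
move=> lambda hl; exists (10 ^- 4); split; first by rewrite invr_gt0 exprn_gt0.
move=> iota _ hi d T P x W Xhat mstar Y HZ HX Hm.
have l0 : 0 < lambda by apply: lt_trans hl; rewrite exprn_gt0.
pose H n := [set w : T n | forall ms,
  Bayes_optimal_minimizer lambda iota (Y n w) (Xhat n w) ms ->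
  [set m | global_minimizer lambda (Y n w) m] = [set ms; - ms] /\
  [set m | low_energy lambda (Y n w) m /\ critical_point lambda (Y n w) m]
    = [set ms; - ms]].
pose e n : R := 200 * (9 / 16) ^+ n + expR (- (lambda ^- 2 / 2048)) ^+ n
      + expR (- (lambda ^- 4 / (512 * 100))) ^+ n.
have rate (k : R) : 0 < k -> 0 <= expR (- k) < 1.
  by move=> k0; rewrite expR_ge0 expR_lt1 oppr_lt0.
have e0 : e n @[n --> \oo] --> (0 : R).
  apply: cvg_sum_geometric; first by lra.
  - by apply: rate; apply: divr_gt0; [rewrite invr_gt0 exprn_gt0|lra].
  - by apply: rate; apply: divr_gt0; [rewrite invr_gt0 exprn_gt0|lra].
(* Blocks of [lambda^-6 n] coordinates are nonempty from this size on. *)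
pose N := (Num.truncn (lambda ^+ 6)).+1.
have bad n : (N <= n)%N -> outer_le (P n) (~` H n) (e n).
  move=> Nn; apply: atypical_landscape => //.
  - exact: leq_trans Nn.
  - exact: ltW.
  - exact: ltW.
  rewrite truncn_gt_nat mulrC ler_pdivlMr ?exprn_gt0// mul1r.
  have /andP[_ /ltW h] := truncn_itv (exprn_ge0 6 (ltW l0)).
  by apply: le_trans h _; rewrite ler_nat.
have [E [mE HE PE]] := probability_cvg1_of_outer_le Hm e0 bad.
exists E; split => // n w /HE[hms hH]; exact: hH hms.
Qed.
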